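(* Let $M$ be a connected one-manifold (one of $\mathbb{R}$, $[0,1)$, $[0,1]$, $S^1$), and let $G \subset \mathrm{Homeo}_+(M)$ be a finitely-generated virtually nilpotent subgroup. Let $d = d(G)$ be the degree of polynomial growth of $G$. Then for every real $\alpha$ with $0 < \alpha < 1/d$ (interpreting $1/0 = \infty$), there exists a homeomorphism $\psi \colon M \to M$ such that $\psi G \psi^{-1} \subset \mathrm{Diff}_+^{1+\alpha}(M)$.
   Context: $\mathrm{Homeo}_+(M)$ is the group of orientation-preserving homeomorphisms of $M$, and $\mathrm{Diff}_+^{1+\alpha}(M)$ the group of orientation-preserving $C^1$ diffeomorphisms of $M$ whose derivative is $\alpha$-Hölder continuous. For a finitely generated group $G$ with finite symmetric generating set $S$, let $|g|_S$ be the word length and $\mathscr{G}_{(G,S)}(n) = \#\{g \in G : |g|_S \le n\}$. For nondecreasing $f,h\colon\mathbb{N}\to\mathbb{N}$ write $f \lesssim h$ if there is $C>0$ with $f(n) \le C h(Cn)$ for all $n$, and $f \sim h$ if $f\lesssim h$ and $h \lesssim f$; the class of $\mathscr{G}_{(G,S)}$ does not depend on $S$. A finitely generated virtually nilpotent group $G$ has polynomial growth: there is an integer $d(G)\ge 0$ with $\mathscr{G}_{(G,S)}(n) \sim n^{d(G)}$; this $d(G)$ is the degree of polynomial growth. *)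

(* Defs.v *)
From Stdlib Require Import Reals Lra List.
Open Scope R_scope.

(** The four connected one-manifolds, realized on subsets of R.
    The circle S^1 = R/Z is realized on [0,1) with the circle metric. *)
Inductive oneManifold := MR | Mhalf | Mclosed | Mcircle.

Definition inM (m : oneManifold) (x : R) : Prop :=
  match m with
  | MR => True
  | Mhalf => 0 <= x < 1
  | Mclosed => 0 <= x <= 1
  | Mcircle => 0 <= x < 1
  end.

Definition pt (m : oneManifold) : Type := {x : R | inM m x}.
Definition val {m} (x : pt m) : R := proj1_sig x.

(** Signed difference y - x; on the circle, the representative in (-1/2,1/2]. *)
Definition sdiff (m : oneManifold) (y x : R) : R :=
  match m with
  | Mcircle =>
      let t := y - x in
      if Rlt_dec (1/2) t then t - 1
      else if Rle_dec t (-(1/2)) then t + 1 else t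
  | _ => y - x
  end.

Definition dist (m : oneManifold) (x y : pt m) : R := Rabs (sdiff m (val y) (val x)).

Definition Mmap (m : oneManifold) : Type := pt m -> pt m.
Definition mcomp {m} (f g : Mmap m) : Mmap m := fun x => f (g x).
Definition idm {m} : Mmap m := fun x => x.

Definition continuous_M (m : oneManifold) (f : Mmap m) : Prop :=
  forall x eps, 0 < eps -> exists delta, 0 < delta /\
    forall y, dist m x y < delta -> dist m (f x) (f y) < eps.

Definition inverse_maps {m} (f g : Mmap m) : Prop :=
  mcomp g f = idm /\ mcomp f g = idm.

Definition is_homeo (m : oneManifold) (f : Mmap m) : Prop :=
  exists g, inverse_maps f g /\ continuous_M m f /\ continuous_M m g.

Definition cyc (a b c : R) : Prop := (a < b < c) \/ (b < c < a) \/ (c < a < b).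

Definition orient_pres (m : oneManifold) (f : Mmap m) : Prop :=
  match m with
  | Mcircle => forall x y z : pt m, cyc (val x) (val y) (val z) ->
                 cyc (val (f x)) (val (f y)) (val (f z))
  | _ => forall x y : pt m, val x < val y -> val (f x) < val (f y)
  end.

Definition Homeo_plus (m : oneManifold) (f : Mmap m) : Prop :=
  is_homeo m f /\ orient_pres m f.

(** f has derivative l at x (one-sided at boundary points; via the lift on S^1). *)
Definition has_deriv (m : oneManifold) (f : Mmap m) (x : pt m) (l : R) : Prop :=
  forall eps, 0 < eps -> exists delta, 0 < delta /\
    forall y, 0 < dist m x y < delta ->
      Rabs (sdiff m (val (f y)) (val (f x)) / sdiff m (val y) (val x) - l) < eps.

Definition C1_with (m : oneManifold) (f : Mmap m) (df : pt m -> R) : Prop :=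
  (forall x, has_deriv m f x (df x)) /\
  (forall x eps, 0 < eps -> exists delta, 0 < delta /\
     forall y, dist m x y < delta -> Rabs (df y - df x) < eps).

Definition Diff1alpha (m : oneManifold) (alpha : R) (f : Mmap m) : Prop :=
  Homeo_plus m f /\
  exists df, C1_with m f df /\
    (exists g dg, inverse_maps f g /\ C1_with m g dg) /\
    exists C, forall x y, x <> y ->
      Rabs (df x - df y) <= C * Rpower (dist m x y) alpha.

Definition is_subgroup (m : oneManifold) (G : Mmap m -> Prop) : Prop :=
  G idm /\ (forall f g, G f -> G g -> G (mcomp f g)) /\
  (forall f, G f -> exists g, G g /\ inverse_maps f g).

Definition eval_word {m} (w : list (Mmap m)) : Mmap m := fold_right mcomp idm w.

Definition word_in {m} (S : list (Mmap m)) (w : list (Mmap m)) : Prop :=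
  forall s, In s w -> In s S.

Definition symmetric_set {m} (S : list (Mmap m)) : Prop :=
  forall s, In s S -> exists t, In t S /\ inverse_maps s t.

Definition generates {m} (S : list (Mmap m)) (G : Mmap m -> Prop) : Prop :=
  (forall s, In s S -> G s) /\
  (forall g, G g <-> exists w, word_in S w /\ g = eval_word w).

Definition in_ball {m} (S : list (Mmap m)) (n : nat) (g : Mmap m) : Prop :=
  exists w, word_in S w /\ (length w <= n)%nat /\ g = eval_word w.

Definition has_card {T : Type} (P : T -> Prop) (k : nat) : Prop :=
  exists l, NoDup l /\ length l = k /\ forall x, In x l <-> P x.

Definition poly_growth {m} (S : list (Mmap m)) (d : nat) : Prop :=
  exists C : nat, (1 <= C)%nat /\
    forall n k, (1 <= n)%nat ->
      (has_card (in_ball S n) k -> (k <= C * (C * n) ^ d)%nat) /\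
      (has_card (in_ball S (C * n)) k -> (n ^ d <= C * k)%nat).

Inductive gen_by {m} (A : Mmap m -> Prop) : Mmap m -> Prop :=
| gb_id : gen_by A idm
| gb_mul : forall a f, A a -> gen_by A f -> gen_by A (mcomp a f)
| gb_inv : forall a ai f, A a -> inverse_maps a ai -> gen_by A f -> gen_by A (mcomp ai f).

Definition is_commutator {m} (x y z : Mmap m) : Prop :=
  exists xi yi, inverse_maps x xi /\ inverse_maps y yi /\
    z = mcomp xi (mcomp yi (mcomp x y)).

(** Lower central series: lcs H 0 = H = gamma_1, lcs H (i+1) = [H, lcs H i]. *)
Fixpoint lcs {m} (H : Mmap m -> Prop) (i : nat) : Mmap m -> Prop :=
  match i with
  | O => H
  | S i' => gen_by (fun z => exists x y, H x /\ lcs H i' y /\ is_commutator x y z)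
  end.

Definition nilpotent {m} (H : Mmap m -> Prop) : Prop :=
  exists c, forall z, lcs H c z -> z = idm.

Definition finite_index {m} (H G : Mmap m -> Prop) : Prop :=
  exists reps : list (Mmap m), forall g, G g ->
    exists r h, In r reps /\ H h /\ g = mcomp r h.

Definition virtually_nilpotent {m} (G : Mmap m -> Prop) : Prop :=
  exists H, (forall h, H h -> G h) /\ is_subgroup m H /\ finite_index H G /\ nilpotent H.

(* Main.v *)
(** If [mu] is a measure whose distribution function is [psi], then conjugating by [psi] turns the
    Radon-Nikodym derivative of [g_* mu] into the derivative of [g], so it suffices to find [mu] for
    which these derivatives are Hoelder in terms of [mu] itself.

    All cases reduce to a group of increasing homeomorphisms of the line commuting with [x + 1]: lift
    the circle; close up an interval into a circle by a common fixed point; identify the line with (0,1)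
    by [theta].

    Structure. Polynomial growth excludes ping-pong, so the supports of the elements form a laminar
    family; a chain of [k] nested supports gives [n ^ k] elements in a ball of radius [O(n)], so chains
    are short. Inside a minimal support meeting a given open set, either some interval is disjoint from
    its translates (except by elements that fix it pointwise), or Hoelder's theorem on Archimedean groups
    conjugates the action of the stabilizer to translations. So either the whole group is conjugate to
    translations, or every open set meets the orbit of a bounded interval [J] with a chart [J -> R] in
    which the stabilizer of [J] acts by translations.

    Smoothing. Put on such a [J] the densities [1 / (A^2 + t^2)], spread them over the orbit by all
    elements [g] of the group at once, with [A = (|g| + N)^(1/alpha)], and add up over countably many
    disjoint orbits whose union is dense. The total mass is finite because [1/alpha > d]. Changing [|g|]
    by a bounded amount changes the density by a factor [1 + O(r^(-alpha))], where [r^2 = A^2 + t^2],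
    whereas the mass lying within distance [r] of the point is of order [1/r]; this is the Hoelder
    estimate. *)

Require Import Defs.
From Stdlib Require Import Reals Lra Lia ZArith List Permutation Cantor.
From Stdlib Require Import Classical ClassicalEpsilon FunctionalExtensionality ProofIrrelevance.
Import Defs.
Open Scope R_scope.

(** * Increasing bijections of the line, and the absence of resilient orbits *)

(** On one interval [J] infinitely many densities overlap, since the whole stabilizer contributes
    and its translations may be dense. Precomposition with a group element permutes the summands and
    changes only their scales, so the candidate derivative is a ratio of two sums of kernels. Its
    error over a segment of mass [delta] is treated in two regimes. If the segment is long, [1/r] is
    at most a multiple of [delta] for every radius [r] met on it, and the ratio of masses and the
    derivative are both [1 + O(delta^alpha)]. If it is short, of chart length [s], the first-order
    terms cancel exactly and the remaining second difference gains both [s/r] and [r^(-alpha)].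

    The exponent [1/alpha] is used because a bounded change of [v] changes [v^(1/alpha)] by a
    relative amount [O(1/v)], and [1/v] is the power [-alpha] of the scale.

    For [d = 0] the exponent [alpha] may exceed 1, where the kernel estimates fail; averaging over a
    finite group then gives exact translations. On the line, [theta] has poles at the ends, so
    regularity on [(0, 1)] has to be carried across them. *)

Definition incr (F : R -> R) : Prop := forall x y, x < y -> F x < F y.
Definition inv_of (F G : R -> R) : Prop := (forall x, G (F x) = x) /\ (forall x, F (G x) = x).

Record igroup (Gam : (R -> R) -> Prop) : Prop := {
  ig_id : Gam (fun x => x);
  ig_comp : forall F G, Gam F -> Gam G -> Gam (fun x => F (G x));
  ig_inv : forall F, Gam F -> exists G, Gam G /\ inv_of F G;
  ig_incr : forall F, Gam F -> incr F }.

Notation it n F := (fun x => Nat.iter n F x).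

Lemma incr_le F x y : incr F -> x <= y -> F x <= F y.
Proof. intros HF [H| ->]; [left; auto | lra]. Qed.

Lemma incr_lt_inv F x y : incr F -> F x < F y -> x < y.
Proof.
  intros HF H. destruct (Rlt_le_dec x y) as [|Hle]; auto.
  apply (incr_le F) in Hle; auto; lra.
Qed.

Lemma incr_le_inv F x y : incr F -> F x <= F y -> x <= y.
Proof.
  intros HF H. destruct (Rle_lt_dec x y) as [|Hlt]; auto.
  apply HF in Hlt; lra.
Qed.

Lemma incr_inj F x y : incr F -> F x = F y -> x = y.
Proof. intros HF H. apply Rle_antisym; apply (incr_le_inv F); auto; lra. Qed.

Lemma inv_of_sym F G : inv_of F G -> inv_of G F.
Proof. intros [H1 H2]; split; auto. Qed.

Lemma inv_of_incr F G : incr F -> inv_of F G -> incr G.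
Proof.
  intros HF [H1 H2] x y Hxy. apply (incr_lt_inv F); auto. now rewrite !H2.
Qed.

Lemma it_succ_r n (F : R -> R) x : Nat.iter (S n) F x = Nat.iter n F (F x).
Proof. apply Nat.iter_succ_r. Qed.

Lemma it_add n m (F : R -> R) x : Nat.iter (n + m) F x = Nat.iter n F (Nat.iter m F x).
Proof. apply Nat.iter_add. Qed.

Lemma it_incr n F : incr F -> incr (it n F).
Proof.
  intros HF. induction n as [|n IH]; intros x y Hxy; simpl; auto.
Qed.

Lemma it_inv n F G : inv_of F G -> inv_of (it n F) (it n G).
Proof.
  intros [H1 H2]. induction n as [|n [IH1 IH2]]; split; intros x; simpl; auto.
  - rewrite <- Nat.iter_swap, H1. apply IH1.
  - rewrite <- Nat.iter_swap, H2. apply IH2.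
Qed.

Lemma it_fix n (F : R -> R) x : F x = x -> Nat.iter n F x = x.
Proof. intros H. induction n; simpl; congruence. Qed.

Lemma it_mul n m (F : R -> R) x : Nat.iter (n * m) F x = Nat.iter n (it m F) x.
Proof. induction n; simpl; auto. now rewrite it_add, IHn. Qed.

Lemma it_in Gam n F : igroup Gam -> Gam F -> Gam (it n F).
Proof.
  intros HG HF. induction n as [|n IH]; simpl.
  - apply (ig_id _ HG).
  - apply (ig_comp _ HG F); auto.
Qed.

Lemma it_le_step n F x : incr F -> x <= F x -> Nat.iter n F x <= Nat.iter (S n) F x.
Proof. intros HF H. rewrite it_succ_r. apply (incr_le (it n F)); auto. now apply it_incr. Qed.

Lemma it_le n F x : incr F -> F x <= x -> Nat.iter n F x <= x.
Proof.
  intros HF H. induction n; [simpl; lra|]. simpl. apply Rle_trans with (F x); auto. now apply incr_le.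
Qed.

(** Otherwise the orbit of [x] is nondecreasing and bounded by [y], and its supremum is a fixed
    point in [[x, y]]. *)
Lemma escape_up F G x y : incr F -> inv_of F G -> x <= F x ->
  (forall z, x <= z <= y -> F z <> z) -> exists n, y < Nat.iter n F x.
Proof.
  intros HF HI Hx Hno. apply NNPP; intros Hn.
  assert (Hb : forall n, Nat.iter n F x <= y).
  { intros n. destruct (Rle_lt_dec (Nat.iter n F x) y); auto. exfalso; eauto. }
  destruct (completeness (fun r => exists n, r = Nat.iter n F x)) as [z [Hz1 Hz2]].
  - exists y. intros r [n ->]. auto.
  - exists x. now exists O.
  - assert (Hxz : x <= z) by (apply Hz1; now exists O).
    assert (Hzy : z <= y) by (apply Hz2; intros r [n ->]; auto).
    apply (Hno z); [lra|]. pose proof (inv_of_incr _ _ HF HI) as HGi. destruct HI as [H1 H2].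
    apply Rle_antisym.
    + rewrite <- (H2 z) at 2. apply incr_le; auto. apply Hz2. intros r [n ->].
      apply (incr_le_inv F); auto. rewrite H2. apply Hz1. now exists (S n).
    + apply Hz2. intros r [n ->]. apply Rle_trans with (Nat.iter (S n) F x).
      * now apply it_le_step.
      * simpl. apply incr_le; auto. apply Hz1. now exists n.
Qed.

(** Conjugation by [x -> - x], which turns statements about right ends into statements about left
    ends. *)
Definition rfl (F : R -> R) : R -> R := fun x => - F (- x).

Lemma rfl_rfl F : rfl (rfl F) = F.
Proof. apply functional_extensionality; intros x; unfold rfl. now rewrite !Ropp_involutive. Qed.

Lemma rfl_incr F : incr F -> incr (rfl F).
Proof. intros HF x y Hxy. unfold rfl. assert (F (-y) < F (-x)) by (apply HF; lra). lra. Qed.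

Lemma rfl_inv F G : inv_of F G -> inv_of (rfl F) (rfl G).
Proof. intros [H1 H2]; split; intros x; unfold rfl; rewrite Ropp_involutive, ?H1, ?H2; lra. Qed.

Lemma rfl_it n F x : Nat.iter n (rfl F) x = - Nat.iter n F (- x).
Proof.
  induction n; simpl; [lra|]. rewrite IHn. unfold rfl at 1. now rewrite Ropp_involutive.
Qed.

Lemma escape_down F G x y : incr F -> inv_of F G -> F x <= x ->
  (forall z, y <= z <= x -> F z <> z) -> exists n, Nat.iter n F x < y.
Proof.
  intros HF HI Hx Hno.
  destruct (escape_up (rfl F) (rfl G) (- x) (- y)) as [n Hn].
  - now apply rfl_incr.
  - now apply rfl_inv.
  - unfold rfl. rewrite Ropp_involutive. lra.
  - intros z Hz Hfix. unfold rfl in Hfix. apply (Hno (- z)); lra.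
  - exists n. rewrite rfl_it, Ropp_involutive in Hn. lra.
Qed.

(** An intermediate value argument without continuity: the orbit of [x] would pass [y] although it
    stays below the orbit of [y]. *)
Lemma fix_between F G x y : incr F -> inv_of F G -> x <= y -> x <= F x -> F y <= y ->
  exists z, x <= z <= y /\ F z = z.
Proof.
  intros HF HI Hxy Hx Hy. apply NNPP; intros Hn.
  destruct (escape_up F G x y) as [n Hlt]; auto.
  { intros z Hz Hf. apply Hn. eauto. }
  pose proof (it_le n F y HF Hy).
  pose proof (incr_le (it n F) x y (it_incr n F HF) Hxy). simpl in *. lra.
Qed.

(** Ping-pong for semigroups: two elements with disjoint images inside a common invariant set
    generate a free semigroup. *)
Definition no_pp (Gam : (R -> R) -> Prop) : Prop :=
  forall F G (X : R -> Prop) x0, Gam F -> Gam G -> X x0 ->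
    (forall u, X u -> X (F u) /\ X (G u)) ->
    (forall u v, X u -> X v -> F u <> G v) -> False.

Definition rflG (Gam : (R -> R) -> Prop) : (R -> R) -> Prop := fun F => Gam (rfl F).

Lemma rflG_igroup Gam : igroup Gam -> igroup (rflG Gam).
Proof.
  intros HG. split.
  - unfold rflG. replace (rfl (fun x => x)) with (fun x : R => x). { apply (ig_id _ HG). }
    apply functional_extensionality; intros x; unfold rfl; lra.
  - unfold rflG. intros F G HF HGG.
    replace (rfl (fun x => F (G x))) with (fun x => rfl F (rfl G x)). { now apply (ig_comp _ HG (rfl F)). }
    apply functional_extensionality; intros x; unfold rfl. now rewrite Ropp_involutive.
  - intros F HF. destruct (ig_inv _ HG _ HF) as [G [HGG HI]]. exists (rfl G). split.
    + unfold rflG. now rewrite rfl_rfl.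
    + rewrite <- (rfl_rfl F). now apply rfl_inv.
  - intros F HF. rewrite <- (rfl_rfl F). apply rfl_incr. now apply (ig_incr _ HG).
Qed.

Lemma rflG_no_pp Gam : no_pp Gam -> no_pp (rflG Gam).
Proof.
  intros HP F G X x0 HF HGG Hx0 Hcl Hd.
  apply (HP (rfl F) (rfl G) (fun u => X (- u)) (- x0)); auto.
  - now rewrite Ropp_involutive.
  - intros u Hu. unfold rfl. rewrite !Ropp_involutive. auto.
  - intros u v Hu Hv E. apply (Hd (- u) (- v)); auto. unfold rfl in E. lra.
Qed.

Section Dynamics.
Variable Gam : (R -> R) -> Prop.
Hypothesis HG : igroup Gam.
Hypothesis HP : no_pp Gam.

(* A contraction [g^n] towards [e] and its composition with [f] would play ping-pong on [e, f (f e)). *)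
Lemma no_resilient f g e : Gam f -> Gam g -> g e = e -> e < f e ->
  (forall u, e < u <= f (f e) -> g u <> u) -> False.
Proof.
  intros Hf Hg He Hfe Hno.
  pose proof (ig_incr _ HG f Hf) as If.
  assert (H2 : f e < f (f e)) by now apply If.
  assert (Hw : exists k ki, Gam k /\ inv_of k ki /\ k e = e /\ k (f (f e)) <= f (f e) /\
     (forall u, e < u <= f (f e) -> k u <> u)).
  { destruct (ig_inv _ HG g Hg) as [gi [Hgi HI]].
    destruct (Rle_lt_dec (g (f (f e))) (f (f e))) as [Hle|Hlt].
    - exists g, gi; auto.
    - exists gi, g. split; [auto|split; [now apply inv_of_sym|]]. destruct HI as [I1 I2].
      split; [rewrite <- He at 1; apply I1|]. split.
      + rewrite <- (I1 (f (f e))) at 2. apply incr_le; [apply (ig_incr _ HG); auto|lra].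
      + intros u Hu E. apply (Hno u Hu). rewrite <- E at 1. apply I2. }
  destruct Hw as (k & ki & Hk & HI & Ke & Ky & Kno).
  pose proof (ig_incr _ HG k Hk) as Ik.
  destruct (escape_down k ki (f (f e)) (f e)) as [n Hn]; auto.
  { intros z Hz. apply Kno. lra. }
  pose proof (it_incr n k Ik) as Ikn. pose proof (it_fix n k e Ke) as Fe.
  apply (HP (it n k) (fun x => f (Nat.iter n k x)) (fun u => e <= u < f (f e)) e).
  - now apply it_in.
  - apply (ig_comp _ HG f); auto. now apply it_in.
  - lra.
  - intros u [Hu1 Hu2].
    assert (Hl : e <= Nat.iter n k u) by (rewrite <- Fe at 1; apply (incr_le (it n k)); auto).
    assert (Hr : Nat.iter n k u < f e).
    { apply Rlt_trans with (Nat.iter n k (f (f e))); auto. }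
    split; [lra|]. pose proof (incr_le f _ _ If Hl). pose proof (If _ _ Hr). lra.
  - intros u v [Hu1 Hu2] [Hv1 Hv2].
    assert (Hl : e <= Nat.iter n k v) by (rewrite <- Fe at 1; apply (incr_le (it n k)); auto).
    assert (Hr : Nat.iter n k u < f e).
    { apply Rlt_trans with (Nat.iter n k (f (f e))); auto. }
    pose proof (incr_le f _ _ If Hl). lra.
Qed.

(** A bounded connected component of the support of [h]. *)
Definition comp (h : R -> R) (a b : R) : Prop :=
  a < b /\ h a = a /\ h b = b /\ forall u, a < u < b -> h u <> u.

Lemma comp_stays h a b u : Gam h -> comp h a b -> a < u < b -> a < h u < b.
Proof.
  intros Hh (Hab & Ha & Hb & _) Hu. pose proof (ig_incr _ HG h Hh) as I.
  split; [rewrite <- Ha at 1|rewrite <- Hb at 1]; apply I; lra.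
Qed.

(** If [a < k a], then [no_resilient] for [k] and [h] at [a] forces [k (k a)] to reach [b]. On the
    other hand [h] or its inverse moves [k a], the left end of the component [(k a, k b)] of
    [k h k^-1], to the right; [no_resilient] at [k a] then forces [k b < b]. Both together
    contradict [k (k a) < k b]. *)
Lemma comp_right h a b k u : Gam h -> Gam k -> comp h a b ->
  a < u < b -> a < k u < b -> ~ a < k a.
Proof.
  intros Hh Hk Hc Hu Hku Hka. pose proof (ig_incr _ HG k Hk) as Ik.
  assert (Hka2 : k a < b). { apply Rlt_trans with (k u); [apply Ik|]; lra. }
  assert (Hkk : b <= k (k a)).
  { destruct (Rle_lt_dec b (k (k a))) as [|Hlt]; auto. exfalso.
    apply (no_resilient k h a); auto; [apply Hc|]. intros v Hv. apply Hc. lra. }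
  destruct (ig_inv _ HG k Hk) as [ki [Hki KI]]. destruct (ig_inv _ HG h Hh) as [hi [Hhi HI]].
  assert (Hex : exists h', Gam h' /\ comp h' a b /\ k a < h' (k a)).
  { destruct (Rtotal_order (k a) (h (k a))) as [Hlt|[E|Hgt]].
    - exists h; auto.
    - exfalso. destruct Hc as (_ & _ & _ & Hc). apply (Hc (k a)); auto.
    - exists hi. split; auto. destruct HI as [I1 I2]. destruct Hc as (C1 & C2 & C3 & C4). split.
      + repeat split; auto; [rewrite <- C2 at 1; auto|rewrite <- C3 at 1; auto|].
        intros v Hv E. apply (C4 v Hv). rewrite <- E at 1. auto.
      + rewrite <- (I1 (k a)) at 1. apply (ig_incr _ HG hi Hhi). auto. }
  destruct Hex as (h' & Hh' & Hc' & Hlt).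
  assert (Hkb : k b < b).
  { destruct (Rlt_le_dec (h' (h' (k a))) (k b)) as [Hl|Hl].
    - exfalso. apply (no_resilient h' (fun x => k (h (ki x))) (k a)); auto.
      + apply (ig_comp _ HG k); auto. apply (ig_comp _ HG h); auto.
      + destruct KI as [K1 _]. rewrite K1. f_equal. apply Hc.
      + intros v Hv E. destruct KI as [K1 K2].
        apply (proj2 (proj2 (proj2 Hc)) (ki v)).
        * pose proof (ig_incr _ HG ki Hki) as Iki.
          rewrite <- (K1 a), <- (K1 b). split; apply Iki; lra.
        * apply (incr_inj k); auto. now rewrite K2.
    - apply Rle_lt_trans with (1 := Hl).
      apply (comp_stays h' a b); auto. apply (comp_stays h' a b); auto. }
  assert (k (k a) < k b) by now apply Ik. lra.
Qed.

End Dynamics.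

Lemma rfl_comp h a b : comp h a b -> comp (rfl h) (- b) (- a).
Proof.
  intros (H1 & H2 & H3 & H4). unfold comp, rfl. rewrite !Ropp_involutive.
  repeat split; try lra. intros u Hu E. apply (H4 (- u)); lra.
Qed.

Section Laminar.
Variable Gam : (R -> R) -> Prop.
Hypothesis HG : igroup Gam.
Hypothesis HP : no_pp Gam.

Lemma no_resilient_left f g e : Gam f -> Gam g -> g e = e -> f e < e ->
  (forall u, f (f e) <= u < e -> g u <> u) -> False.
Proof.
  intros Hf Hg He Hfe Hno.
  apply (no_resilient (rflG Gam) (rflG_igroup _ HG) (rflG_no_pp _ HP) (rfl f) (rfl g) (- e)).
  - unfold rflG. now rewrite rfl_rfl.
  - unfold rflG. now rewrite rfl_rfl.
  - unfold rfl. rewrite Ropp_involutive. lra.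
  - unfold rfl. rewrite Ropp_involutive. lra.
  - unfold rfl. rewrite !Ropp_involutive. intros u Hu E. apply (Hno (- u)); lra.
Qed.

Lemma comp_left h a b k u : Gam h -> Gam k -> comp h a b ->
  a < u < b -> a < k u < b -> ~ k b < b.
Proof.
  intros Hh Hk Hc Hu Hku Hkb.
  apply (comp_right (rflG Gam) (rflG_igroup _ HG) (rflG_no_pp _ HP) (rfl h) (- b) (- a) (rfl k) (- u)).
  - unfold rflG. now rewrite rfl_rfl.
  - unfold rflG. now rewrite rfl_rfl.
  - now apply rfl_comp.
  - lra.
  - unfold rfl. rewrite Ropp_involutive. lra.
  - unfold rfl. rewrite Ropp_involutive. lra.
Qed.

(** Laminarity: the image of a component under a group element is either disjoint from the component
    or equal to it. The one-sided lemmas are applied to [k] and to its inverse. *)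
Lemma comp_fix_ends h a b k u : Gam h -> Gam k -> comp h a b ->
  a < u < b -> a < k u < b -> k a = a /\ k b = b.
Proof.
  intros Hh Hk Hc Hu Hku. destruct (ig_inv _ HG k Hk) as [ki [Hki [K1 K2]]].
  pose proof (comp_right Gam HG HP h a b k u Hh Hk Hc Hu Hku).
  pose proof (comp_left h a b k u Hh Hk Hc Hu Hku).
  assert (Hu' : a < ki (k u) < b) by now rewrite K1.
  pose proof (comp_right Gam HG HP h a b ki (k u) Hh Hki Hc Hku Hu').
  pose proof (comp_left h a b ki (k u) Hh Hki Hc Hku Hu').
  pose proof (ig_incr _ HG ki Hki) as I.
  split; apply Rle_antisym.
  - lra.
  - apply (incr_le_inv ki); auto. rewrite K1. lra.
  - apply (incr_le_inv ki); auto. rewrite K1. lra.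
  - lra.
Qed.

End Laminar.

(** * Groups of polynomial growth commuting with the unit translation *)

Definition shift : R -> R := fun x => x + 1.

(* In [lg_growth] the window of length 1 prevents two translates of one element from being counted. *)
Record lgroup (Gam : (R -> R) -> Prop) (L : (R -> R) -> nat) (C d : nat) : Prop := {
  lg_ig : igroup Gam;
  lg_shift : Gam shift;
  lg_com : forall F, Gam F -> forall x, F (x + 1) = F x + 1;
  lg_Lcomp : forall F G, Gam F -> Gam G -> (L (fun x => F (G x)) <= L F + L G)%nat;
  lg_Linv : forall F G, Gam F -> inv_of F G -> L G = L F;
  lg_Lshift : L shift = O;
  lg_growth : forall n z x l, (1 <= n)%nat -> NoDup l ->
    (forall F, In F l -> Gam F /\ (L F <= n)%nat /\ z <= F x < z + 1) ->
    (length l <= C * n ^ d)%nat }.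

Definition btest (P : Prop) : bool := if excluded_middle_informative P then true else false.

Lemma btest_true P : btest P = true <-> P.
Proof. unfold btest. destruct (excluded_middle_informative P); split; auto; discriminate. Qed.

Lemma btest_false P : btest P = false <-> ~ P.
Proof. unfold btest. destruct (excluded_middle_informative P); split; auto; try discriminate; tauto. Qed.

Lemma exp_beats_poly c e : exists k, (1 <= k)%nat /\ (c * k ^ e < 2 ^ k)%nat.
Proof.
  (* With [k] a power of two only exponents have to be compared:
     [c + 2 * m * e <= m + m ^ 2 < 4 ^ m]. *)
  set (m := (c + 2 * e)%nat). exists (2 ^ (2 * m))%nat.
  assert (Hm : (m + 1 <= 2 ^ m)%nat). { pose proof (Nat.pow_gt_lin_r 2 m). lia. }
  assert (E : (2 ^ (2 * m) = 2 ^ m * 2 ^ m)%nat). { rewrite <- Nat.pow_add_r. f_equal. lia. }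
  split; [rewrite E; nia|].
  rewrite <- Nat.pow_mul_r.
  apply Nat.lt_le_trans with (2 ^ (c + 2 * m * e))%nat.
  - rewrite Nat.pow_add_r. apply Nat.mul_lt_mono_pos_r.
    + pose proof (Nat.pow_nonzero 2 (2 * m * e)). lia.
    + apply Nat.pow_gt_lin_r. lia.
  - apply Nat.pow_le_mono_r; [lia|]. rewrite E. nia.
Qed.

Section Growth.
Variables (Gam : (R -> R) -> Prop) (L : (R -> R) -> nat) (C d : nat).
Hypothesis HL : lgroup Gam L C d.
Let HG := lg_ig _ _ _ _ HL.

Lemma com_n F n x : Gam F -> F (x + INR n) = F x + INR n.
Proof.
  intros HF. induction n as [|n IH].
  - simpl. now rewrite !Rplus_0_r.
  - rewrite S_INR. rewrite <- Rplus_assoc, (lg_com _ _ _ _ HL F HF), IH. lra.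
Qed.

Lemma L_id : L (fun x => x) = O.
Proof.
  destruct (ig_inv _ HG shift (lg_shift _ _ _ _ HL)) as [G [HGG HI]].
  pose proof (lg_Linv _ _ _ _ HL _ _ (lg_shift _ _ _ _ HL) HI) as E.
  pose proof (lg_Lcomp _ _ _ _ HL shift G (lg_shift _ _ _ _ HL) HGG) as E2.
  rewrite (lg_Lshift _ _ _ _ HL) in *.
  replace (fun x => x) with (fun x => shift (G x)); [lia|].
  apply functional_extensionality. apply HI.
Qed.

Lemma growth_k n k z x l : (1 <= n)%nat -> NoDup l ->
  (forall F, In F l -> Gam F /\ (L F <= n)%nat /\ z <= F x < z + INR k) ->
  (length l <= k * (C * n ^ d))%nat.
Proof.
  intros Hn. revert l. induction k as [|k IH]; intros l Hl HF.
  - destruct l as [|F l]; simpl; [lia|]. destruct (HF F) as (_ & _ & H); [now left|]. simpl in H. lra.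
  - set (p := fun F : R -> R => btest (F x < z + INR k)).
    rewrite <- (filter_length p l).
    assert (length (filter p l) <= k * (C * n ^ d))%nat.
    { apply IH; [now apply NoDup_filter|]. intros F HFi. apply filter_In in HFi as [HFi Hb].
      unfold p in Hb. rewrite btest_true in Hb. destruct (HF F HFi) as (H1 & H2 & H3).
      repeat split; auto; lra. }
    assert (length (filter (fun F => negb (p F)) l) <= C * n ^ d)%nat.
    { apply (lg_growth _ _ _ _ HL n (z + INR k) x); auto; [now apply NoDup_filter|].
      intros F HFi. apply filter_In in HFi as [HFi Hb].
      unfold p in Hb. rewrite Bool.negb_true_iff, btest_false in Hb.
      destruct (HF F HFi) as (H1 & H2 & H3). rewrite S_INR in H3. repeat split; auto; lra. }
    simpl. lia.
Qed.

(** A bound on [L] alone leaves infinitely many elements, since [shift] has length zero. Bounding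
    the displacement of [0] as well costs one power of [n], hence the exponent [S d] in
    [ball_growth]. *)
Definition ball n F : Prop := Gam F /\ (L F <= n)%nat /\ - INR n <= F 0 <= INR n.

Lemma ball_growth n l : (1 <= n)%nat -> NoDup l -> (forall F, In F l -> ball n F) ->
  (length l <= 3 * C * n ^ S d)%nat.
Proof.
  intros Hn Hl HF.
  assert (length l <= (2 * n + 1) * (C * n ^ d))%nat.
  { apply (growth_k n _ (- INR n) 0); auto. intros F HFi. destruct (HF F HFi) as (H1 & H2 & H3).
    repeat split; auto; try lra. rewrite plus_INR, mult_INR. simpl. lra. }
  simpl. nia.
Qed.

Lemma ball_id n : ball n (fun x => x).
Proof.
  split; [apply (ig_id _ HG)|split]; [rewrite L_id; lia|]. pose proof (pos_INR n). lra.
Qed.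

Lemma ball_comp n m F G : ball n F -> ball m G -> ball (n + m) (fun x => F (G x)).
Proof.
  intros (H1 & H2 & H3) (K1 & K2 & K3). split; [|split].
  - now apply (ig_comp _ HG F).
  - pose proof (lg_Lcomp _ _ _ _ HL F G H1 K1). lia.
  - pose proof (com_n F m 0 H1) as E1. pose proof (com_n F m (- INR m) H1) as E2.
    replace (- INR m + INR m) with 0 in E2 by lra. rewrite Rplus_0_l in E1.
    pose proof (incr_le F _ _ (ig_incr _ HG F H1) (proj1 K3)).
    pose proof (incr_le F _ _ (ig_incr _ HG F H1) (proj2 K3)).
    rewrite plus_INR. lra.
Qed.

Lemma ball_mono n m F : (n <= m)%nat -> ball n F -> ball m F.
Proof.
  intros Hnm (H1 & H2 & H3). apply le_INR in Hnm as Hnm'. split; [auto|split; [lia|lra]].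
Qed.

Lemma ball_ex F : Gam F -> exists n, (1 <= n)%nat /\ ball n F.
Proof.
  intros HF. destruct (INR_unbounded (Rabs (F 0))) as [n Hn].
  exists (S (n + L F)). split; [lia|]. split; [auto|split; [lia|]].
  rewrite S_INR, plus_INR. pose proof (pos_INR (L F)).
  unfold Rabs in Hn. destruct (Rcase_abs (F 0)); lra.
Qed.

Lemma ball_it K n F : ball K F -> ball (n * K) (it n F).
Proof.
  intros HF. induction n; simpl; [apply (ball_id 0)|]. now apply ball_comp with (F := F).
Qed.

(** The [2 ^ k] words of length [k] in [F] and [G] are told apart by their values at [x0], and they
    lie in a ball whose radius is linear in [k]. *)
Lemma lgroup_no_pp : no_pp Gam.
Proof.
  intros F G X x0 HF HGG Hx0 Hcl Hdis.
  destruct (ball_ex F HF) as [K1 [_ B1]]. destruct (ball_ex G HGG) as [K2 [_ B2]].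
  set (K := S (K1 + K2)).
  apply (ball_mono _ K) in B1; [|lia]. apply (ball_mono _ K) in B2; [|lia].
  assert (Hw : forall k, exists l, NoDup l /\ length l = (2 ^ k)%nat /\
     forall w, In w l -> ball (k * K) w /\ X (w x0)).
  { induction k as [|k (l & Hl1 & Hl2 & Hl3)].
    - exists ((fun x => x) :: nil). split; [repeat constructor; intros []|split; [reflexivity|]].
      intros w [<-|[]]. split; auto. apply (ball_id 0).
    - exists (map (fun w x => F (w x)) l ++ map (fun w x => G (w x)) l).
      assert (Hinj : forall f, Gam f -> NoDup (map (fun (w : R -> R) x => f (w x)) l)).
      { intros f Hf. apply NoDup_map_NoDup_ForallPairs; auto.
        intros w w' _ _ E. apply functional_extensionality; intros x.
        apply (incr_inj f); [now apply (ig_incr _ HG)|]. exact (f_equal (fun h => h x) E). }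
      split; [|split].
      + apply NoDup_app; auto. intros w Hw1 Hw2. apply in_map_iff in Hw1 as (u & <- & Hu).
        apply in_map_iff in Hw2 as (v & E & Hv).
        apply (Hdis (u x0) (v x0)); [apply Hl3; auto|apply Hl3; auto|].
        now apply (f_equal (fun h => h x0)) in E.
      + rewrite length_app, !length_map, Hl2. simpl. lia.
      + intros w Hw. apply in_app_iff in Hw as [Hw|Hw]; apply in_map_iff in Hw as (u & <- & Hu);
          apply Hl3 in Hu as [Hu1 Hu2]; (split; [|apply Hcl; auto]);
          [apply (ball_comp K (k * K) F u)|apply (ball_comp K (k * K) G u)]; auto. }
  destruct (exp_beats_poly (3 * C * K ^ S d) (S d)) as [k [Hk1 Hk2]].
  destruct (Hw k) as (l & Hl1 & Hl2 & Hl3).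
  assert (length l <= 3 * C * (k * K) ^ S d)%nat.
  { apply ball_growth; auto; [lia|]. intros w Hin. now apply Hl3. }
  rewrite Nat.pow_mul_l in H. lia.
Qed.

(* Passing to a strictly smaller support multiplies these counts by [n], which polynomial growth allows
   only boundedly often. *)
Definition spread (k : nat) (X : R -> Prop) : Prop :=
  exists K (Phi : nat -> nat -> R -> R), (1 <= K)%nat /\ forall n, (1 <= n)%nat ->
    (forall i, (i < n ^ k)%nat -> ball (K * n) (Phi n i)) /\
    (forall i j u v, (i < n ^ k)%nat -> (j < n ^ k)%nat -> i <> j -> X u -> X v ->
       Phi n i u <> Phi n j v).

Lemma spread_0 X : spread 0 X.
Proof.
  exists 1%nat, (fun _ _ x => x). split; [lia|]. intros n Hn. split.
  - intros i _. apply ball_id.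
  - intros i j u v Hi Hj. simpl in *. lia.
Qed.

(** The [n ^ k] elements have different values at [x], while a ball of radius [K * n] has at most a
    multiple of [n ^ S d] elements. *)
Lemma spread_bound k X x : X x -> spread k X -> (k <= S d)%nat.
Proof.
  intros Hx (K & Phi & HK & H). destruct (Nat.le_gt_cases k (S d)) as [|Hk]; auto. exfalso.
  set (n := (3 * C * K ^ S d + 1)%nat).
  destruct (H n) as [H1 H2]; [lia|].
  assert (Hlen : (length (map (Phi n) (seq 0 (n ^ k))) <= 3 * C * (K * n) ^ S d)%nat).
  { apply ball_growth; [nia| |].
    - apply NoDup_map_NoDup_ForallPairs; [|apply seq_NoDup].
      intros i j Hi Hj E. apply in_seq in Hi. apply in_seq in Hj.
      destruct (Nat.eq_dec i j) as [|Hij]; auto. exfalso.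
      apply (H2 i j x x); auto; try lia. now rewrite E.
    - intros F HF. apply in_map_iff in HF as (i & <- & Hi). apply in_seq in Hi. apply H1. lia. }
  rewrite length_map, length_seq, Nat.pow_mul_l in Hlen.
  assert (n ^ S (S d) <= n ^ k)%nat by (apply Nat.pow_le_mono_r; lia).
  assert (0 < n ^ S d)%nat. { pose proof (Nat.pow_nonzero n (S d)). lia. }
  change (n ^ S (S d))%nat with (n * n ^ S d)%nat in *. nia.
Qed.

(** The new family composes an old element, indexed by the quotient [i / n], with [g] iterated
    [i mod n] times. Different quotients are separated by the old family on [X], different
    remainders by the iterates of [g] on [Y]. *)
Lemma spread_step k (X Y : R -> Prop) g : spread k X -> Gam g ->
  (forall u, Y u -> X u) -> (forall u, X u -> X (g u)) ->
  (forall n m u v, Y u -> Y v -> n <> m -> Nat.iter n g u <> Nat.iter m g v) -> spread (S k) Y.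
Proof.
  intros (K & Phi & HK & H) Hg HYX HXg Hd. destruct (ball_ex g Hg) as [M [HM HgM]].
  exists (K + M)%nat, (fun n i x => Phi n (i / n)%nat (Nat.iter (i mod n) g x)).
  split; [lia|]. intros n Hn. destruct (H n Hn) as [H1 H2].
  assert (Hdiv : forall i, (i < n ^ S k)%nat -> (i / n < n ^ k)%nat).
  { intros i Hi. apply Nat.Div0.div_lt_upper_bound. simpl in Hi. lia. }
  assert (HX : forall m u, Y u -> X (Nat.iter m g u)).
  { intros m u Hu. induction m; simpl; auto. }
  split.
  - intros i Hi. apply (ball_mono (K * n + (i mod n) * M)).
    + pose proof (Nat.mod_upper_bound i n). nia.
    + apply (ball_comp _ _ (Phi n (i / n)%nat) (it (i mod n) g)); [auto|]. now apply ball_it.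
  - intros i j u v Hi Hj Hij Hu Hv E.
    destruct (Nat.eq_dec (i / n) (j / n)) as [Eq|Nq].
    + rewrite Eq in E. apply incr_inj in E.
      * revert E. apply Hd; auto. intros Em. apply Hij.
        rewrite (Nat.div_mod i n), (Nat.div_mod j n) by lia. congruence.
      * apply (ig_incr _ HG). apply (H1 (j / n)%nat); auto.
    + revert E. apply H2; auto.
Qed.

End Growth.

(** * Minimal supports *)

Lemma it_le_mono n m F x : incr F -> x <= F x -> (n <= m)%nat -> Nat.iter n F x <= Nat.iter m F x.
Proof.
  intros HF Hx Hnm. induction Hnm as [|m _ IH]; [lra|].
  apply Rle_trans with (1 := IH). now apply it_le_step.
Qed.

Lemma left_fix F G q w : incr F -> inv_of F G -> F q = q -> q < w -> F w <> w ->
  exists a, q <= a < w /\ F a = a /\ forall u, a < u <= w -> F u <> u.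
Proof.
  intros HF HI Hq Hqw Hw. pose proof (inv_of_incr _ _ HF HI) as HGi. destruct HI as [I1 I2].
  destruct (completeness (fun z => z <= w /\ F z = z)) as [a [A1 A2]].
  - exists w. now intros z [Hz _].
  - exists q. split; [lra|auto].
  - assert (Haw : a <= w) by (apply A2; now intros z [Hz _]).
    assert (Hqa : q <= a) by (apply A1; split; [lra|auto]).
    assert (Fa : F a = a).
    { apply Rle_antisym.
      - apply (incr_le_inv G); auto. rewrite I1. apply A2. intros z [Hz1 Hz2].
        assert (Gz : G z = z) by (rewrite <- Hz2 at 1; auto).
        rewrite <- Gz. apply incr_le; auto.
      - apply A2. intros z [Hz1 Hz2]. rewrite <- Hz2. apply incr_le; auto. }
    exists a. split; [|split; auto].
    + split; auto. destruct Haw as [|E]; auto. subst. contradiction.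
    + intros u Hu E. assert (u <= a) by (apply A1; split; [lra|auto]). lra.
Qed.

(** The integer translates of the fixed point [q] are fixed too, so there are fixed points on both
    sides of [w]; the nearest ones bound the component. *)
Lemma comp_exists Gam h q w : igroup Gam -> Gam h -> (forall x, h (x + 1) = h x + 1) ->
  h q = q -> h w <> w -> exists a b, comp h a b /\ a < w < b.
Proof.
  intros HG Hh Hcom Hq Hw. pose proof (ig_incr _ HG h Hh) as Ih.
  destruct (ig_inv _ HG h Hh) as [g [Hg HI]].
  assert (Hn : forall n, h (q + INR n) = q + INR n /\ h (q - INR n) = q - INR n).
  { induction n as [|n [H1 H2]].
    - simpl. rewrite Rplus_0_r, Rminus_0_r. auto.
    - rewrite S_INR. split.
      + rewrite <- Rplus_assoc, Hcom. lra.
      + apply Rplus_eq_reg_r with 1. rewrite <- Hcom.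
        replace (q - (INR n + 1) + 1) with (q - INR n) by lra. auto. }
  destruct (INR_unbounded (Rabs (q - w))) as [n Hnn]. destruct (Hn n) as [Hn1 Hn2].
  assert (q - INR n < w < q + INR n).
  { unfold Rabs in Hnn. destruct (Rcase_abs (q - w)); lra. }
  destruct (left_fix h g (q - INR n) w) as [a (A1 & A2 & A3)]; auto; [lra|].
  destruct (left_fix (rfl h) (rfl g) (- (q + INR n)) (- w)) as [b (B1 & B2 & B3)].
  - now apply rfl_incr.
  - now apply rfl_inv.
  - unfold rfl. rewrite Ropp_involutive. lra.
  - lra.
  - unfold rfl. rewrite Ropp_involutive. lra.
  - exists a, (- b). split; [|lra]. unfold rfl in *. repeat split; try lra.
    intros u Hu E. destruct (Rle_lt_dec u w).
    + apply (A3 u); lra.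
    + apply (B3 (- u)); [lra|]. rewrite Ropp_involutive. lra.
Qed.

Lemma comp_inv h g a b : inv_of h g -> comp h a b -> comp g a b.
Proof.
  intros [I1 I2] (C1 & C2 & C3 & C4). repeat split; auto.
  - rewrite <- C2 at 1; auto.
  - rewrite <- C3 at 1; auto.
  - intros v Hv E. apply (C4 v Hv). rewrite <- E at 1. auto.
Qed.

Lemma comp_up h g a b w : incr h -> inv_of h g -> comp h a b -> a < w < b -> w < h w ->
  forall u, a < u < b -> u < h u.
Proof.
  intros Ih HI Hc Hw Hlt u Hu. pose proof (inv_of_incr _ _ Ih HI) as Ig.
  destruct (Rlt_le_dec u (h u)) as [|Hle]; auto. exfalso.
  destruct (Rle_lt_dec w u) as [Hwu|Hwu].
  - destruct (fix_between h g w u) as [z [Hz Ez]]; auto; [lra|]. apply (proj2 (proj2 (proj2 Hc)) z); auto. lra.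
  - destruct (comp_inv _ _ _ _ HI Hc) as (_ & _ & _ & C4). destruct HI as [I1 I2].
    destruct (fix_between g h u w) as [z [Hz Ez]]; auto.
    + now split.
    + lra.
    + rewrite <- (I1 u) at 1. now apply incr_le.
    + rewrite <- (I1 w) at 2. apply incr_le; auto. lra.
    + apply (C4 z); auto. lra.
Qed.

(** The line with [shift] and every component of a support are instances. [ax_block] is laminarity
    in the form needed for a descent through nested supports. *)
Record axis (Gam : (R -> R) -> Prop) (f : R -> R) (C : R -> Prop) : Prop := {
  ax_in : Gam f;
  ax_conv : forall x y z, C x -> C y -> x <= z <= y -> C z;
  ax_stab : forall x, C x -> C (f x);
  ax_stab_inv : forall x, C (f x) -> C x;
  ax_up : forall x, C x -> x < f x;
  ax_cof : forall x y, C x -> C y -> exists n, y < Nat.iter n f x;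
  ax_block : forall h, Gam h -> (exists u, C u /\ C (h u)) -> forall v, C v -> C (h v) }.

Definition shape (C : R -> Prop) : Prop :=
  (forall x, C x) \/ exists a b, a < b /\ forall x, C x <-> a < x < b.

Section Minimal.
Variables (Gam : (R -> R) -> Prop) (L : (R -> R) -> nat) (Cst d : nat).
Hypothesis HL : lgroup Gam L Cst d.
Let HG := lg_ig _ _ _ _ HL.
Let HP := lgroup_no_pp _ _ _ _ HL.

Lemma axis_shift : axis Gam shift (fun _ => True).
Proof.
  split; auto; try (apply (lg_shift _ _ _ _ HL)); unfold shift.
  - intros; lra.
  - intros x y _ _. destruct (INR_unbounded (y - x)) as [n Hn]. exists n.
    assert (E : Nat.iter n (fun z => z + 1) x = x + INR n).
    { clear Hn. induction n; [simpl; lra|]. rewrite S_INR. simpl. rewrite IHn. lra. }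
    rewrite E. lra.
Qed.

Lemma axis_comp h a b : Gam h -> comp h a b -> exists f, axis Gam f (fun x => a < x < b).
Proof.
  intros Hh Hc. destruct (ig_inv _ HG h Hh) as [g [Hg HI]].
  pose proof (ig_incr _ HG h Hh) as Ih. pose proof (ig_incr _ HG g Hg) as Ig.
  assert (Hw : exists f fi, Gam f /\ inv_of f fi /\ comp f a b /\ forall u, a < u < b -> u < f u).
  { set (w := (a + b) / 2). assert (Hw : a < w < b) by (unfold w; destruct Hc; lra).
    destruct (Rtotal_order w (h w)) as [Hlt|[E|Hgt]].
    - exists h, g. repeat (split; auto). apply (comp_up h g a b w); auto.
    - exfalso. apply (proj2 (proj2 (proj2 Hc)) w); auto.
    - exists g, h. pose proof (comp_inv _ _ _ _ HI Hc) as Hc'. apply inv_of_sym in HI.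
      split; [auto|split; [auto|split; [auto|]]].
      apply (comp_up g h a b w); auto. rewrite <- (proj2 HI w) at 1. auto. }
  destruct Hw as (f & fi & Hf & HfI & Hcf & Hup). pose proof (ig_incr _ HG f Hf) as If.
  exists f. split; auto.
  - intros; lra.
  - intros x Hx. now apply (comp_stays Gam HG f a b).
  - intros x Hx. destruct Hcf as (C1 & C2 & C3 & C4).
    split; apply (incr_lt_inv f); auto; lra.
  - intros x y Hx Hy. apply (escape_up f fi x y); auto.
    + left. now apply Hup.
    + intros z Hz. apply Hcf. lra.
  - intros k Hk [u [Hu1 Hu2]] v Hv. destruct (comp_fix_ends Gam HG HP h a b k u) as [E1 E2]; auto.
    pose proof (ig_incr _ HG k Hk) as Ik.
    split; [rewrite <- E1|rewrite <- E2]; apply Ik; lra.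
Qed.

Lemma axis_inv_stab f C h g : axis Gam f C -> Gam g -> inv_of h g ->
  (forall u, C u -> C (h u)) -> forall u, C u -> C (g u).
Proof.
  intros HA Hg [I1 I2] Hs u Hu. apply (ax_block _ _ _ HA g Hg); auto.
  exists (h u). split; auto. now rewrite I1.
Qed.

Lemma it_stab n f (C : R -> Prop) x : (forall u, C u -> C (f u)) -> C x -> C (Nat.iter n f x).
Proof. intros H Hx. induction n; simpl; auto. Qed.

(** The iterates of [w] under [h] and its inverse stay in [C] and sweep out [(a, b)]. *)
Lemma comp_in_axis f C h a b w : axis Gam f C -> Gam h -> (forall u, C u -> C (h u)) ->
  comp h a b -> a < w < b -> C w -> forall u, a < u < b -> C u.
Proof.
  intros HA Hh Hs Hc Hw Cw u Hu. destruct (ig_inv _ HG h Hh) as [g [Hg HI]].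
  assert (Hd : forall k ki, Gam k -> inv_of k ki -> (forall u, C u -> C (k u)) -> comp k a b -> w < k w -> 
     w <= u -> C u).
  { intros k ki Hk KI Ks Kc Kw Hwu.
    destruct (escape_up k ki w u) as [n Hn]; auto.
    - now apply (ig_incr _ HG).
    - lra.
    - intros z Hz. apply Kc. lra.
    - apply (ax_conv _ _ _ HA w (Nat.iter n k w)); auto; [now apply it_stab|lra]. }
  assert (Hd' : forall k ki, Gam k -> inv_of k ki -> (forall u, C u -> C (k u)) -> comp k a b -> k w < w -> 
     u <= w -> C u).
  { intros k ki Hk KI Ks Kc Kw Hwu.
    destruct (escape_down k ki w u) as [n Hn]; auto.
    - now apply (ig_incr _ HG).
    - lra.
    - intros z Hz. apply Kc. lra.
    - apply (ax_conv _ _ _ HA (Nat.iter n k w) w); auto; [now apply it_stab|lra]. }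
  pose proof (axis_inv_stab f C h g HA Hg HI Hs) as Hgs.
  pose proof (comp_inv _ _ _ _ HI Hc) as Hgc. pose proof (inv_of_sym _ _ HI) as HI'.
  pose proof (ig_incr _ HG h Hh) as Ih. pose proof (ig_incr _ HG g Hg) as Ig.
  assert (Hne : h w <> w) by (apply Hc; auto).
  destruct (Rdichotomy _ _ Hne) as [Hlt|Hgt]; destruct (Rle_lt_dec u w) as [Huw|Huw].
  - apply (Hd' h g); auto.
  - apply (Hd g h); auto; [|lra]. rewrite <- (proj1 HI w) at 1. now apply Ig.
  - apply (Hd' g h); auto. rewrite <- (proj1 HI w) at 2. now apply Ig.
  - apply (Hd h g); auto. lra.
Qed.

(** The fixed point [q] lies outside [(a, b)], so the end of the component on its side belongs to
    [C] and is moved by [f]. If two steps of [f] stayed inside the component, that end would be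
    resilient. *)
Lemma axis_jump f C h a b q : axis Gam f C -> Gam h -> comp h a b ->
  (forall u, a < u < b -> C u) -> C q -> h q = q -> b <= f (f a).
Proof.
  intros HA Hh Hc Hsub Cq Hq. pose proof (ax_in _ _ _ HA) as Hf.
  destruct Hc as (C1 & C2 & C3 & C4). pose proof (ig_incr _ HG f Hf) as If.
  assert (Cm : C ((a + b) / 2)) by (apply Hsub; lra).
  destruct (Rle_lt_dec q a) as [Hqa|Hqa].
  - destruct (Rle_lt_dec b (f (f a))) as [|Hlt]; auto. exfalso.
    assert (Ca : C a) by (apply (ax_conv _ _ _ HA q ((a + b) / 2)); auto; lra).
    apply (no_resilient Gam HG HP f h a); auto.
    + now apply (ax_up _ _ _ HA).
    + intros u Hu. apply C4. lra.
  - assert (Hbq : b <= q). { destruct (Rle_lt_dec b q); auto. exfalso. apply (C4 q); auto. }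
    assert (Cb : C b) by (apply (ax_conv _ _ _ HA ((a + b) / 2) q); auto; lra).
    destruct (ig_inv _ HG f Hf) as [g [Hg [I1 I2]]].
    assert (Cgb : C (g b)) by (apply (ax_stab_inv _ _ _ HA); now rewrite I2).
    destruct (Rle_lt_dec (g (g b)) a) as [Hle|Hlt].
    + rewrite <- (I2 b), <- (I2 (g b)). apply incr_le; auto. now apply incr_le.
    + exfalso. apply (no_resilient_left Gam HG HP g h b); auto.
      * rewrite <- (I2 b) at 2. now apply (ax_up _ _ _ HA).
      * intros u Hu. apply C4. lra.
Qed.

(** If it fails, some element of the stabilizer has a component that meets the window and misses a
    point of [C], which allows a further descent. *)
Definition minimal_on (C : R -> Prop) w1 w2 : Prop :=
  forall h, Gam h -> (forall u, C u -> C (h u)) ->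
    (forall u, C u -> h u <> u) \/ (forall u, w1 < u < w2 -> h u = u).

Lemma open_window f C x u1 u2 : axis Gam f C -> C x -> u1 < x < u2 ->
  exists w1 w2, w1 < w2 /\ forall u, w1 <= u <= w2 -> C u /\ u1 < u < u2.
Proof.
  intros HA Cx Hx. pose proof (ax_up _ _ _ HA x Cx). pose proof (ax_stab _ _ _ HA x Cx) as Cfx.
  exists x, ((x + Rmin (f x) u2) / 2). pose proof (Rmin_l (f x) u2). pose proof (Rmin_r (f x) u2).
  assert (x < Rmin (f x) u2) by (apply Rmin_glb_lt; lra).
  split; [lra|]. intros u Hu. split; [|lra]. apply (ax_conv _ _ _ HA x (f x)); auto; lra.
Qed.

(** By [axis_jump], [f] applied twice moves the component past itself, so its translates under the
    iterates of this map are disjoint, as [spread_step] requires. *)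
Lemma spread_comp k f C h a b q : axis Gam f C -> Gam h -> comp h a b ->
  (forall u, a < u < b -> C u) -> C q -> h q = q -> spread Gam L k C ->
  spread Gam L (S k) (fun x => a < x < b).
Proof.
  intros HA Hh Hc Hsub Cq Hq Hsp. pose proof (axis_jump f C h a b q HA Hh Hc Hsub Cq Hq) as Hj.
  pose proof (ax_in _ _ _ HA) as Hf. pose proof (ig_incr _ HG f Hf) as If. set (g := fun x => f (f x)).
  assert (Hg : Gam g) by exact (it_in Gam 2 f HG Hf). assert (Ig : incr g) by exact (it_incr 2 f If).
  apply (spread_step Gam L Cst d HL k C _ g); auto.
  { intros u Cu. now do 2 apply (ax_stab _ _ _ HA). }
  assert (Hord : forall n m u v, a < u < b -> a < v < b -> (n < m)%nat -> Nat.iter n g u < Nat.iter m g v).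
  { intros n m u v Hu Hv Hnm. apply Rlt_le_trans with (Nat.iter n g b); [apply (it_incr n g Ig); lra|].
    apply Rle_trans with (Nat.iter (S n) g a).
    - rewrite it_succ_r. apply (incr_le (it n g)); auto. now apply it_incr.
    - apply Rle_trans with (Nat.iter m g a).
      + apply it_le_mono; auto. unfold g. destruct Hc. lra.
      + left. apply (it_incr m g Ig). lra. }
  intros n m u v Hu Hv Hnm E. destruct (Nat.lt_total n m) as [Hlt|[Heq|Hlt]]; [|lia|].
  - pose proof (Hord n m u v Hu Hv Hlt). lra.
  - pose proof (Hord m n v u Hv Hu Hlt). lra.
Qed.

Lemma deeper_comp k f C w1 w2 : axis Gam f C -> (forall u, w1 <= u <= w2 -> C u) -> spread Gam L k C ->
  ~ minimal_on C w1 w2 ->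
  exists h a b w, Gam h /\ comp h a b /\ a < w < b /\ w1 < w < w2 /\ spread Gam L (S k) (fun x => a < x < b).
Proof.
  intros HA HwC Hsp Hmin. unfold minimal_on in Hmin. apply not_all_ex_not in Hmin as [h Hmin].
  apply imply_to_and in Hmin as [Hh Hmin]. apply imply_to_and in Hmin as [Hs Hmin].
  apply not_or_and in Hmin as [Hq Hw].
  apply not_all_ex_not in Hq as [q Hq]. apply imply_to_and in Hq as [Cq Hq]. apply NNPP in Hq.
  apply not_all_ex_not in Hw as [w Hw]. apply imply_to_and in Hw as [Hw Hhw].
  assert (Cw : C w) by (apply HwC; lra).
  destruct (comp_exists Gam h q w HG Hh (lg_com _ _ _ _ HL h Hh) Hq Hhw) as (a & b & Hc & Hab).
  exists h, a, b, w. split; [auto|]. split; [auto|]. split; [auto|]. split; [auto|].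
  apply (spread_comp k f C h a b q); auto. now apply (comp_in_axis f C h a b w).
Qed.

Lemma minimal_axis u1 u2 : u1 < u2 ->
  exists f C w1 w2, axis Gam f C /\ shape C /\ w1 < w2 /\
    (forall u, w1 <= u <= w2 -> C u /\ u1 < u < u2) /\ minimal_on C w1 w2.
Proof.
  intros Hu.
  (* The number [j] bounds the descents that remain: each one raises the exponent [k], and
     [spread_bound] stops it at [S d]. *)
  assert (Hmain : forall j k f C x, (S d < k + j)%nat -> axis Gam f C -> shape C -> spread Gam L k C ->
    C x -> u1 < x < u2 -> exists f C w1 w2, axis Gam f C /\ shape C /\ w1 < w2 /\
    (forall u, w1 <= u <= w2 -> C u /\ u1 < u < u2) /\ minimal_on C w1 w2).
  { induction j as [|j IH]; intros k f C x Hkj HA Hsh Hsp Cx Hx.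
    - pose proof (spread_bound Gam L Cst d HL k C x Cx Hsp). lia.
    - destruct (open_window f C x u1 u2 HA Cx Hx) as (w1 & w2 & Hw & Hwu).
      destruct (classic (minimal_on C w1 w2)) as [Hmin|Hmin]; [exists f, C, w1, w2; auto|].
      destruct (deeper_comp k f C w1 w2 HA (fun u H => proj1 (Hwu u H)) Hsp Hmin)
        as (h & a & b & w & Hh & Hc & Hab & Hw' & Hsp').
      destruct (axis_comp h a b Hh Hc) as [f' HA'].
      apply (IH (S k) f' (fun x => a < x < b) w); auto; [lia| |apply Hwu; lra].
      right. exists a, b. split; [apply Hc|]. intros y; tauto. }
  apply (Hmain (S (S d)) O shift (fun _ => True) ((u1 + u2) / 2)); auto.
  - apply axis_shift.
  - left; auto.
  - apply (spread_0 Gam L Cst d HL).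
  - lra.
Qed.

End Minimal.

(** * Hoelder's theorem on a minimal support *)

Definition zit (f fi : R -> R) (m : Z) (x : R) : R :=
  if Z.leb 0 m then Nat.iter (Z.to_nat m) f x else Nat.iter (Z.to_nat (- m)) fi x.

Lemma zit_succ f fi m x : inv_of f fi -> zit f fi (m + 1) x = f (zit f fi m x).
Proof.
  intros [I1 I2]. unfold zit. destruct (Z.leb_spec 0 m) as [H|H].
  - destruct (Z.leb_spec 0 (m + 1)); [|lia]. rewrite Z2Nat.inj_add by lia.
    rewrite Nat.add_comm. reflexivity.
  - replace (Z.to_nat (- m)) with (S (Z.to_nat (- (m + 1)))) by lia. simpl. rewrite I2.
    destruct (Z.leb_spec 0 (m + 1)); auto. replace m with (- 1)%Z by lia. reflexivity.
Qed.

Lemma zit_pred f fi m x : inv_of f fi -> zit f fi (m - 1) x = fi (zit f fi m x).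
Proof.
  intros HI. replace m with (m - 1 + 1)%Z at 2 by lia. rewrite zit_succ; auto.
  symmetry; apply HI.
Qed.

Lemma zit_add f fi m n x : inv_of f fi -> zit f fi (m + n) x = zit f fi m (zit f fi n x).
Proof.
  intros HI. revert m. apply Z.peano_ind.
  - reflexivity.
  - intros m IH. unfold Z.succ. replace (m + 1 + n)%Z with (m + n + 1)%Z by lia.
    rewrite !zit_succ; auto. now f_equal.
  - intros m IH. unfold Z.pred. replace (m + -1 + n)%Z with (m + n - 1)%Z by lia.
    replace (m + -1)%Z with (m - 1)%Z by lia.
    rewrite !zit_pred; auto. now f_equal.
Qed.

Lemma zit_nat f fi n x : zit f fi (Z.of_nat n) x = Nat.iter n f x.
Proof. unfold zit. destruct (Z.leb_spec 0 (Z.of_nat n)); [|lia]. now rewrite Nat2Z.id. Qed.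

Lemma Z_threshold (P : Z -> Prop) a b : (a <= b)%Z -> P a -> ~ P b -> exists m, P m /\ ~ P (m + 1)%Z.
Proof.
  intros Hab Pa Pb. replace b with (a + Z.of_nat (Z.to_nat (b - a)))%Z in Pb by lia.
  induction (Z.to_nat (b - a)) as [|n IH].
  - rewrite Z.add_0_r in Pb. contradiction.
  - destruct (classic (P (a + Z.of_nat n)%Z)) as [H|H]; auto.
    exists (a + Z.of_nat n)%Z. split; auto. now replace (a + Z.of_nat n + 1)%Z with (a + Z.of_nat (S n))%Z by lia.
Qed.

Section Holder.
Variables (Gam : (R -> R) -> Prop) (f fi : R -> R) (C : R -> Prop) (w1 w2 : R).
Hypothesis HG : igroup Gam.
Hypothesis HA : axis Gam f C.
Hypothesis Hfi : Gam fi.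
Hypothesis Hf : inv_of f fi.
Hypothesis Hw12 : w1 < w2.
Hypothesis HwC : forall u, w1 <= u <= w2 -> C u.
Hypothesis Hmin : minimal_on Gam C w1 w2.
(** Recurrence: in every subwindow some element moves a point a little to the right. The case
    without recurrence is settled separately in [good_dichotomy]. *)
Hypothesis Hrec : forall j1 j2, w1 <= j1 -> j1 < j2 -> j2 <= w2 ->
  exists k p, Gam k /\ j1 < p /\ p < k p /\ k p < j2.

Definition stab (h : R -> R) : Prop := Gam h /\ forall u, C u -> C (h u).

Lemma stab_incr h : stab h -> incr h.
Proof. intros [H _]. now apply (ig_incr _ HG). Qed.

Lemma stab_id : stab (fun x => x).
Proof. split; auto. apply (ig_id _ HG). Qed.

Lemma stab_comp h k : stab h -> stab k -> stab (fun x => h (k x)).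
Proof. intros [H1 H2] [K1 K2]. split; auto. now apply (ig_comp _ HG h). Qed.

Lemma stab_inv h : stab h -> exists g, stab g /\ inv_of h g.
Proof.
  intros [H1 H2]. destruct (ig_inv _ HG h H1) as [g [Hg HI]]. exists g. split; auto. split; auto.
  now apply (axis_inv_stab Gam f C h g).
Qed.

Lemma stab_inv_of h g : stab h -> inv_of h g -> stab g.
Proof.
  intros Hh HI. destruct (stab_inv h Hh) as [g' [Hg' [I1 I2]]]. 
  replace g with g'; auto. apply functional_extensionality; intros x.
  rewrite <- (I1 (g x)). f_equal. symmetry. apply HI.
Qed.

Lemma stab_it n h : stab h -> stab (it n h).
Proof. intros [H1 H2]. split; [now apply it_in|]. intros u Hu. now apply it_stab. Qed.

Lemma stab_zit h g m : stab h -> inv_of h g -> stab (zit h g m).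
Proof.
  intros Hh HI. unfold zit. destruct (0 <=? m)%Z; apply stab_it; auto.
  now apply (stab_inv_of h).
Qed.

Lemma stab_f : stab f.
Proof. split; [apply (ax_in _ _ _ HA)|apply (ax_stab _ _ _ HA)]. Qed.

Lemma stab_intro h u : Gam h -> C u -> C (h u) -> stab h.
Proof. intros Hh Hu Hhu. split; auto. apply (ax_block _ _ _ HA h Hh). eauto. Qed.

Lemma zit_window h g p x : stab h -> inv_of h g -> C p -> C x ->
  (forall u, C u -> exists n, u < Nat.iter n h p) -> (forall u, C u -> exists n, p < Nat.iter n h u) ->
  exists m, p <= zit h g m x < h p.
Proof.
  intros Hh HI Cp Cx H1 H2. destruct (H1 x Cx) as [n1 Hn1]. destruct (H2 x Cx) as [n2 Hn2].
  destruct (Z_threshold (fun m => zit h g m p <= x) (- Z.of_nat n2) (Z.of_nat n1)) as [m [Hm1 Hm2]].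
  - lia.
  - apply (incr_le_inv (zit h g (Z.of_nat n2))); [now apply stab_incr, stab_zit|].
    rewrite <- zit_add; auto. rewrite Z.add_opp_diag_r, zit_nat. simpl. left; auto.
  - rewrite zit_nat. lra.
  - exists (- m)%Z. apply Rnot_le_lt in Hm2.
    pose proof (stab_incr _ (stab_zit h g (- m) Hh HI)) as Hi. split.
    + replace p with (zit h g (- m) (zit h g m p)).
      * now apply incr_le.
      * rewrite <- zit_add; auto. rewrite Z.add_opp_diag_l. reflexivity.
    + replace (h p) with (zit h g (- m) (zit h g (m + 1) p)); auto.
      rewrite <- zit_add; auto. replace (- m + (m + 1))%Z with (0 + 1)%Z by lia.
      now rewrite zit_succ.
Qed.

Lemma free_cofinal h : stab h -> (forall u, C u -> u < h u) ->
  forall x y, C x -> C y -> exists n, y < Nat.iter n h x.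
Proof.
  intros Hh Hup x y Cx Cy. destruct (stab_inv h Hh) as [g [_ HI]].
  apply (escape_up h g x y); auto.
  - now apply stab_incr.
  - left; auto.
  - intros z Hz E. assert (Cz : C z) by (apply (ax_conv _ _ _ HA x y); auto).
    pose proof (Hup z Cz). lra.
Qed.

Lemma free_up h u : stab h -> (forall x, C x -> h x <> x) -> C u -> u < h u -> forall x, C x -> x < h x.
Proof.
  intros Hh Hfree Cu Hu x Cx. destruct (Rlt_le_dec x (h x)) as [|Hle]; auto. exfalso.
  destruct (stab_inv h Hh) as [g [Hg HI]]. pose proof (stab_incr h Hh) as Ih. pose proof (stab_incr g Hg) as Ig.
  destruct (Rle_lt_dec u x) as [Hux|Hxu].
  - destruct (fix_between h g u x) as [z [Hz Ez]]; auto; [lra|].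
    apply (Hfree z); auto. apply (ax_conv _ _ _ HA u x); auto.
  - destruct (fix_between g h x u) as [z [Hz Ez]]; auto.
    + now apply inv_of_sym.
    + lra.
    + rewrite <- (proj1 HI x) at 1. now apply incr_le.
    + rewrite <- (proj1 HI u) at 2. apply incr_le; auto. lra.
    + apply (Hfree z); [apply (ax_conv _ _ _ HA x u); auto|]. rewrite <- Ez at 1. apply HI.
Qed.

(** The element supplied by recurrence returns a point of [C] to [C], so it stabilizes [C]; it is
    not trivial on the window, so by minimality it is free. *)
Lemma small_move j1 j2 : w1 <= j1 -> j1 < j2 -> j2 <= w2 ->
  exists k p, stab k /\ (forall u, C u -> u < k u) /\ C p /\ j1 < p /\ k p < j2.
Proof.
  intros H1 H12 H2. destruct (Hrec j1 j2) as (k & p & Hk & Hp1 & Hp2 & Hp3); auto.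
  assert (Cp : C p) by (apply HwC; lra). assert (Ckp : C (k p)) by (apply HwC; lra).
  assert (Sk : stab k) by (apply (stab_intro k p); auto).
  exists k, p. repeat split; auto; try apply Sk.
  destruct (Hmin k) as [Hfree|Hid]; try apply Sk.
  - apply (free_up k p); auto.
  - rewrite (Hid p) in Hp2; lra.
Qed.

(** The powers of the element from [small_move] bring [x] into the fundamental interval from [p] to
    [k p], which lies in the subwindow. *)
Lemma orbit_meets j1 j2 x : w1 <= j1 -> j1 < j2 -> j2 <= w2 -> C x ->
  exists k, stab k /\ j1 < k x < j2.
Proof.
  intros H1 H12 H2 Cx. destruct (small_move j1 j2) as (k & p & Sk & Hup & Cp & Hp1 & Hp2); auto.
  destruct (stab_inv k Sk) as [g [_ HI]].
  destruct (zit_window k g p x) as [m Hm]; auto.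
  - intros u Cu. now apply free_cofinal.
  - intros u Cu. now apply free_cofinal.
  - exists (zit k g m). split; [now apply stab_zit|lra].
Qed.

(** This extends minimality from the window to [C]. If [h] is trivial on the window and [k] carries
    [x] into it, then [k h k^-1] has fixed points in [C], so it is trivial on the window and fixes
    [k x]; hence [h] fixes [x]. *)
Lemma stab_free h : stab h -> (forall x, C x -> h x <> x) \/ (forall x, C x -> h x = x).
Proof.
  intros Sh. destruct (Hmin h) as [|Hid]; try apply Sh; auto. right. intros x Cx.
  destruct (orbit_meets w1 w2 x) as [k [Sk Hk]]; auto; try lra.
  destruct (stab_inv k Sk) as [g [Sg HI]].
  assert (Skhg : stab (fun y => k (h (g y)))) by (apply (stab_comp k); auto; now apply (stab_comp h)).
  destruct (orbit_meets w1 w2 (k w1)) as [l [Sl Hl]]; try lra.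
  { apply Sk. apply HwC. lra. }
  destruct (Hmin (fun y => k (h (g y)))) as [Hf'|Hid']; try apply Skhg.
  - exfalso. set (u := (w1 + w2) / 2). apply (Hf' (k u)).
    + apply Sk. apply HwC. unfold u; lra.
    + rewrite (proj1 HI). f_equal. apply Hid. unfold u; lra.
  - apply (incr_inj k); [now apply stab_incr|]. 
    rewrite <- (Hid' (k x)) by lra. now rewrite (proj1 HI).
Qed.

(** The element [h^-1 k] is the identity on [C] or moves all points of [C] in one direction. The
    stabilizer is thus totally ordered by its values at any single point. *)
Lemma stab_trichotomy h k : stab h -> stab k ->
  (forall x, C x -> h x < k x) \/ (forall x, C x -> h x = k x) \/ (forall x, C x -> k x < h x).
Proof.
  intros Sh Sk. destruct (stab_inv h Sh) as [g [Sg HI]]. pose proof (stab_incr h Sh) as Ih.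
  assert (Sq : stab (fun x => g (k x))) by now apply (stab_comp g).
  assert (Hq : forall x, k x = h (g (k x))) by (intros; now rewrite (proj2 HI)).
  set (q := fun x => g (k x)) in *.
  assert (Cw : C w1) by (apply HwC; lra).
  destruct (stab_free q Sq) as [Hfree|Hid].
  - destruct (Rdichotomy _ _ (Hfree w1 Cw)) as [Hlt|Hgt].
    + right; right. destruct (stab_inv q Sq) as [qi [Sqi [Q1 Q2]]]. intros x Cx. rewrite Hq. apply Ih.
      assert (Hup : forall y, C y -> y < qi y).
      { apply (free_up qi w1); auto.
        - intros y Cy E. apply (Hfree y Cy). rewrite <- E at 1. auto.
        - rewrite <- (Q1 w1) at 1. now apply (stab_incr qi Sqi). }
      fold (q x). rewrite <- (Q1 x) at 2. apply Hup. now apply Sq.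
    + left. intros x Cx. rewrite Hq. apply Ih. apply (free_up q w1); auto.
  - right; left. intros x Cx. rewrite Hq. f_equal. symmetry. now apply Hid.
Qed.

Definition le_on (h k : R -> R) : Prop := forall x, C x -> h x <= k x.

Lemma le_on_total h k x : stab h -> stab k -> C x -> h x <= k x -> le_on h k.
Proof.
  intros Sh Sk Cx Hle y Cy. destruct (stab_trichotomy h k Sh Sk) as [H|[H|H]].
  - left; auto.
  - right; auto.
  - pose proof (H x Cx). lra.
Qed.

Lemma le_on_it n h k : stab h -> stab k -> le_on h k -> le_on (it n h) (it n k).
Proof.
  intros Sh Sk Hle x Cx. induction n as [|n IH]; simpl; [lra|].
  apply Rle_trans with (k (Nat.iter n h x)).
  - apply Hle. now apply (stab_it n h).
  - apply incr_le; auto. now apply stab_incr.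
Qed.

Lemma le_on_commute n h k : stab h -> stab k -> le_on (fun x => h (k x)) (fun x => k (h x)) ->
  le_on (fun x => Nat.iter n h (k x)) (fun x => k (Nat.iter n h x)).
Proof.
  intros Sh Sk Hle x Cx. induction n as [|n IH]; simpl; [lra|].
  apply Rle_trans with (h (k (Nat.iter n h x))).
  - apply incr_le; auto. now apply stab_incr.
  - apply Hle. now apply (stab_it n h).
Qed.

Lemma le_on_pow_comp n h k : stab h -> stab k -> le_on (fun x => h (k x)) (fun x => k (h x)) ->
  le_on (fun x => Nat.iter n h (Nat.iter n k x)) (it n (fun x => h (k x))).
Proof.
  intros Sh Sk Hle x Cx. induction n as [|n IH]; simpl; [lra|].
  apply Rle_trans with (h (k (Nat.iter n h (Nat.iter n k x)))).
  - apply incr_le; [now apply stab_incr|]. apply (le_on_commute n h k); auto. now apply (stab_it n k).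
  - apply incr_le; [now apply stab_incr|]. apply incr_le; [now apply stab_incr|auto].
Qed.

Notation fz := (zit f fi).

Lemma fz_stab m : stab (fz m).
Proof. apply stab_zit; auto. apply stab_f. Qed.

Lemma fz_lt m x : C x -> fz m x < fz (m + 1) x.
Proof. intros Cx. rewrite zit_succ; auto. apply (ax_up _ _ _ HA). now apply fz_stab. Qed.

Lemma fz_mono m n x : C x -> (m <= n)%Z -> fz m x <= fz n x.
Proof.
  intros Cx Hmn. replace n with (m + Z.of_nat (Z.to_nat (n - m)))%Z by lia.
  induction (Z.to_nat (n - m)) as [|j IH]; [rewrite Z.add_0_r; lra|].
  replace (m + Z.of_nat (S j))%Z with (m + Z.of_nat j + 1)%Z by lia.
  pose proof (fz_lt (m + Z.of_nat j) x Cx). lra.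
Qed.

Lemma fz_mono_inv m n x : C x -> fz m x <= fz n x -> (m <= n)%Z.
Proof.
  intros Cx H. destruct (Z.le_gt_cases m n); auto. exfalso.
  pose proof (fz_lt n x Cx). pose proof (fz_mono (n + 1) m x Cx). assert (n + 1 <= m)%Z by lia.
  pose proof (H2 H3). lra.
Qed.

Lemma fz_pow m n h : stab h -> le_on (fz m) h -> le_on (fz (m * Z.of_nat n)) (it n h).
Proof.
  intros Sh Hle x Cx. induction n as [|n IH].
  - simpl. rewrite Z.mul_0_r. unfold zit; simpl; lra.
  - replace (m * Z.of_nat (S n))%Z with (m + m * Z.of_nat n)%Z by lia. rewrite zit_add; auto. simpl.
    apply Rle_trans with (h (fz (m * Z.of_nat n) x)).
    + apply Hle. now apply fz_stab.
    + apply incr_le; auto. now apply stab_incr.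
Qed.

Lemma pow_fz m n h : stab h -> le_on h (fz m) -> le_on (it n h) (fz (m * Z.of_nat n)).
Proof.
  intros Sh Hle x Cx. induction n as [|n IH].
  - simpl. rewrite Z.mul_0_r. unfold zit; simpl; lra.
  - replace (m * Z.of_nat (S n))%Z with (m + m * Z.of_nat n)%Z by lia. rewrite zit_add; auto. simpl.
    apply Rle_trans with (fz m (Nat.iter n h x)).
    + apply Hle. now apply (stab_it n h).
    + apply incr_le; auto. now apply stab_incr, fz_stab.
Qed.

Let x0 := w1.

Lemma x0_in : C x0.
Proof. apply HwC. unfold x0. lra. Qed.

Lemma fz_floor h : stab h -> exists m, le_on (fz m) h /\ le_on h (fz (m + 1)).
Proof.
  intros Sh. pose proof x0_in as Cx. assert (Chx : C (h x0)) by now apply Sh.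
  destruct (ax_cof _ _ _ HA x0 (h x0)) as [n1 Hn1]; auto.
  destruct (ax_cof _ _ _ HA (h x0) x0) as [n2 Hn2]; auto.
  destruct (Z_threshold (fun m => fz m x0 <= h x0) (- Z.of_nat n2) (Z.of_nat n1)) as [m [Hm1 Hm2]].
  - lia.
  - apply (incr_le_inv (fz (Z.of_nat n2))); [apply stab_incr, fz_stab|].
    rewrite <- zit_add; auto. rewrite Z.add_opp_diag_r, zit_nat. left. exact Hn2.
  - rewrite zit_nat. lra.
  - exists m. split; apply (le_on_total _ _ x0); auto using fz_stab. lra.
Qed.

Definition ratios (h : R -> R) (r : R) : Prop :=
  exists m n, (1 <= n)%nat /\ r = IZR m / INR n /\ le_on (fz m) (it n h).

(* The translation number of [h] relative to [f]. *)
Definition phi (h : R -> R) : R := epsilon (inhabits 0) (is_lub (ratios h)).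

Lemma phi_lub h : stab h -> is_lub (ratios h) (phi h).
Proof.
  intros Sh. unfold phi; apply epsilon_spec. destruct (fz_floor h Sh) as [m [Hm1 Hm2]].
  destruct (completeness (ratios h)) as [s Hs]; [| |now exists s].
  - exists (IZR (m + 1)). intros r (m' & n & Hn & -> & Hr).
    assert (0 < INR n) by (apply lt_0_INR; lia).
    apply Rmult_le_reg_r with (INR n); auto. unfold Rdiv. rewrite Rmult_assoc, Rinv_l, Rmult_1_r by lra.
    rewrite INR_IZR_INZ, <- mult_IZR. apply IZR_le.
    apply (fz_mono_inv _ _ x0 x0_in). apply Rle_trans with (1 := Hr x0 x0_in).
    apply pow_fz; auto using x0_in.
  - exists (IZR m / INR 1), m, 1%nat. auto.
Qed.

Lemma phi_ge h m n : stab h -> (1 <= n)%nat -> le_on (fz m) (it n h) -> IZR m / INR n <= phi h.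
Proof. intros Sh Hn H. apply (phi_lub h Sh). now exists m, n. Qed.

Lemma phi_mono h k : stab h -> stab k -> le_on h k -> phi h <= phi k.
Proof.
  intros Sh Sk Hle. apply (phi_lub h Sh). intros r (m & n & Hn & -> & Hr).
  apply phi_ge; auto. intros x Cx. apply Rle_trans with (1 := Hr x Cx). now apply le_on_it.
Qed.

(* According to whether [h k <= k h] or [k h <= h k], either [h^n k^n] or [k^n h^n] lies below [(h k)^n]. *)
Lemma phi_super h k : stab h -> stab k -> phi h + phi k <= phi (fun x => h (k x)).
Proof.
  intros Sh Sk. assert (Shk : stab (fun x => h (k x))) by now apply (stab_comp h).
  assert (Skh : stab (fun x => k (h x))) by now apply (stab_comp k).
  assert (H : forall r r', ratios h r -> ratios k r' -> r + r' <= phi (fun x => h (k x))).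
  { intros r r' (m & n & Hn & -> & Hr) (m' & n' & Hn' & -> & Hr').
    assert (0 < INR n) by (apply lt_0_INR; lia). assert (0 < INR n') by (apply lt_0_INR; lia).
    set (N := (n * n')%nat).
    assert (H1 : le_on (fz (m * Z.of_nat n')) (it N h)).
    { intros x Cx. unfold N. rewrite Nat.mul_comm, it_mul. apply (fz_pow m n' (it n h)); auto.
      now apply stab_it. }
    assert (H2 : le_on (fz (m' * Z.of_nat n)) (it N k)).
    { intros x Cx. unfold N. rewrite it_mul. apply (fz_pow m' n (it n' k)); auto.
      now apply stab_it. }
    replace (IZR m / INR n + IZR m' / INR n') with
      (IZR (m * Z.of_nat n' + m' * Z.of_nat n) / INR N).
    2: { unfold N. rewrite mult_INR, plus_IZR, !mult_IZR, <- !INR_IZR_INZ. field. lra. }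
    apply phi_ge; auto; [unfold N; nia|].
    destruct (Rle_lt_dec (h (k x0)) (k (h x0))) as [Hle|Hlt].
    - assert (Hc : le_on (fun x => h (k x)) (fun x => k (h x))).
      { apply (le_on_total _ _ x0); auto using x0_in. }
      intros x Cx. rewrite zit_add; auto.
      apply Rle_trans with (Nat.iter N h (Nat.iter N k x)); [|now apply le_on_pow_comp].
      apply Rle_trans with (fz (m * Z.of_nat n') (Nat.iter N k x)).
      + apply incr_le; [apply stab_incr, fz_stab|]. auto.
      + apply H1. now apply (stab_it N k).
    - assert (Hc : le_on (fun x => k (h x)) (fun x => h (k x))).
      { apply (le_on_total _ _ x0); auto using x0_in. lra. }
      intros x Cx. rewrite Z.add_comm, zit_add; auto.
      apply Rle_trans with (Nat.iter N (fun y => k (h y)) x); [|now apply (le_on_it N (fun y => k (h y)))].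
      apply Rle_trans with (Nat.iter N k (Nat.iter N h x)); [|now apply (le_on_pow_comp N k h)].
      apply Rle_trans with (fz (m' * Z.of_nat n) (Nat.iter N h x)).
      + apply incr_le; [apply stab_incr, fz_stab|]. auto.
      + apply H2. now apply (stab_it N h). }
  assert (Hk : phi k <= phi (fun x => h (k x)) - phi h).
  { apply (phi_lub k Sk). intros r' Hr'.
    assert (phi h <= phi (fun x => h (k x)) - r').
    { apply (phi_lub h Sh). intros r Hr. pose proof (H r r' Hr Hr'). lra. }
    lra. }
  lra.
Qed.

Lemma phi_id : phi (fun x => x) = 0.
Proof.
  assert (Hi : forall n (x : R), Nat.iter n (fun y => y) x = x) by (intros n x; now apply it_fix).
  apply Rle_antisym.
  - apply (phi_lub _ stab_id). intros r (m & n & Hn & -> & Hr).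
    assert (0 < INR n) by (apply lt_0_INR; lia).
    assert (m <= 0)%Z.
    { apply (fz_mono_inv m 0 x0 x0_in). pose proof (Hr x0 x0_in) as Hr0. simpl in Hr0. now rewrite Hi in Hr0. }
    apply IZR_le in H0. apply Rmult_le_reg_r with (INR n); auto. unfold Rdiv.
    rewrite Rmult_assoc, Rinv_l; lra.
  - replace 0 with (IZR 0 / INR 1) by (simpl; lra). apply phi_ge; [apply stab_id|lia|].
    intros x Cx. simpl. unfold zit; simpl; lra.
Qed.

(** Superadditivity gives [phi h + phi g <= 0]. Conversely [h ^ n] lies between two consecutive
    powers of [f], so the sum is at least [- 1 / n] for every [n]. *)
Lemma phi_inv h g : stab h -> inv_of h g -> phi g = - phi h.
Proof.
  intros Sh HI. pose proof (stab_inv_of h g Sh HI) as Sg.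
  assert (phi h + phi g <= 0).
  { rewrite <- phi_id. replace (fun x => x) with (fun x => h (g x)); [now apply phi_super|].
    apply functional_extensionality. apply HI. }
  assert (0 <= phi h + phi g).
  { apply Rnot_lt_le; intros Hneg.
    destruct (archimed_cor1 (- (phi h + phi g))) as [n [Hn1 Hn2]]; [lra|].
    assert (Sn : stab (it n h)) by now apply stab_it.
    destruct (fz_floor _ Sn) as [m [Hm1 Hm2]].
    pose proof (phi_ge h m n Sh Hn2 Hm1) as E1.
    assert (E2 : IZR (- (m + 1)) / INR n <= phi g).
    { apply phi_ge; auto. intros x Cx. destruct (it_inv n h g HI) as [J1 J2].
      rewrite <- (J1 (fz (- (m + 1)) x)). apply (incr_le (it n g)); [now apply stab_incr, stab_it|].
      apply Rle_trans with (fz (m + 1) (fz (- (m + 1)) x)).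
      - apply Hm2. now apply fz_stab.
      - rewrite <- zit_add; auto. rewrite Z.add_opp_diag_r. unfold zit; simpl; lra. }
    rewrite opp_IZR, plus_IZR in E2. assert (0 < INR n) by (apply lt_0_INR; lia).
    unfold Rdiv in *. lra. }
  lra.
Qed.

Lemma phi_comp h k : stab h -> stab k -> phi (fun x => h (k x)) = phi h + phi k.
Proof.
  intros Sh Sk. apply Rle_antisym; [|now apply phi_super].
  destruct (stab_inv k Sk) as [g [Sg HI]].
  assert (Shk : stab (fun x => h (k x))) by now apply (stab_comp h).
  pose proof (phi_super (fun x => h (k x)) g Shk Sg) as E. simpl in E.
  replace (fun x => h (k (g x))) with h in E.
  2: { apply functional_extensionality; intros x. f_equal. symmetry; apply HI. }
  rewrite (phi_inv k g) in E; auto. lra.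
Qed.

(** Archimedean property: some power of [q] exceeds [f] at the base point, hence on all of [C]. *)
Lemma phi_pos q : stab q -> (forall x, C x -> x < q x) -> 0 < phi q.
Proof.
  intros Sq Hup. destruct (free_cofinal q Sq Hup x0 (f x0)) as [n Hn]; try apply x0_in.
  { apply stab_f. apply x0_in. }
  assert (1 <= n)%nat. 
  { destruct n; [|lia]. simpl in Hn. pose proof (ax_up _ _ _ HA x0 x0_in). lra. }
  assert (0 < INR n) by (apply lt_0_INR; lia).
  apply Rlt_le_trans with (IZR 1 / INR n).
  - unfold Rdiv. rewrite Rmult_1_l. now apply Rinv_0_lt_compat.
  - apply phi_ge; auto. apply (le_on_total _ _ x0); auto using fz_stab, stab_it, x0_in.
    unfold zit. simpl. lra.
Qed.

Lemma phi_lt h k x : stab h -> stab k -> C x -> h x < k x -> phi h < phi k.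
Proof.
  intros Sh Sk Cx Hlt. destruct (stab_inv h Sh) as [g [Sg HI]].
  assert (Sq : stab (fun y => g (k y))) by now apply (stab_comp g).
  assert (Hup : forall y, C y -> y < g (k y)).
  { intros y Cy. rewrite <- (proj1 HI y) at 1. apply (stab_incr g Sg).
    destruct (stab_trichotomy h k Sh Sk) as [H|[H|H]]; auto; pose proof (H x Cx); lra. }
  pose proof (phi_pos _ Sq Hup). rewrite (phi_comp g k), (phi_inv h g) in H; auto. lra.
Qed.

Lemma orbit_dense x y : C x -> C y -> x < y -> exists k, stab k /\ x < k x0 < y.
Proof.
  intros Cx Cy Hxy. destruct (orbit_meets w1 w2 x) as [k [Sk Hk]]; auto; try lra.
  destruct (stab_inv k Sk) as [g [Sg HI]]. pose proof (stab_incr k Sk) as Ik. pose proof (stab_incr g Sg) as Ig.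
  pose proof (Ik _ _ Hxy). pose proof (Rmin_l (k y) w2). pose proof (Rmin_r (k y) w2).
  assert (k x < Rmin (k y) w2) by (apply Rmin_glb_lt; lra).
  destruct (orbit_meets (k x) (Rmin (k y) w2) x0) as [l [Sl Hl]]; auto using x0_in; try lra.
  exists (fun z => g (l z)). split; [now apply (stab_comp g)|].
  rewrite <- (proj1 HI x), <- (proj1 HI y). split; apply Ig; lra.
Qed.

Definition below (x r : R) : Prop := exists h, stab h /\ h x0 <= x /\ r = phi h.

(** The extension of [h x0 -> phi h] from the orbit of the base point to [C] by suprema. *)
Definition pi (x : R) : R := epsilon (inhabits 0) (is_lub (below x)).

Lemma pi_lub x : C x -> is_lub (below x) (pi x).
Proof.
  intros Cx. unfold pi; apply epsilon_spec.
  destruct (ax_cof _ _ _ HA x0 x x0_in Cx) as [n1 Hn1].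
  destruct (ax_cof _ _ _ HA x x0 Cx x0_in) as [n2 Hn2].
  destruct (completeness (below x)) as [s Hs]; [| |now exists s].
  - exists (phi (it n1 f)). intros r (h & Sh & Hh & ->).
    apply phi_mono; auto using stab_it, stab_f.
    apply (le_on_total _ _ x0); auto using stab_it, stab_f, x0_in. lra.
  - exists (phi (it n2 fi)), (it n2 fi). split; [|split; auto].
    + apply stab_it. apply (stab_inv_of f); auto using stab_f.
    + destruct (it_inv n2 f fi Hf) as [J1 J2]. rewrite <- (J1 x). left.
      apply (it_incr n2 fi); auto. now apply (ig_incr _ HG).
Qed.

Lemma pi_equiv k x : stab k -> C x -> pi (k x) = pi x + phi k.
Proof.
  assert (Hle : forall k x, stab k -> C x -> pi (k x) <= pi x + phi k).
  { clear k x. intros k x Sk Cx. assert (Ckx : C (k x)) by now apply Sk.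
    destruct (stab_inv k Sk) as [g [Sg HI]].
    apply (pi_lub _ Ckx). intros r (h & Sh & Hh & ->).
    assert (phi (fun y => g (h y)) <= pi x).
    { apply (pi_lub _ Cx). exists (fun y => g (h y)). split; [now apply (stab_comp g)|split; auto].
      rewrite <- (proj1 HI x). apply incr_le; auto. now apply stab_incr. }
    rewrite (phi_comp g h), (phi_inv k g) in H; auto. lra. }
  intros Sk Cx. apply Rle_antisym; auto.
  destruct (stab_inv k Sk) as [g [Sg HI]]. assert (Ckx : C (k x)) by now apply Sk.
  pose proof (Hle g (k x) Sg Ckx) as E. rewrite (proj1 HI), (phi_inv k g) in E; auto. lra.
Qed.

Lemma pi_incr x y : C x -> C y -> x < y -> pi x < pi y.
Proof.
  intros Cx Cy Hxy. destruct (orbit_dense x y) as [k1 [S1 H1]]; auto.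
  assert (Ck1 : C (k1 x0)) by (apply S1, x0_in).
  destruct (orbit_dense (k1 x0) y) as [k2 [S2 H2]]; auto; [lra|].
  apply Rle_lt_trans with (phi k1).
  - apply (pi_lub x Cx). intros r (h & Sh & Hh & ->). left. apply (phi_lt h k1 x0); auto using x0_in. lra.
  - apply Rlt_le_trans with (phi k2).
    + apply (phi_lt k1 k2 x0); auto using x0_in. lra.
    + apply (pi_lub y Cy). exists k2. repeat split; auto; try apply S2. lra.
Qed.

(** By density an orbit point [k x0] falls strictly between [x0] and [q x0]; one of [k] and [k^-1 q]
    then has at most half the translation number of [q]. *)
Lemma phi_small eps : 0 < eps -> exists q, stab q /\ (forall x, C x -> x < q x) /\ 0 < phi q < eps.
Proof.
  intros Heps.
  assert (Hn : forall n, exists q, stab q /\ (forall x, C x -> x < q x) /\ INR (S n) * phi q <= phi f).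
  { induction n as [|n (q & Sq & Hup & Hq)].
    - exists f. split; [apply stab_f|split; [apply (ax_up _ _ _ HA)|simpl; lra]].
    - destruct (orbit_dense x0 (q x0)) as [k [Sk Hk]]; auto using x0_in.
      { apply Sq, x0_in. }
      destruct (stab_inv k Sk) as [g [Sg HI]].
      assert (Hk1 : forall x, C x -> x < k x).
      { destruct (stab_trichotomy _ _ stab_id Sk) as [H|[H|H]]; auto; pose proof (H x0 x0_in); simpl in *; lra. }
      assert (Hk2 : forall x, C x -> x < g (q x)).
      { intros x Cx. rewrite <- (proj1 HI x) at 1. apply (stab_incr g Sg).
        destruct (stab_trichotomy _ _ Sk Sq) as [H|[H|H]]; auto; pose proof (H x0 x0_in); lra. }
      assert (Sgq : stab (fun x => g (q x))) by now apply (stab_comp g).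
      assert (E : phi (fun x => g (q x)) = phi q - phi k) by (rewrite (phi_comp g q), (phi_inv k g); auto; lra).
      pose proof (pos_INR n). rewrite S_INR in *. rewrite S_INR.
      destruct (Rle_lt_dec (phi k) (phi q / 2)) as [Hle|Hlt].
      + exists k. split; auto. split; auto. pose proof (phi_pos k Sk Hk1). nra.
      + exists (fun x => g (q x)). split; auto. split; auto. rewrite E.
        pose proof (phi_pos _ Sgq Hk2). nra. }
  destruct (INR_unbounded (phi f / eps)) as [n Hn'].
  destruct (Hn n) as (q & Sq & Hup & Hq). exists q. split; auto. split; auto.
  pose proof (phi_pos q Sq Hup) as Hp. split; auto.
  apply Rnot_le_lt; intros Hle. rewrite S_INR in Hq. pose proof (pos_INR n).
  assert (phi f < INR n * eps).
  { apply Rmult_lt_reg_r with (/ eps); [now apply Rinv_0_lt_compat|]. rewrite Rmult_assoc, Rinv_r; lra. }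
  nra.
Qed.

Lemma pi_surj y : exists u, C u /\ pi u = y.
Proof.
  pose proof x0_in as Cx0. pose proof (phi_pos f stab_f (ax_up _ _ _ HA)) as Hpf.
  assert (Hup : exists n, y < pi (Nat.iter n f x0)).
  { destruct (INR_unbounded ((y - pi x0) / phi f)) as [n Hn]. exists n.
    assert (E : pi (Nat.iter n f x0) = pi x0 + INR n * phi f).
    { clear Hn. induction n as [|n IH]; [simpl; lra|]. rewrite S_INR. simpl.
      rewrite pi_equiv, IH; [lra|apply stab_f|]. now apply (stab_it n f stab_f). }
    rewrite E. apply (Rmult_lt_compat_r (phi f)) in Hn; auto. unfold Rdiv in Hn.
    rewrite Rmult_assoc, Rinv_l in Hn; lra. }
  assert (Sfi : stab fi) by (apply (stab_inv_of f); auto using stab_f).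
  assert (Hdn : exists n, pi (Nat.iter n fi x0) <= y).
  { destruct (INR_unbounded ((pi x0 - y) / phi f)) as [n Hn]. exists n.
    assert (E : pi (Nat.iter n fi x0) = pi x0 - INR n * phi f).
    { clear Hn. induction n as [|n IH]; [simpl; lra|]. rewrite S_INR. simpl.
      rewrite pi_equiv, IH, (phi_inv f fi); [lra|apply stab_f|auto|auto|].
      now apply (stab_it n fi). }
    rewrite E. apply (Rmult_lt_compat_r (phi f)) in Hn; auto. unfold Rdiv in Hn.
    rewrite Rmult_assoc, Rinv_l in Hn; lra. }
  destruct Hup as [n1 Hn1]. destruct Hdn as [n2 Hn2].
  assert (C1 : C (Nat.iter n1 f x0)) by now apply (stab_it n1 f stab_f).
  assert (C2 : C (Nat.iter n2 fi x0)) by now apply (stab_it n2 fi Sfi).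
  destruct (completeness (fun u => C u /\ pi u <= y)) as [u [U1 U2]].
  - exists (Nat.iter n1 f x0). intros u [Cu Hu]. apply Rnot_lt_le; intros Hlt.
    pose proof (pi_incr _ _ C1 Cu Hlt). lra.
  - now exists (Nat.iter n2 fi x0).
  - assert (Cu : C u).
    { apply (ax_conv _ _ _ HA (Nat.iter n2 fi x0) (Nat.iter n1 f x0)); auto. split.
      - apply U1. auto.
      - apply U2. intros v [Cv Hv]. apply Rnot_lt_le; intros Hlt.
        pose proof (pi_incr _ _ C1 Cv Hlt). lra. }
    exists u. split; auto. destruct (Rtotal_order (pi u) y) as [Hlt|[E|Hgt]]; auto; exfalso.
    + destruct (phi_small (y - pi u)) as (q & Sq & Hq1 & Hq2); [lra|].
      pose proof (pi_equiv q u Sq Cu). pose proof (Hq1 u Cu).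
      assert (q u <= u). { apply U1. split; [now apply Sq|lra]. } lra.
    + destruct (phi_small (pi u - y)) as (q & Sq & Hq1 & Hq2); [lra|].
      destruct (stab_inv q Sq) as [g [Sg HI]]. pose proof (pi_equiv g u Sg Cu) as E.
      rewrite (phi_inv q g) in E; auto. assert (Cgu : C (g u)) by now apply Sg.
      assert (Hgu : g u < u). { rewrite <- (proj2 HI u) at 2. auto. }
      assert (u <= g u); [|lra]. apply U2. intros v [Cv Hv]. apply Rnot_lt_le; intros Hlt.
      pose proof (pi_incr _ _ Cgu Cv Hlt). lra.
Qed.

End Holder.

(** * A dense family of intervals with translation charts *)

(** By [gd_trans] the translates of [(a, b)] are equal or disjoint, and the stabilizer acts by
    translations in the chart [p], which stretches [(a, b)] over the whole line. *)
Record good (Gam : (R -> R) -> Prop) (a b : R) (p : R -> R) : Prop := {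
  gd_ne : a < b;
  gd_incr : forall u v, a < u -> u < v -> v < b -> p u < p v;
  gd_surj : forall y, exists u, a < u < b /\ p u = y;
  gd_trans : forall h, Gam h -> (exists u, a < u < b /\ a < h u < b) ->
    exists c, forall v, a < v < b -> a < h v < b /\ p (h v) = p v + c }.

Definition translation_like (Gam : (R -> R) -> Prop) (p : R -> R) : Prop :=
  incr p /\ (forall y, exists u, p u = y) /\
  forall h, Gam h -> exists c, forall v, p (h v) = p v + c.

Lemma interval_chart a b : a < b -> exists p : R -> R,
  (forall u v, a < u -> u < v -> v < b -> p u < p v) /\
  (forall y, exists u, a < u < b /\ p u = y).
Proof.
  intros Hab. pose proof PI_RGT_0 as HPI.
  exists (fun u => tan (PI * ((u - a) / (b - a) - / 2))). 
  assert (Hinv : 0 < / (b - a)) by (apply Rinv_0_lt_compat; lra).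
  assert (Hb : forall u, a < u < b -> 0 < (u - a) / (b - a) < 1).
  { intros u Hu. unfold Rdiv. split; [apply Rmult_lt_0_compat; lra|].
    apply Rmult_lt_reg_r with (b - a); [lra|]. rewrite Rmult_assoc, Rinv_l; lra. }
  split.
  - intros u v Hu Huv Hv. pose proof (Hb u). pose proof (Hb v).
    assert ((u - a) / (b - a) < (v - a) / (b - a)) by (apply Rmult_lt_compat_r; lra).
    apply tan_increasing; nra.
  - intros y. pose proof (atan_bound y) as Hat.
    set (r := / 2 + atan y / PI).
    assert (Hr : atan y = PI * (r - / 2)) by (unfold r; field; lra).
    assert (0 < r < 1) by (split; nra).
    exists (a + (b - a) * r). split; [nra|].
    replace ((a + (b - a) * r - a) / (b - a)) with r by (field; lra).
    rewrite <- Hr. apply tan_atan.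
Qed.

Section Family.
Variables (Gam : (R -> R) -> Prop) (L : (R -> R) -> nat) (Cst d : nat).
Hypothesis HL : lgroup Gam L Cst d.
Let HG := lg_ig _ _ _ _ HL.

(** Otherwise [shift] sends a point of [(a, b)] into [(a, b)] and would have to preserve the
    interval, which fails near its right end. *)
Lemma good_length a b p : good Gam a b p -> b <= a + 1.
Proof.
  intros Hgd. apply Rnot_lt_le; intros Hlt.
  destruct (gd_trans _ _ _ _ Hgd shift (lg_shift _ _ _ _ HL)) as [c Hc].
  - exists ((a + b - 1) / 2). unfold shift. lra.
  - destruct (Hc ((Rmax a (b - 1) + b) / 2)) as [[H1 H2] _];
      pose proof (Rmax_l a (b - 1)); pose proof (Rmax_r a (b - 1));
      assert (Rmax a (b - 1) < b) by (apply Rmax_lub_lt; lra); unfold shift in *; lra.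
Qed.

Lemma good_dichotomy : (exists p, translation_like Gam p) \/
  forall u1 u2, u1 < u2 -> exists a b p, good Gam a b p /\
    forall x, a < x < b -> exists h, Gam h /\ u1 < h x < u2.
Proof.
  destruct (classic (exists p, translation_like Gam p)) as [|Hno]; [now left|]. right.
  intros u1 u2 Hu.
  destruct (minimal_axis Gam L Cst d HL u1 u2 Hu) as (f & C & w1 & w2 & HA & Hsh & Hw & Hsub & Hmin).
  destruct (classic (forall j1 j2, w1 <= j1 -> j1 < j2 -> j2 <= w2 ->
    exists k p, Gam k /\ j1 < p /\ p < k p /\ k p < j2)) as [Hrec|Hrec].
  (* Recurrent case: [pi] is a translation chart on [C]. If [C] is the whole line it conjugates the
     entire group, which [Hno] excludes. *)
  - destruct (ig_inv _ HG f (ax_in _ _ _ HA)) as [fi [Hfi HI]].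
    assert (HwC : forall u, w1 <= u <= w2 -> C u) by (intros u H'; now apply Hsub).
    set (p := pi Gam f fi C w1).
    assert (Pi : forall x y, C x -> C y -> x < y -> p x < p y)
      by (intros; now apply (pi_incr Gam f fi C w1 w2)).
    assert (Ps : forall y, exists u, C u /\ p u = y)
      by (intros; now apply (pi_surj Gam f fi C w1 w2)).
    assert (Pe : forall h, stab Gam C h -> forall x, C x -> p (h x) = p x + phi f fi C h)
      by (intros; now apply (pi_equiv Gam f fi C w1 w2)).
    destruct Hsh as [Hall|(a & b & Hab & HC)].
    + exfalso. apply Hno. exists p. split; [|split].
      * intros x y Hxy. now apply Pi.
      * intros y. destruct (Ps y) as [u [_ E]]. eauto.
      * intros h Hh. exists (phi f fi C h). intros v. apply Pe; auto. split; auto.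
    + exists a, b, p. split; [split; auto|].
      * intros u v H1 H2 H3. apply Pi; auto; apply HC; lra.
      * intros y. destruct (Ps y) as [u [Cu E]]. exists u. split; auto. now apply HC.
      * intros h Hh [u [Hu1 Hu2]]. exists (phi f fi C h).
        assert (Sh : stab Gam C h).
        { apply (stab_intro Gam f C HA h u); auto; now apply HC. }
        intros v Hv. apply HC in Hv. split; [|now apply Pe]. apply HC. now apply Sh.
      * intros x Hx. apply HC in Hx.
        destruct (orbit_meets Gam f C w1 w2 HG HA HwC Hmin Hrec w1 w2 x) as [k [[Sk _] Hk]]; auto; try lra.
        exists k. split; auto. destruct (Hsub (k x)); lra.
  (* Wandering case: no element moves a point of [(j1, j2)] to another point of it. An element that
     returns a point has a fixed point, hence is trivial on the window, so any chart of [(j1, j2)]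
     serves. *)
  - apply not_all_ex_not in Hrec as [j1 Hrec]. apply not_all_ex_not in Hrec as [j2 Hrec].
    apply imply_to_and in Hrec as [H1 Hrec]. apply imply_to_and in Hrec as [H2 Hrec].
    apply imply_to_and in Hrec as [H3 Hrec].
    assert (Hfix : forall h u, Gam h -> j1 < u < j2 -> j1 < h u < j2 -> h u = u).
    { intros h u Hh Hu1 Hu2. destruct (Rtotal_order u (h u)) as [Hlt|[E|Hgt]]; auto; exfalso; apply Hrec.
      - exists h, u. repeat split; auto; lra.
      - destruct (ig_inv _ HG h Hh) as [g [Hg [I1 I2]]]. exists g, (h u). rewrite I1. repeat split; auto; lra. }
    destruct (interval_chart j1 j2 H2) as (p & P1 & P2).
    exists j1, j2, p. split; [split; auto|].
    + intros h Hh [u [Hu1 Hu2]]. exists 0. intros v Hv. rewrite Rplus_0_r.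
      assert (E : h v = v); [|rewrite E; auto].
      destruct (Hmin h Hh) as [Hfree|Hid].
      * apply (ax_block _ _ _ HA h Hh). exists u. split; apply Hsub; lra.
      * exfalso. apply (Hfree u); [apply Hsub; lra|]. now apply Hfix.
      * apply Hid. lra.
    + intros x Hx. exists (fun y => y). split; [apply (ig_id _ HG)|]. apply Hsub. lra.
Qed.

Definition item := (R * R * (R -> R))%type.
Definition in_item (J : item) (x : R) : Prop := fst (fst J) < x < snd (fst J).
Definition good_item (J : item) : Prop := good Gam (fst (fst J)) (snd (fst J)) (snd J).
Definition apart (J J' : item) : Prop := forall h u, Gam h -> in_item J u -> ~ in_item J' (h u).
Definition meets (J : item) (u1 u2 : R) : Prop := exists h z, Gam h /\ u1 < z < u2 /\ in_item J (h z).

(** Through the Cantor pairing these intervals run over all [(p / q, (p + 1) / q)] with [p >= 0] and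
    [q >= 1]. Integer translations supply the negative part of the line. *)
Definition left_end (n : nat) : R := INR (snd (of_nat n)) / INR (S (fst (of_nat n))).
Definition right_end (n : nat) : R := (INR (snd (of_nat n)) + 1) / INR (S (fst (of_nat n))).

Definition eligible (l : list item) (n : nat) (J : item) : Prop :=
  good_item J /\ meets J (left_end n) (right_end n) /\ forall J', In J' l -> apart J' J.

Definition pick_item (l : list item) (n : nat) : option item :=
  match excluded_middle_informative (exists J, eligible l n J) with
  | left H => Some (proj1_sig (constructive_indefinite_description _ H))
  | right _ => None
  end.

(** A greedy choice. Disjointness of the orbits is built in; density holds because at step [n]
    either an earlier orbit already meets the [n]-th interval or a new item is eligible. *)
Fixpoint picked (n : nat) : list item :=
  match n with
  | O => nil
  | S n' => match pick_item (picked n') n' with Some J => J :: picked n' | None => picked n' end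
  end.

Lemma pick_some l n J : pick_item l n = Some J -> eligible l n J.
Proof.
  unfold pick_item. destruct (excluded_middle_informative _) as [H|H]; [|discriminate].
  intros E. injection E as <-. apply proj2_sig.
Qed.

Lemma picked_in m n J : (m < n)%nat -> pick_item (picked m) m = Some J -> In J (picked n).
Proof.
  intros Hmn E. induction Hmn as [|n _ IH]; simpl.
  - rewrite E. now left.
  - destruct (pick_item (picked n) n); auto. now right.
Qed.

Lemma picked_inv n J : In J (picked n) -> exists m, pick_item (picked m) m = Some J.
Proof.
  induction n as [|n IH]; simpl; [tauto|].
  destruct (pick_item (picked n) n) as [J'|] eqn:E; auto. intros [<-|H]; eauto.
Qed.

Lemma apart_sym J J' : apart J J' -> apart J' J.
Proof.
  intros H h u Hh Hu Hhu. destruct (ig_inv _ HG h Hh) as [g [Hg [I1 I2]]].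
  apply (H g (h u)); auto. now rewrite I1.
Qed.

Lemma base_interval x y : x < y -> exists n k, x < left_end n - INR k /\ right_end n - INR k < y.
Proof.
  intros Hxy. destruct (INR_unbounded (Rabs x + 1)) as [k Hk].
  destruct (archimed_cor1 ((y - x) / 3)) as [q [Hq1 Hq2]]; [lra|].
  assert (Hq : 0 < INR q) by (apply lt_0_INR; lia).
  assert (Hx : 0 <= x + INR k) by (unfold Rabs in Hk; destruct (Rcase_abs x); lra).
  destruct (archimed ((x + INR k) * INR q)) as [A1 A2].
  set (z := up ((x + INR k) * INR q)) in *.
  assert (Hz : (0 <= z)%Z). { apply le_IZR. pose proof (Rmult_le_pos _ _ Hx (Rlt_le _ _ Hq)). lra. }
  exists (to_nat (pred q, Z.to_nat z)), k. unfold left_end, right_end. rewrite cancel_of_to. cbn [fst snd].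
  replace (S (pred q)) with q by lia. rewrite INR_IZR_INZ, Z2Nat.id by auto.
  assert (E : x + INR k = (x + INR k) * INR q / INR q) by (field; lra).
  assert (Hqi : 0 < / INR q) by now apply Rinv_0_lt_compat.
  split.
  - assert (x + INR k < IZR z / INR q) by (rewrite E; apply Rmult_lt_compat_r; lra). lra.
  - assert ((IZR z + 1) / INR q <= x + INR k + 2 * / INR q); [|lra].
    rewrite E at 1. unfold Rdiv. rewrite <- Rmult_plus_distr_r. apply Rmult_le_compat_r; lra.
Qed.

Lemma shift_back k : exists g, Gam g /\ forall x, g x = x - INR k.
Proof.
  destruct (ig_inv _ HG shift (lg_shift _ _ _ _ HL)) as [s [Hs [I1 I2]]].
  exists (it k s). split; [now apply it_in|]. induction k as [|k IH]; intros x.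
  - simpl; lra.
  - rewrite it_succ_r, IH, S_INR. pose proof (I2 x) as E. unfold shift in E. lra.
Qed.

Lemma family_exists : (exists p, translation_like Gam p) \/
  exists (V : nat -> Prop) (a b : nat -> R) (p : nat -> R -> R),
    (forall i, V i -> good Gam (a i) (b i) (p i)) /\
    (forall i j h u, V i -> V j -> Gam h -> a i < u < b i -> a j < h u < b j -> i = j) /\
    (forall x y, x < y -> exists i h z, V i /\ Gam h /\ x < z < y /\ a i < h z < b i).
Proof.
  destruct good_dichotomy as [|Hgood]; [now left|]. right.
  set (fam := fun n => pick_item (picked n) n).
  set (dflt := (0, 0, fun x : R => x) : item).
  set (it' := fun n => match fam n with Some J => J | None => dflt end).
  exists (fun n => fam n <> None), (fun n => fst (fst (it' n))), (fun n => snd (fst (it' n))), (fun n => snd (it' n)).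
  assert (Hfam : forall n, fam n <> None -> fam n = Some (it' n)).
  { intros n Hn. unfold it'. destruct (fam n); congruence. }
  split; [|split].
  - intros i Hi. exact (proj1 (pick_some _ _ _ (Hfam i Hi))).
  - assert (Hlt : forall i j, fam i <> None -> fam j <> None -> (i < j)%nat -> apart (it' i) (it' j)).
    { intros i j Hi Hj Hij. apply (pick_some _ _ _ (Hfam j Hj)). apply (picked_in i); auto. exact (Hfam i Hi). }
    intros i j h u Hi Hj Hh Hu Hhu. destruct (Nat.lt_total i j) as [Hij|[E|Hij]]; auto; exfalso.
    + apply (Hlt i j Hi Hj Hij h u); auto.
    + apply (apart_sym _ _ (Hlt j i Hj Hi Hij) h u); auto.
  - intros x y Hxy. destruct (base_interval x y Hxy) as (n & k & H1 & H2).
    assert (Hm : exists i, fam i <> None /\ meets (it' i) (left_end n) (right_end n)).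
    { destruct (classic (exists J, In J (picked n) /\ meets J (left_end n) (right_end n))) as [[J [HJ Hm]]|Hno].
      - apply picked_inv in HJ as [i Hi]. exists i. change (fam i = Some J) in Hi. 
        unfold it'. rewrite Hi. split; [discriminate|auto].
      - assert (Hlr : left_end n < right_end n).
        { unfold left_end, right_end. apply Rmult_lt_compat_r; [|lra].
          apply Rinv_0_lt_compat, lt_0_INR. lia. }
        destruct (Hgood _ _ Hlr) as (a & b & p & Hgd & Hcov).
        (* The orbit of the [n]-th interval covers the new interval, so an earlier orbit that met
           the new interval would also meet the [n]-th one. *)
        assert (He : exists J, eligible (picked n) n J).
        { exists (a, b, p). split; [auto|split].
          - pose proof (gd_ne _ _ _ _ Hgd) as Hab.
            destruct (Hcov ((a + b) / 2)) as [h [Hh Hhx]]; [lra|].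
            destruct (ig_inv _ HG h Hh) as [g [Hg [I1 I2]]].
            exists g, (h ((a + b) / 2)). split; [auto|split; [auto|]]. rewrite I1. unfold in_item; simpl; lra.
          - intros J HJ h u Hh Hu Hhu. apply Hno. exists J. split; auto.
            destruct (Hcov (h u)) as [g [Hg Hgu]]; [exact Hhu|].
            assert (Hgh : Gam (fun x => g (h x))) by now apply (ig_comp _ HG g).
            destruct (ig_inv _ HG _ Hgh) as [e [He [I1 I2]]].
            exists e, (g (h u)). split; [auto|split; [auto|]]. now rewrite I1. }
        assert (Hsome : exists J, fam n = Some J).
        { unfold fam, pick_item. destruct (excluded_middle_informative _); [eauto|contradiction]. }
        destruct Hsome as [J HJ]. exists n. split; [congruence|].
        unfold it'. rewrite HJ. apply (pick_some _ _ _ HJ). }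
    destruct Hm as [i [Hi (h & z & Hh & Hz & Hin)]].
    destruct (shift_back k) as [s [Hs Es]]. destruct (ig_inv _ HG s Hs) as [si [Hsi [I1 I2]]].
    exists i, (fun x => h (si x)), (s z). split; [auto|split; [now apply (ig_comp _ HG h)|split]].
    + rewrite Es. lra.
    + rewrite I1. exact Hin.
Qed.

End Family.

(** * Unordered sums and the Cauchy kernel *)

Section Sums.
Context {X : Type}.
Variable P : X -> Prop.

Definition fsum (a : X -> R) (l : list X) : R := fold_right (fun x s => a x + s) 0 l.

Definition on_P (l : list X) : Prop := NoDup l /\ forall x, In x l -> P x.

(** Convergence along the net of finite subsets, which requires no enumeration of the group and is
    invariant under bijections of the indices. *)
Definition has_sum (a : X -> R) (s : R) : Prop :=
  forall eps, 0 < eps -> exists l0, on_P l0 /\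
    forall l, on_P l -> incl l0 l -> Rabs (fsum a l - s) < eps.

Lemma eq_dec_classic (x y : X) : {x = y} + {x <> y}.
Proof. apply excluded_middle_informative. Qed.

Lemma on_P_union l1 l2 : on_P l1 -> on_P l2 -> exists l, on_P l /\ incl l1 l /\ incl l2 l.
Proof.
  intros [N1 H1] [N2 H2]. exists (nodup eq_dec_classic (l1 ++ l2)). split; [split|split].
  - apply NoDup_nodup.
  - intros x Hx. apply nodup_In, in_app_iff in Hx as [|]; auto.
  - intros x Hx. apply nodup_In, in_app_iff; auto.
  - intros x Hx. apply nodup_In, in_app_iff; auto.
Qed.

Lemma on_P_nil : on_P nil.
Proof. split; [constructor|intros x []]. Qed.

Lemma fsum_plus a b l : fsum (fun x => a x + b x) l = fsum a l + fsum b l.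
Proof. induction l; simpl; lra. Qed.

Lemma fsum_scal c a l : fsum (fun x => c * a x) l = c * fsum a l.
Proof. induction l; simpl; [lra|rewrite IHl; lra]. Qed.

Lemma fsum_le a b l : (forall x, In x l -> a x <= b x) -> fsum a l <= fsum b l.
Proof.
  induction l as [|x l IH]; intros H; simpl; [lra|].
  assert (a x <= b x) by (apply H; now left).
  assert (fsum a l <= fsum b l) by (apply IH; intros; apply H; now right). lra.
Qed.

Lemma fsum_ext a b l : (forall x, In x l -> a x = b x) -> fsum a l = fsum b l.
Proof. intros H. apply Rle_antisym; apply fsum_le; intros x Hx; rewrite H; auto; lra. Qed.

Lemma fsum_app a l1 l2 : fsum a (l1 ++ l2) = fsum a l1 + fsum a l2.
Proof. induction l1; simpl; lra. Qed.

Lemma fsum_filter a (t : X -> bool) l :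
  fsum a l = fsum a (filter t l) + fsum a (filter (fun x => negb (t x)) l).
Proof. induction l as [|x l IH]; simpl; [lra|]. destruct (t x); simpl; lra. Qed.

Lemma fsum_const c l : fsum (fun _ => c) l = INR (length l) * c.
Proof. induction l as [|x l IH]; [simpl; lra|]. cbn [fsum fold_right]. fold (fsum (fun _ => c) l).
  rewrite IH. change (length (x :: l)) with (S (length l)). rewrite S_INR. lra. Qed.

Lemma fsum_incl a l l' : (forall x, In x l' -> 0 <= a x) -> NoDup l -> incl l l' -> fsum a l <= fsum a l'.
Proof.
  revert l'. induction l as [|x l IH]; intros l' Hpos Hnd Hincl; simpl.
  - clear Hincl. induction l' as [|y l' IH]; simpl; [lra|].
    assert (0 <= a y) by (apply Hpos; now left).
    assert (0 <= fsum a l') by (apply IH; intros; apply Hpos; now right). lra.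
  - inversion Hnd; subst. destruct (in_split x l') as (l1 & l2 & ->); [apply Hincl; now left|].
    assert (fsum a l <= fsum a (l1 ++ l2)).
    { apply IH; auto.
      - intros y Hy. apply Hpos. rewrite in_app_iff in *. simpl. tauto.
      - intros y Hy. assert (In y (l1 ++ x :: l2)) by (apply Hincl; now right).
        rewrite in_app_iff in *. simpl in *. intuition. subst. contradiction. }
    rewrite fsum_app in *. simpl. lra.
Qed.

Lemma has_sum_plus a b s t : has_sum a s -> has_sum b t -> has_sum (fun x => a x + b x) (s + t).
Proof.
  intros Ha Hb eps Heps. destruct (Ha (eps / 2)) as [l1 [O1 H1]]; [lra|].
  destruct (Hb (eps / 2)) as [l2 [O2 H2]]; [lra|].
  destruct (on_P_union l1 l2 O1 O2) as (l0 & O0 & I1 & I2). exists l0. split; auto.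
  intros l O I. specialize (H1 l O (incl_tran I1 I)). specialize (H2 l O (incl_tran I2 I)).
  rewrite fsum_plus. replace (fsum a l + fsum b l - (s + t)) with ((fsum a l - s) + (fsum b l - t)) by lra.
  pose proof (Rabs_triang (fsum a l - s) (fsum b l - t)). lra.
Qed.

Lemma has_sum_scal c a s : has_sum a s -> has_sum (fun x => c * a x) (c * s).
Proof.
  intros Ha eps Heps. assert (Hc : 0 < Rabs c + 1) by (pose proof (Rabs_pos c); lra).
  destruct (Ha (eps / (Rabs c + 1))) as [l0 [O0 H0]]; [now apply Rdiv_lt_0_compat|].
  exists l0. split; auto. intros l O I. specialize (H0 l O I).
  rewrite fsum_scal. replace (c * fsum a l - c * s) with (c * (fsum a l - s)) by lra.
  rewrite Rabs_mult. apply Rle_lt_trans with ((Rabs c + 1) * Rabs (fsum a l - s)).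
  - apply Rmult_le_compat_r; [apply Rabs_pos|lra].
  - apply (Rmult_lt_compat_l (Rabs c + 1)) in H0; auto. 
    replace ((Rabs c + 1) * (eps / (Rabs c + 1))) with eps in H0 by (field; lra). auto.
Qed.

Lemma has_sum_ext a b s : (forall x, P x -> a x = b x) -> has_sum a s -> has_sum b s.
Proof.
  intros E Ha eps Heps. destruct (Ha eps Heps) as [l0 [O0 H0]]. exists l0. split; auto.
  intros l O I. rewrite <- (fsum_ext a b); auto. intros x Hx. apply E. now apply O.
Qed.

Lemma has_sum_minus a b s t : has_sum a s -> has_sum b t -> has_sum (fun x => a x - b x) (s - t).
Proof.
  intros Ha Hb. replace (s - t) with (s + (-1) * t) by lra.
  apply (has_sum_ext (fun x => a x + (-1) * b x)); [intros; lra|].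
  apply has_sum_plus; auto. now apply has_sum_scal.
Qed.

Lemma has_sum_le a b s t : has_sum a s -> has_sum b t -> (forall x, P x -> a x <= b x) -> s <= t.
Proof.
  intros Ha Hb Hle. apply Rnot_lt_le; intros Hlt.
  destruct (Ha ((s - t) / 2)) as [l1 [O1 H1]]; [lra|].
  destruct (Hb ((s - t) / 2)) as [l2 [O2 H2]]; [lra|].
  destruct (on_P_union l1 l2 O1 O2) as (l & O & I1 & I2).
  specialize (H1 l O I1). specialize (H2 l O I2).
  assert (fsum a l <= fsum b l) by (apply fsum_le; intros; apply Hle, O; auto).
  apply Rabs_def2 in H1. apply Rabs_def2 in H2. lra.
Qed.

Lemma has_sum_unique a s t : has_sum a s -> has_sum a t -> s = t.
Proof. intros H1 H2. apply Rle_antisym; eapply has_sum_le; eauto; intros; lra. Qed.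

Lemma has_sum_abs_le a b s t : has_sum a s -> has_sum b t -> (forall x, P x -> Rabs (a x) <= b x) ->
  Rabs s <= t.
Proof.
  intros Ha Hb H. apply Rabs_le. split.
  - assert (Hb' : has_sum (fun x => (-1) * b x) ((-1) * t)) by now apply has_sum_scal.
    assert ((-1) * t <= s); [|lra]. apply (has_sum_le _ _ _ _ Hb' Ha). intros x Hx.
    pose proof (H x Hx). pose proof (Rle_abs (- a x)). rewrite Rabs_Ropp in H1. lra.
  - apply (has_sum_le _ _ _ _ Ha Hb). intros x Hx. pose proof (H x Hx). pose proof (Rle_abs (a x)). lra.
Qed.

Lemma has_sum_ge_fsum a s l : has_sum a s -> (forall x, P x -> 0 <= a x) -> on_P l -> fsum a l <= s.
Proof.
  intros Ha Hpos Hl. apply Rnot_lt_le; intros Hlt.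
  destruct (Ha (fsum a l - s)) as [l0 [O0 H0]]; [lra|].
  destruct (on_P_union l0 l O0 Hl) as (l' & O & I1 & I2). specialize (H0 l' O I1).
  assert (fsum a l <= fsum a l').
  { apply fsum_incl; auto; [|apply Hl]. intros x Hx. apply Hpos, O, Hx. }
  apply Rabs_def2 in H0. lra.
Qed.

Lemma has_sum_ge_term a s x : has_sum a s -> (forall y, P y -> 0 <= a y) -> P x -> a x <= s.
Proof.
  intros Ha Hpos Hx. replace (a x) with (fsum a (x :: nil)) by (simpl; lra).
  apply has_sum_ge_fsum; auto. split; [repeat constructor; intros []|].
  intros y [<-|[]]; auto.
Qed.

Lemma has_sum_exists a M : (forall x, P x -> 0 <= a x) -> (forall l, on_P l -> fsum a l <= M) ->
  exists s, has_sum a s /\ s <= M.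
Proof.
  intros Hpos HM. destruct (completeness (fun r => exists l, on_P l /\ r = fsum a l)) as [s [S1 S2]].
  - exists M. intros r [l [O ->]]. auto.
  - exists 0, nil. split; [apply on_P_nil|reflexivity].
  - exists s. split.
    + intros eps Heps.
      assert (Hex : exists l0, on_P l0 /\ s - eps < fsum a l0).
      { apply NNPP; intros Hn. assert (s <= s - eps); [|lra]. apply S2. intros r [l [O ->]].
        apply Rnot_lt_le; intros Hlt. apply Hn. eauto. }
      destruct Hex as [l0 [O0 H0]]. exists l0. split; auto. intros l O I.
      assert (fsum a l0 <= fsum a l).
      { apply fsum_incl; auto; [|apply O0]. intros x Hx. apply Hpos, O, Hx. }
      assert (fsum a l <= s) by (apply S1; eauto). apply Rabs_def1; lra.
    + apply S2. intros r [l [O ->]]. auto.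
Qed.

Lemma has_sum_reindex a s (f g : X -> X) : (forall x, P x -> P (f x) /\ g (f x) = x) ->
  (forall x, P x -> P (g x) /\ f (g x) = x) -> has_sum a s -> has_sum (fun x => a (f x)) s.
Proof.
  intros Hf Hg Ha eps Heps. destruct (Ha eps Heps) as [l0 [O0 H0]].
  assert (Hmap : forall h k l, (forall x, P x -> P (h x) /\ k (h x) = x) -> on_P l -> on_P (map h l)).
  { intros h k l Hh [Nd Hin]. split.
    - apply NoDup_map_NoDup_ForallPairs; auto. intros x y Hx Hy E.
      rewrite <- (proj2 (Hh x (Hin x Hx))), <- (proj2 (Hh y (Hin y Hy))). now f_equal.
    - intros y Hy. apply in_map_iff in Hy as (x & <- & Hx). apply Hh. auto. }
  exists (map g l0). split; [now apply (Hmap g f)|]. intros l O I.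
  replace (fsum (fun x => a (f x)) l) with (fsum a (map f l)).
  - apply H0; [now apply (Hmap f g)|]. intros x Hx. apply in_map_iff. exists (g x). split.
    + apply Hg. now apply O0.
    + apply I. apply in_map_iff. eauto.
  - clear. induction l; simpl; [auto|now rewrite IHl].
Qed.

Lemma has_sum_tail a s eps : has_sum a s -> (forall x, P x -> 0 <= a x) -> 0 < eps ->
  exists l0, on_P l0 /\ s < fsum a l0 + eps.
Proof.
  intros Ha Hpos Heps. destruct (Ha eps Heps) as [l0 [O0 H0]]. exists l0. split; auto.
  specialize (H0 l0 O0 (incl_refl l0)). apply Rabs_def2 in H0. lra.
Qed.

End Sums.

(** * The Cauchy kernel and its distribution function *)

Definition rad (A t : R) : R := sqrt (A ^ 2 + t ^ 2).
Definition ker (A t : R) : R := / (A ^ 2 + t ^ 2).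
(** The integral of [ker A] from minus infinity to [t]; the total mass is [PI / A]. *)
Definition cdf (A t : R) : R := (atan (t / A) + PI / 2) / A.

Lemma rad_sq A t : rad A t ^ 2 = A ^ 2 + t ^ 2.
Proof. unfold rad. apply pow2_sqrt. nra. Qed.

Lemma rad_ge A t : 0 < A -> A <= rad A t.
Proof.
  intros HA. unfold rad; rewrite <- (sqrt_pow2 A) at 1 by lra; apply sqrt_le_1; nra.
Qed.

Lemma rad_pos A t : 0 < A -> 0 < rad A t.
Proof. intros HA. pose proof (rad_ge A t HA). lra. Qed.

Lemma rad_abs A t : Rabs t <= rad A t.
Proof. unfold rad. rewrite <- sqrt_Rsqr_abs. unfold Rsqr. apply sqrt_le_1; nra. Qed.

Lemma rad_lip A t u : 0 < A -> rad A u <= rad A t + Rabs (u - t).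
Proof.
  intros HA. pose proof (rad_pos A t HA). pose proof (rad_pos A u HA). pose proof (rad_abs A t).
  pose proof (rad_sq A t). pose proof (rad_sq A u). pose proof (Rabs_pos (u - t)).
  apply Rnot_lt_le; intros Hlt.
  assert ((rad A t + Rabs (u - t)) ^ 2 < rad A u ^ 2) by (rewrite <- !Rsqr_pow2; apply Rsqr_incrst_1; lra).
  assert (E : Rabs (u - t) ^ 2 = (u - t) ^ 2) by (apply pow2_abs).
  assert (t * (u - t) <= rad A t * Rabs (u - t)).
  { apply Rle_trans with (Rabs t * Rabs (u - t)).
    - rewrite <- Rabs_mult. apply Rle_abs.
    - apply Rmult_le_compat_r; auto. }
  nra.
Qed.

Lemma ker_rad A t : 0 < A -> ker A t = / rad A t ^ 2.
Proof. intros HA. unfold ker. now rewrite rad_sq. Qed.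

Lemma ker_pos A t : 0 < A -> 0 < ker A t.
Proof. intros HA. apply Rinv_0_lt_compat. nra. Qed.

Lemma cdf_deriv A t : 0 < A -> derivable_pt_lim (cdf A) t (ker A t).
Proof.
  intros HA. unfold cdf.
  replace (ker A t) with (/ A * ((/ (1 + (t / A) ^ 2)) * (/ A * 1) + 0)).
  2: { unfold ker. field. split; nra. }
  apply derivable_pt_lim_ext with (fun x => / A * (atan (/ A * x) + PI / 2)).
  { intros x. unfold Rdiv. rewrite (Rmult_comm x). lra. }
  apply derivable_pt_lim_scal with (f := fun x => atan (/ A * x) + PI / 2).
  apply derivable_pt_lim_plus with (f1 := fun x => atan (/ A * x)) (f2 := fun _ => PI / 2).
  - apply (derivable_pt_lim_comp (fun x => / A * x) atan).
    + apply derivable_pt_lim_scal with (f := fun x => x). apply derivable_pt_lim_id.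
    + unfold Rdiv. rewrite (Rmult_comm t). apply derivable_pt_lim_atan.
  - apply derivable_pt_lim_const.
Qed.

(** The two distribution functions are combined before the mean value theorem is applied, so both
    kernels are evaluated at the same point. This replaces integration of inequalities between
    kernels. *)
Lemma cdf_mvt c1 A c2 B t1 t2 : 0 < A -> 0 < B -> t1 < t2 -> exists xi, t1 < xi < t2 /\
  (c1 * cdf A t2 + c2 * cdf B t2) - (c1 * cdf A t1 + c2 * cdf B t1) =
  (t2 - t1) * (c1 * ker A xi + c2 * ker B xi).
Proof.
  intros HA HB Ht.
  destruct (MVT_cor2 (fun t => c1 * cdf A t + c2 * cdf B t) (fun t => c1 * ker A t + c2 * ker B t) t1 t2 Ht)
    as [xi [E Hxi]].
  - intros t _. apply derivable_pt_lim_plus with (f1 := fun t => c1 * cdf A t) (f2 := fun t => c2 * cdf B t).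
    + apply derivable_pt_lim_scal with (f := cdf A). now apply cdf_deriv.
    + apply derivable_pt_lim_scal with (f := cdf B). now apply cdf_deriv.
  - exists xi. split; [lra|]. rewrite E. lra.
Qed.

Lemma cdf_mvt1 A t1 t2 : 0 < A -> t1 < t2 -> exists xi, t1 < xi < t2 /\
  cdf A t2 - cdf A t1 = (t2 - t1) * ker A xi.
Proof.
  intros HA Ht. destruct (cdf_mvt 1 A 0 A t1 t2) as [xi [H1 H2]]; auto. exists xi. split; auto. lra.
Qed.

Lemma cdf_incr A : 0 < A -> incr (cdf A).
Proof.
  intros HA x y Hxy. destruct (cdf_mvt1 A x y HA Hxy) as [xi [_ E]]. pose proof (ker_pos A xi HA). nra.
Qed.

Lemma cdf_bounds A t : 0 < A -> 0 < cdf A t < PI / A.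
Proof.
  intros HA. pose proof (atan_bound (t / A)). unfold cdf. split.
  - apply Rdiv_lt_0_compat; lra.
  - apply Rmult_lt_compat_r; [now apply Rinv_0_lt_compat|lra].
Qed.

Lemma cdf_top A eps : 0 < A -> 0 < eps -> exists T, forall t, T <= t -> PI / A - eps < cdf A t.
Proof.
  intros HA He. pose proof PI_RGT_0.
  set (e := Rmin (eps * A / 2) 1). assert (0 < e).
  { apply Rmin_glb_lt; [|lra]. apply Rdiv_lt_0_compat; [now apply Rmult_lt_0_compat|lra]. }
  assert (e <= 1) by apply Rmin_r. assert (e <= eps * A / 2) by apply Rmin_l.
  pose proof PI2_1. 
  exists (A * tan (PI / 2 - e)). intros t Ht. unfold cdf.
  assert (PI / 2 - e <= atan (t / A)).
  { rewrite <- (atan_tan (PI / 2 - e)) by lra. 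
    assert (tan (PI / 2 - e) <= t / A).
    { apply Rmult_le_reg_r with A; auto. unfold Rdiv. rewrite Rmult_assoc, Rinv_l; lra. }
    destruct H4 as [Hl| ->]; [left; now apply atan_increasing|lra]. }
  apply Rmult_lt_reg_r with A; auto. unfold Rdiv. rewrite Rmult_minus_distr_r.
  rewrite !Rmult_assoc, Rinv_l, !Rmult_1_r by lra. nra.
Qed.

Lemma cdf_opp A t : 0 < A -> cdf A (- t) = PI / A - cdf A t.
Proof.
  intros HA. unfold cdf. replace (- t / A) with (- (t / A)) by (field; lra). rewrite atan_opp. field. lra.
Qed.

Lemma cdf_bottom A eps : 0 < A -> 0 < eps -> exists T, forall t, t <= T -> cdf A t < eps.
Proof.
  intros HA He. destruct (cdf_top A eps HA He) as [T HT]. exists (- T). intros t Ht.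
  assert (E : PI / A - eps < cdf A (- t)) by (apply HT; lra). rewrite cdf_opp in E; auto. lra.
Qed.

Lemma cdf_lip A t1 t2 : 1 <= A -> t1 <= t2 -> cdf A t2 - cdf A t1 <= t2 - t1.
Proof.
  intros HA [Ht| ->]; [|lra]. destruct (cdf_mvt1 A t1 t2) as [xi [_ E]]; [lra|auto|]. rewrite E.
  rewrite <- (Rmult_1_r (t2 - t1)) at 2. apply Rmult_le_compat_l; [lra|].
  unfold ker. rewrite <- Rinv_1. apply Rinv_le_contravar; nra.
Qed.

(** Within distance [r = rad A t] of [t] the radius is at most [2 * r], so the density is at least
    [1 / (4 * r ^ 2)]. *)
Lemma cdf_mass A t m : 0 < A -> 0 < m <= 1 ->
  m / (4 * rad A t) <= cdf A (t + m * rad A t) - cdf A t /\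
  m / (4 * rad A t) <= cdf A t - cdf A (t - m * rad A t).
Proof.
  intros HA Hm. pose proof (rad_pos A t HA) as Hr. set (r := rad A t) in *.
  assert (Hk : forall xi, Rabs (xi - t) <= r -> / (4 * r ^ 2) <= ker A xi).
  { intros xi Hxi. rewrite ker_rad by auto. pose proof (rad_lip A t xi HA). pose proof (rad_pos A xi HA).
    fold r in H. apply Rinv_le_contravar; [nra|]. nra. }
  assert (E : m / (4 * r) = m * r * / (4 * r ^ 2)) by (field; lra).
  assert (0 < m * r) by nra. assert (m * r <= r) by nra.
  split.
  - destruct (cdf_mvt1 A t (t + m * r)) as [xi [Hxi E2]]; auto; [lra|].
    rewrite E2, E. replace (t + m * r - t) with (m * r) by lra.
    apply Rmult_le_compat_l; [lra|]. apply Hk. apply Rabs_le. lra.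
  - destruct (cdf_mvt1 A (t - m * r) t) as [xi [Hxi E2]]; auto; [lra|].
    rewrite E2, E. replace (t - (t - m * r)) with (m * r) by lra.
    apply Rmult_le_compat_l; [lra|]. apply Hk. apply Rabs_le. lra.
Qed.

Lemma ker_variation A z xi : 0 < A -> Rabs (xi - z) <= rad A z / 8 ->
  Rabs (ker A xi - ker A z) <= 4 * (Rabs (xi - z) / rad A z) * ker A z.
Proof.
  intros HA Hd. pose proof (rad_pos A z HA) as Hr. pose proof (rad_pos A xi HA) as Hr'.
  pose proof (rad_lip A z xi HA) as H1. pose proof (rad_lip A xi z HA) as H2.
  rewrite (Rabs_minus_sym z xi) in H2. pose proof (Rabs_pos (xi - z)) as Hs.
  pose proof (rad_sq A z) as Q1. pose proof (rad_sq A xi) as Q2.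
  pose proof (rad_abs A z). pose proof (rad_abs A xi).
  set (s := Rabs (xi - z)) in *. set (r := rad A z) in *. set (r' := rad A xi) in *.
  rewrite !ker_rad by auto. fold r r'.
  replace (/ r' ^ 2 - / r ^ 2) with ((z ^ 2 - xi ^ 2) * (/ r' ^ 2 * / r ^ 2)).
  2: { replace (z ^ 2 - xi ^ 2) with (r ^ 2 - r' ^ 2) by lra. field. lra. }
  assert (Hi : 0 < / r' ^ 2 * / r ^ 2) by (apply Rmult_lt_0_compat; apply Rinv_0_lt_compat; nra).
  rewrite Rabs_mult, (Rabs_right (/ r' ^ 2 * / r ^ 2)) by lra.
  assert (Rabs (z ^ 2 - xi ^ 2) <= s * (r + r')).
  { replace (z ^ 2 - xi ^ 2) with ((xi - z) * (- (z + xi))) by ring.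
    rewrite Rabs_mult, Rabs_Ropp. apply Rmult_le_compat_l; [apply Rabs_pos|].
    apply Rle_trans with (1 := Rabs_triang z xi). lra. }
  apply Rle_trans with (s * (r + r') * (/ r' ^ 2 * / r ^ 2)).
  - apply Rmult_le_compat_r; lra.
  - replace (s * (r + r') * (/ r' ^ 2 * / r ^ 2)) with (s / r * (/ r ^ 2) * ((r + r') * r / r' ^ 2)) by (field; lra).
    replace (4 * (s / r) * / r ^ 2) with (s / r * / r ^ 2 * 4) by (field; lra).
    apply Rmult_le_compat_l.
    + apply Rmult_le_pos; [|left; apply Rinv_0_lt_compat; nra].
      apply Rmult_le_pos; [auto|left; now apply Rinv_0_lt_compat].
    (* Since the radius is 1-Lipschitz, [r' >= 7 * r / 8], which leaves the quotient below 4. *)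
    + apply Rmult_le_reg_r with (r' ^ 2); [nra|]. unfold Rdiv. rewrite Rmult_assoc, Rinv_l by nra. nra.
Qed.

(** Modelled on [A = v ^ (1 / al)] and [B = v' ^ (1 / al)] with [v' - v] bounded: the squares differ
    by a relative error [O(1 / v)], and [1 / v] is [A ^ (- al)]. *)
Record comparable (al c A B : R) : Prop := {
  cp_A : 1 <= A; cp_B : 1 <= B; cp_c : 1 <= c;
  cp_AB : A <= c * B;
  cp_sq : Rabs (A ^ 2 - B ^ 2) <= c * A ^ 2 * Rpower A (- al) }.

Lemma Rabs_le_inv x y : Rabs x <= y -> - y <= x <= y.
Proof. unfold Rabs. destruct (Rcase_abs x); lra. Qed.

Lemma Rpower_pos x y : 0 < Rpower x y.
Proof. apply exp_pos. Qed.

Lemma Rpower_sq x : 0 < x -> Rpower x 2 = x ^ 2.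
Proof. intros H. replace 2 with (INR 2) by (simpl; lra). now apply Rpower_pow. Qed.

Lemma Rpower_anti al x y : 0 < al -> 0 < x -> x <= y -> Rpower y (- al) <= Rpower x (- al).
Proof.
  intros Ha Hx Hxy. rewrite !Rpower_Ropp. apply Rinv_le_contravar; [apply Rpower_pos|].
  apply Rle_Rpower_l; lra.
Qed.

(** * Kernels of comparable scales *)

Section Compare.
Variables (al c A B : R).
Hypothesis Hal : 0 < al <= 1.
Hypothesis HAB : comparable al c A B.

Let HA := cp_A _ _ _ _ HAB.
Let HB := cp_B _ _ _ _ HAB.
Let Hc := cp_c _ _ _ _ HAB.

Lemma rad_compare t : rad A t <= c * rad B t.
Proof.
  assert (0 < rad B t) by (apply rad_pos; lra).
  apply Rsqr_incr_0_var; [|apply Rmult_le_pos; lra]. rewrite !Rsqr_pow2, Rpow_mult_distr, !rad_sq.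
  assert (A ^ 2 <= (c * B) ^ 2) by (apply pow_incr; pose proof (cp_AB _ _ _ _ HAB); lra).
  assert (1 * t ^ 2 <= c ^ 2 * t ^ 2) by (apply Rmult_le_compat_r; [apply pow2_ge_0|nra]).
  nra.
Qed.

(** For [al <= 1] the function [x ^ (2 - al)] is nondecreasing, so an error known at the scale [A]
    carries over to the larger [rad A t]. *)
Lemma ker_compare t : c * A ^ 2 * Rpower A (- al) * ker B t <= c ^ 3 * Rpower (rad A t) (- al).
Proof.
  assert (H1 : 0 < rad A t) by (apply rad_pos; lra). assert (H2 : 0 < rad B t) by (apply rad_pos; lra).
  pose proof (rad_ge A t) as H3. pose proof (rad_compare t) as H4.
  assert (E : forall x, 0 < x -> x ^ 2 * Rpower x (- al) = Rpower x (2 - al)).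
  { intros x Hx. rewrite <- Rpower_sq by auto. rewrite <- Rpower_plus. f_equal. }
  assert (H5 : A ^ 2 * Rpower A (- al) <= rad A t ^ 2 * Rpower (rad A t) (- al)).
  { rewrite !E by lra. apply Rle_Rpower_l; [lra|]. split; [lra|]. apply H3. lra. }
  assert (H6 : ker B t <= c ^ 2 * / rad A t ^ 2).
  { rewrite ker_rad by lra. assert (H6 : rad A t ^ 2 <= c ^ 2 * rad B t ^ 2).
    { rewrite <- Rpow_mult_distr. apply pow_incr. lra. }
    assert (0 < rad A t ^ 2) by now apply pow_lt. assert (0 < rad B t ^ 2) by now apply pow_lt.
    replace (/ rad B t ^ 2) with (rad A t ^ 2 * (/ rad A t ^ 2 * / rad B t ^ 2)) by (field; lra).
    replace (c ^ 2 * / rad A t ^ 2) with (c ^ 2 * rad B t ^ 2 * (/ rad A t ^ 2 * / rad B t ^ 2)) by (field; lra).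
    apply Rmult_le_compat_r; auto. left; apply Rmult_lt_0_compat; now apply Rinv_0_lt_compat. }
  assert (0 < ker B t) by (apply ker_pos; lra).
  apply Rle_trans with (c * (rad A t ^ 2 * Rpower (rad A t) (- al)) * (c ^ 2 * / rad A t ^ 2)).
  - pose proof (Rpower_pos A (- al)). apply Rmult_le_compat; try nra.
    apply Rmult_le_pos; [|nra]. apply Rmult_le_pos; nra.
  - right. field. lra.
Qed.

Lemma ker_diff t : ker B t - ker A t = (A ^ 2 - B ^ 2) * (ker A t * ker B t).
Proof. unfold ker. field. split; nra. Qed.

Lemma ker_close t : Rabs (ker B t - ker A t) <= c ^ 3 * Rpower (rad A t) (- al) * ker A t.
Proof.
  assert (0 < ker A t) by (apply ker_pos; lra). assert (0 < ker B t) by (apply ker_pos; lra).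
  rewrite ker_diff, Rabs_mult, (Rabs_right (_ * _)) by nra.
  pose proof (cp_sq _ _ _ _ HAB). pose proof (ker_compare t).
  apply Rle_trans with (c * A ^ 2 * Rpower A (- al) * ker B t * ker A t); [|apply Rmult_le_compat_r; lra].
  replace (c * A ^ 2 * Rpower A (- al) * ker B t * ker A t)
    with (c * A ^ 2 * Rpower A (- al) * (ker A t * ker B t)) by ring.
  apply Rmult_le_compat_r; nra.
Qed.

(** By [ker_diff] the difference of the kernels is a constant times their product. Moving the point
    gains the factor [s / r], in addition to [r ^ (- al)] from the change of scale. *)
Lemma ker_close_variation z xi : Rabs (xi - z) <= rad A z / (8 * c) ->
  Rabs ((ker B xi - ker A xi) - (ker B z - ker A z)) <=
  12 * c ^ 4 * (Rabs (xi - z) / rad A z) * Rpower (rad A z) (- al) * ker A z.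
Proof.
  intros Hd. assert (H1 : 0 < rad A z) by (apply rad_pos; lra). assert (H2 : 0 < rad B z) by (apply rad_pos; lra).
  pose proof (rad_compare z) as H3. pose proof (Rabs_pos (xi - z)) as Hs.
  set (s := Rabs (xi - z)) in *.
  assert (Hs8 : s * (8 * c) <= rad A z).
  { apply (Rmult_le_compat_r (8 * c)) in Hd; [|lra]. unfold Rdiv in Hd. rewrite Rmult_assoc, Rinv_l in Hd; lra. }
  assert (HvA : Rabs (ker A xi - ker A z) <= 4 * (s / rad A z) * ker A z).
  { apply ker_variation; [lra|]. fold s. nra. }
  assert (HvB : Rabs (ker B xi - ker B z) <= 4 * (s / rad B z) * ker B z).
  { apply ker_variation; [lra|]. fold s. nra. }
  assert (kA : 0 < ker A z) by (apply ker_pos; lra). assert (kB : 0 < ker B z) by (apply ker_pos; lra).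
  assert (Hq : 0 <= s / rad A z) by (apply Rmult_le_pos; [auto|left; now apply Rinv_0_lt_compat]).
  assert (HqB : s / rad B z <= c * (s / rad A z)).
  { apply Rmult_le_reg_r with (rad A z * rad B z); [nra|]. unfold Rdiv. field_simplify; [|lra|lra]. nra. }
  assert (HqB2 : s / rad B z <= / 8).
  { apply Rmult_le_reg_r with (rad B z); [lra|]. unfold Rdiv. rewrite Rmult_assoc, Rinv_l by lra. nra. }
  assert (kBxi : 0 <= ker B xi <= 2 * ker B z).
  { split; [left; apply ker_pos; lra|]. apply Rabs_le_inv in HvB. nra. }
  rewrite !ker_diff.
  replace ((A ^ 2 - B ^ 2) * (ker A xi * ker B xi) - (A ^ 2 - B ^ 2) * (ker A z * ker B z))
    with ((A ^ 2 - B ^ 2) * ((ker A xi - ker A z) * ker B xi + ker A z * (ker B xi - ker B z))) by ring.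
  rewrite Rabs_mult.
  assert (Hin : Rabs ((ker A xi - ker A z) * ker B xi + ker A z * (ker B xi - ker B z)) <=
    12 * c * (s / rad A z) * ker A z * ker B z).
  { apply Rle_trans with (1 := Rabs_triang _ _). rewrite !Rabs_mult, (Rabs_right (ker B xi)), (Rabs_right (ker A z)) by lra.
    assert (Rabs (ker A xi - ker A z) * ker B xi <= 4 * (s / rad A z) * ker A z * (2 * ker B z)).
    { apply Rmult_le_compat; try lra. apply Rabs_pos. }
    assert (ker A z * Rabs (ker B xi - ker B z) <= ker A z * (4 * (c * (s / rad A z)) * ker B z)).
    { apply Rmult_le_compat_l; [lra|]. apply Rle_trans with (1 := HvB). apply Rmult_le_compat_r; lra. }
    assert (0 <= (s / rad A z) * (ker A z * ker B z)) by (apply Rmult_le_pos; nra). nra. }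
  pose proof (cp_sq _ _ _ _ HAB) as Hsq. pose proof (ker_compare z) as Hkc.
  pose proof (Rpower_pos A (- al)). pose proof (Rpower_pos (rad A z) (- al)).
  apply Rle_trans with (c * A ^ 2 * Rpower A (- al) * (12 * c * (s / rad A z) * ker A z * ker B z)).
  - apply Rmult_le_compat; auto; apply Rabs_pos.
  - replace (c * A ^ 2 * Rpower A (- al) * (12 * c * (s / rad A z) * ker A z * ker B z))
      with ((c * A ^ 2 * Rpower A (- al) * ker B z) * (12 * c * (s / rad A z) * ker A z)) by ring.
    replace (12 * c ^ 4 * (s / rad A z) * Rpower (rad A z) (- al) * ker A z)
      with ((c ^ 3 * Rpower (rad A z) (- al)) * (12 * c * (s / rad A z) * ker A z)) by ring.
    apply Rmult_le_compat_r; auto. apply Rmult_le_pos; [|lra]. apply Rmult_le_pos; [lra|auto].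
Qed.

Lemma cdf_close eta t1 t2 : t1 <= t2 ->
  (forall xi, t1 <= xi <= t2 -> Rpower (rad A xi) (- al) <= eta) ->
  Rabs ((cdf B t2 - cdf B t1) - (cdf A t2 - cdf A t1)) <= c ^ 3 * eta * (cdf A t2 - cdf A t1).
Proof.
  intros [Ht| ->] Heta; [|rewrite !Rminus_diag, Rabs_R0; lra].
  assert (Hk : forall xi, t1 < xi < t2 -> Rabs (ker B xi - ker A xi) <= c ^ 3 * eta * ker A xi).
  { intros xi Hxi. apply Rle_trans with (1 := ker_close xi). 
    assert (0 < ker A xi) by (apply ker_pos; lra). apply Rmult_le_compat_r; [lra|].
    apply Rmult_le_compat_l; [apply pow_le; lra|]. apply Heta. lra. }
  apply Rabs_le. split.
  - destruct (cdf_mvt (1 - c ^ 3 * eta) A (-1) B t1 t2) as [xi [Hxi E]]; try lra.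
    pose proof (Rabs_le_inv _ _ (Hk xi Hxi)). nra.
  - destruct (cdf_mvt (- (1 + c ^ 3 * eta)) A 1 B t1 t2) as [xi [Hxi E]]; try lra.
    pose proof (Rabs_le_inv _ _ (Hk xi Hxi)). nra.
Qed.

End Compare.

(** * Densities carried by a chart *)

Section Chart.
Variables (a b : R) (p : R -> R).
Hypothesis Hab : a < b.
Hypothesis Hp : forall u v, a < u -> u < v -> v < b -> p u < p v.
Hypothesis Hs : forall y, exists u, a < u < b /\ p u = y.

(* The distribution function of the density [ker A] carried by the chart [p] to [(a, b)]. *)
Definition Th (A u : R) : R :=
  if Rle_dec u a then 0 else if Rle_dec b u then PI / A else cdf A (p u).

Lemma Th_in A u : a < u < b -> Th A u = cdf A (p u).
Proof. intros H. unfold Th. destruct (Rle_dec u a); [lra|]. destruct (Rle_dec b u); lra. Qed.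

Lemma Th_left A u : u <= a -> Th A u = 0.
Proof. intros H. unfold Th. destruct (Rle_dec u a); lra. Qed.

Lemma Th_right A u : b <= u -> Th A u = PI / A.
Proof. intros H. unfold Th. destruct (Rle_dec u a); [lra|]. destruct (Rle_dec b u); lra. Qed.

Lemma Th_cases u : u <= a \/ a < u < b \/ b <= u.
Proof. destruct (Rle_lt_dec u a); auto. destruct (Rle_lt_dec b u); auto. Qed.

Lemma p_le u v : a < u -> u <= v -> v < b -> p u <= p v.
Proof. intros H1 [H2| ->] H3; [left; auto|lra]. Qed.

Lemma p_lt_inv u v : a < u < b -> a < v < b -> p u < p v -> u < v.
Proof.
  intros Hu Hv H. apply Rnot_le_lt; intros Hle. assert (p v <= p u) by (apply p_le; lra). lra.
Qed.

Lemma Th_bounds A u : 0 < A -> 0 <= Th A u <= PI / A.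
Proof.
  intros HA. assert (0 < PI / A) by (apply Rdiv_lt_0_compat; [apply PI_RGT_0|auto]).
  destruct (Th_cases u) as [H'|[H'|H']]; [rewrite Th_left by auto|rewrite Th_in by auto|rewrite Th_right by auto]; try lra.
  pose proof (cdf_bounds A (p u) HA). lra.
Qed.

Lemma Th_mono A u v : 0 < A -> u <= v -> Th A u <= Th A v.
Proof.
  intros HA Huv. pose proof (Th_bounds A u HA). pose proof (Th_bounds A v HA).
  destruct (Th_cases u) as [H1|[H1|H1]]; [rewrite Th_left by auto; lra| |rewrite (Th_right A v) by lra; lra].
  destruct (Th_cases v) as [H2|[H2|H2]]; [lra| |rewrite (Th_right A v) by lra; lra].
  rewrite !Th_in by auto. apply incr_le; [now apply cdf_incr|]. apply p_le; lra.
Qed.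

Lemma Th_strict A u z v : 0 < A -> u < z -> z <= v -> a < z < b -> Th A u < Th A v.
Proof.
  intros HA H1 H2 Hz. apply Rlt_le_trans with (Th A z); [|now apply Th_mono].
  rewrite (Th_in A z) by auto. pose proof (cdf_bounds A (p z) HA).
  destruct (Rle_lt_dec u a); [rewrite Th_left; lra|]. rewrite Th_in by lra.
  apply cdf_incr; auto. apply Hp; lra.
Qed.

(** The mass near an end of the chart is arbitrarily small, so a point left of the interval can be
    replaced by one inside it, for both scales at once. This reduces estimates on [Th] to estimates
    on [cdf]. *)
Lemma Th_enter A B u v eps : 0 < A -> 0 < B -> 0 < eps -> u <= v -> a < v < b ->
  exists u', u <= u' <= v /\ a < u' < b /\ Th A u' <= Th A u + eps /\ Th B u' <= Th B u + eps.
Proof.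
  intros HA HB He Huv Hv. destruct (Rle_lt_dec u a) as [Hua|Hua].
  - destruct (cdf_bottom A eps HA He) as [T1 HT1]. destruct (cdf_bottom B eps HB He) as [T2 HT2].
    destruct (Hs (Rmin (p v - 1) (Rmin T1 T2))) as [u' [Hu' E]].
    pose proof (Rmin_l (p v - 1) (Rmin T1 T2)). pose proof (Rmin_r (p v - 1) (Rmin T1 T2)).
    pose proof (Rmin_l T1 T2). pose proof (Rmin_r T1 T2).
    assert (u' < v) by (apply p_lt_inv; auto; lra).
    exists u'. rewrite !(Th_in _ u'), !(Th_left _ u) by auto. rewrite E.
    assert (cdf A (Rmin (p v - 1) (Rmin T1 T2)) < eps) by (apply HT1; lra).
    assert (cdf B (Rmin (p v - 1) (Rmin T1 T2)) < eps) by (apply HT2; lra). lra.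
  - exists u. repeat split; lra.
Qed.

Lemma Th_exit A B u v eps : 0 < A -> 0 < B -> 0 < eps -> u <= v -> a < u < b ->
  exists v', u <= v' <= v /\ a < v' < b /\ Th A v - eps <= Th A v' /\ Th B v - eps <= Th B v'.
Proof.
  intros HA HB He Huv Hu. destruct (Rle_lt_dec b v) as [Hbv|Hbv].
  - destruct (cdf_top A eps HA He) as [T1 HT1]. destruct (cdf_top B eps HB He) as [T2 HT2].
    destruct (Hs (Rmax (p u + 1) (Rmax T1 T2))) as [v' [Hv' E]].
    pose proof (Rmax_l (p u + 1) (Rmax T1 T2)). pose proof (Rmax_r (p u + 1) (Rmax T1 T2)).
    pose proof (Rmax_l T1 T2). pose proof (Rmax_r T1 T2).
    assert (u < v') by (apply p_lt_inv; auto; lra).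
    exists v'. rewrite !(Th_in _ v'), !(Th_right _ v) by auto. rewrite E.
    assert (PI / A - eps < cdf A (Rmax (p u + 1) (Rmax T1 T2))) by (apply HT1; lra).
    assert (PI / B - eps < cdf B (Rmax (p u + 1) (Rmax T1 T2))) by (apply HT2; lra). lra.
  - exists v. repeat split; lra.
Qed.

Lemma Th_close al c A B eta u1 u2 : 0 < al <= 1 -> comparable al c A B -> 0 <= eta -> u1 <= u2 ->
  (forall v, a < v < b -> u1 <= v <= u2 -> Rpower (rad A (p v)) (- al) <= eta) ->
  Rabs ((Th B u2 - Th B u1) - (Th A u2 - Th A u1)) <= c ^ 3 * eta * (Th A u2 - Th A u1).
Proof.
  intros Hal HAB He Hu Heta.
  pose proof (cp_A _ _ _ _ HAB) as HA. pose proof (cp_B _ _ _ _ HAB) as HB. pose proof (cp_c _ _ _ _ HAB) as Hc.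
  assert (Hce : 0 <= c ^ 3 * eta) by (apply Rmult_le_pos; [apply pow_le; lra|auto]).
  destruct (Rle_lt_dec u2 a) as [H1|H1].
  { rewrite !Th_left by lra. rewrite !Rminus_diag, Rabs_R0. lra. }
  destruct (Rle_lt_dec b u1) as [H2|H2].
  { rewrite !Th_right by lra. rewrite !Rminus_diag, Rabs_R0. lra. }
  destruct Hu as [Hu| ->]; [|rewrite !Rminus_diag, Rabs_R0; lra].
  assert (Hv : exists v, u1 <= v <= u2 /\ a < v < b).
  { exists ((Rmax a u1 + Rmin b u2) / 2). 
    pose proof (Rmax_l a u1). pose proof (Rmax_r a u1). pose proof (Rmin_l b u2). pose proof (Rmin_r b u2).
    assert (Rmax a u1 < Rmin b u2) by (apply Rmax_lub_lt; apply Rmin_glb_lt; lra). lra. }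
  destruct Hv as (v & Hv1 & Hv2).
  (* Both ends are moved into [(a, b)]; each of the two scales loses at most [e / 4] at each end, in
     total [e]. *)
  apply le_epsilon. intros e Hpos.
  destruct (Th_enter A B u1 v (e / 4)) as (w1 & W1 & W2 & W3 & W4); try lra.
  destruct (Th_exit A B v u2 (e / 4)) as (w2 & W5 & W6 & W7 & W8); try lra.
  assert (Hmain : Rabs ((Th B w2 - Th B w1) - (Th A w2 - Th A w1)) <= c ^ 3 * eta * (Th A w2 - Th A w1)).
  { rewrite !Th_in by auto. apply (cdf_close al); auto; [apply p_le; lra|].
    intros xi Hxi. destruct (Hs xi) as [x [Hx Ex]]. rewrite <- Ex. apply Heta; auto.
    assert (~ x < w1) by (intros Hl; pose proof (Hp x w1); lra).
    assert (~ w2 < x) by (intros Hl; pose proof (Hp w2 x); lra). lra. }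
  assert (A0 : 0 < A) by lra. assert (B0 : 0 < B) by lra.
  pose proof (Th_mono A u1 w1 A0 (proj1 W1)). pose proof (Th_mono B u1 w1 B0 (proj1 W1)).
  pose proof (Th_mono A w2 u2 A0 (proj2 W5)). pose proof (Th_mono B w2 u2 B0 (proj2 W5)).
  assert (c ^ 3 * eta * (Th A w2 - Th A w1) <= c ^ 3 * eta * (Th A u2 - Th A u1)) by (apply Rmult_le_compat_l; lra).
  apply Rabs_le_inv in Hmain. apply Rabs_le. lra.
Qed.

Lemma Th_mass_right A v u m : 0 < A -> 0 < m <= 1 -> a < v < b -> v <= u ->
  (u < b -> p v + m * rad A (p v) <= p u) -> m / (4 * rad A (p v)) <= Th A u - Th A v.
Proof.
  intros HA Hm Hv Hvu Hu. destruct (cdf_mass A (p v) m HA Hm) as [H1 _]. rewrite (Th_in A v) by auto.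
  apply Rle_trans with (1 := H1). apply Rplus_le_compat_r. destruct (Rle_lt_dec b u) as [Hbu|Hbu].
  - rewrite Th_right by auto. left. now apply cdf_bounds.
  - rewrite Th_in by lra. apply incr_le; [now apply cdf_incr|auto].
Qed.

Lemma Th_mass_left A v u m : 0 < A -> 0 < m <= 1 -> a < v < b -> u <= v ->
  (a < u -> p u <= p v - m * rad A (p v)) -> m / (4 * rad A (p v)) <= Th A v - Th A u.
Proof.
  intros HA Hm Hv Hvu Hu. destruct (cdf_mass A (p v) m HA Hm) as [_ H1]. rewrite (Th_in A v) by auto.
  apply Rle_trans with (1 := H1). apply Rplus_le_compat_l, Ropp_le_contravar.
  destruct (Rle_lt_dec u a) as [Hua|Hua].
  - rewrite Th_left by auto. left. now apply cdf_bounds.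
  - rewrite Th_in by lra. apply incr_le; [now apply cdf_incr|auto].
Qed.

Lemma Th_near_right A u eps : 1 <= A -> 0 < eps -> exists v, u < v /\ Th A v < Th A u + eps.
Proof.
  intros HA He. destruct (Rlt_le_dec u a) as [H1|H1]; [exists a; rewrite !Th_left; lra|].
  destruct (Rlt_le_dec u b) as [H2|H2]; [|exists (u + 1); rewrite !Th_right; lra].
  destruct H1 as [H1|H1].
  - destruct (Hs (p u + eps / 2)) as [v [Hv E]]. exists v. rewrite !Th_in by lra. split.
    + apply p_lt_inv; auto. lra.
    + pose proof (cdf_lip A (p u) (p v) HA). lra.
  - destruct (Hs 0) as [z [Hz _]].
    destruct (Th_enter A A u z (eps / 2)) as (v & Hv); try lra. exists v. lra.
Qed.

Lemma Th_near_left A u eps : 1 <= A -> 0 < eps -> exists v, v < u /\ Th A u - eps < Th A v.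
Proof.
  intros HA He. destruct (Rlt_le_dec b u) as [H1|H1]; [exists b; rewrite !Th_right; lra|].
  destruct (Rlt_le_dec a u) as [H2|H2]; [|exists (u - 1); rewrite !Th_left; lra].
  destruct H1 as [H1|H1].
  - destruct (Hs (p u - eps / 2)) as [v [Hv E]]. exists v. rewrite !Th_in by lra. split.
    + apply p_lt_inv; auto. lra.
    + pose proof (cdf_lip A (p v) (p u) HA). lra.
  - destruct (Hs 0) as [z [Hz _]].
    destruct (Th_exit A A z u (eps / 2)) as (v & Hv); try lra. exists v. lra.
Qed.

End Chart.

(** * Weights *)

Lemma Rpower_pow_base x y n : 0 < x -> Rpower (x ^ n) y = Rpower x y ^ n.
Proof.
  intros Hx. induction n as [|n IH]; simpl.
  - unfold Rpower. now rewrite ln_1, Rmult_0_r, exp_0.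
  - rewrite <- IH, Rpower_mult_distr; auto. now apply pow_lt.
Qed.

Lemma Rpower_inv x y : 0 < x -> Rpower (/ x) y = / Rpower x y.
Proof. intros Hx. unfold Rpower. rewrite ln_Rinv, <- exp_Ropp by auto. f_equal. ring. Qed.

Section Weights.
Variables (Gam : (R -> R) -> Prop) (L : (R -> R) -> nat) (Cst d : nat) (al : R).
Hypothesis HL : lgroup Gam L Cst d.
Hypothesis Hal : 0 < al.
Hypothesis Hald : al * INR d < 1.

Definition weight (N : nat) (H : R -> R) : R := Rpower (INR (L H + N)) (/ al).

(** The ratio between consecutive dyadic shells: their cardinality bound grows by [2 ^ d], the
    weights by [2 ^ (1 / al)]. It is below 1 exactly because [al * d < 1]. *)
Let q := 2 ^ d * / Rpower 2 (/ al).

Lemma q_range : 0 < q < 1.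
Proof.
  unfold q. split.
  - apply Rmult_lt_0_compat; [apply pow_lt; lra|]. apply Rinv_0_lt_compat, Rpower_pos.
  - apply Rmult_lt_reg_r with (Rpower 2 (/ al)); [apply Rpower_pos|].
    rewrite Rmult_assoc, Rinv_l by (pose proof (Rpower_pos 2 (/ al)); lra).
    rewrite Rmult_1_r, Rmult_1_l, <- Rpower_pow by lra.
    apply Rpower_lt; [lra|]. apply Rmult_lt_reg_l with al; auto. rewrite Rinv_r; lra.
Qed.

Definition in_window (k : nat) (z x : R) (l : list (R -> R)) : Prop :=
  NoDup l /\ forall H, In H l -> Gam H /\ z <= H x < z + INR k.

(** Each step of the induction adds the shell [2 ^ J <= L H + 2 ^ j0 < 2 ^ S J]. The difference
    [q ^ j0 - q ^ J] in the bound telescopes. *)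
Lemma weight_dyadic j0 J k z x l : (j0 <= J)%nat -> in_window k z x l ->
  (forall H, In H l -> (L H + 2 ^ j0 < 2 ^ J)%nat) ->
  fsum (fun H => / weight (2 ^ j0) H) l <= INR k * (INR Cst * 2 ^ d / (1 - q)) * (q ^ j0 - q ^ J).
Proof.
  intros HJ. revert l. pose proof q_range as Hq. induction HJ as [|J HJ IH]; intros l [Hnd Hl] Hlt.
  - destruct l as [|H l]; [simpl; lra|]. exfalso. pose proof (Hlt H (or_introl eq_refl)). lia.
  - set (t := fun H : R -> R => btest (L H + 2 ^ j0 < 2 ^ J)%nat).
    rewrite (fsum_filter _ t).
    assert (H1 : fsum (fun H => / weight (2 ^ j0) H) (filter t l) <=
      INR k * (INR Cst * 2 ^ d / (1 - q)) * (q ^ j0 - q ^ J)).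
    { apply IH.
      - split; [now apply NoDup_filter|]. intros H HH. apply filter_In in HH as [HH _]. auto.
      - intros H HH. apply filter_In in HH as [_ HH]. unfold t in HH. now rewrite btest_true in HH. }
    set (l' := filter (fun H => negb (t H)) l).
    assert (Hl' : forall H, In H l' -> In H l /\ (2 ^ J <= L H + 2 ^ j0)%nat).
    { intros H HH. apply filter_In in HH as [HH HH']. split; auto.
      unfold t in HH'. rewrite Bool.negb_true_iff, btest_false in HH'. lia. }
    assert (Hcount : (length l' <= k * (Cst * (2 ^ S J) ^ d))%nat).
    { apply (growth_k Gam L Cst d HL _ _ z x).
      - pose proof (Nat.pow_nonzero 2 (S J)). lia.
      - now apply NoDup_filter.
      - intros H HH. apply Hl' in HH as [HH HH']. destruct (Hl H HH) as [G1 G2].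
        split; auto. split; auto. pose proof (Hlt H HH). lia. }
    assert (H2 : fsum (fun H => / weight (2 ^ j0) H) l' <= INR (length l') * / Rpower 2 (/ al) ^ J).
    { rewrite <- fsum_const. apply fsum_le. intros H HH. apply Hl' in HH as [_ HH].
      rewrite <- Rpower_pow_base by lra. unfold weight.
      apply Rinv_le_contravar; [apply Rpower_pos|]. apply Rle_Rpower_l.
      - left. now apply Rinv_0_lt_compat.
      - split; [apply pow_lt; lra|]. apply le_INR in HH. rewrite pow_INR in HH. exact HH. }
    assert (Hpos : 0 < / Rpower 2 (/ al) ^ J) by (apply Rinv_0_lt_compat, pow_lt, Rpower_pos).
    assert (H3 : INR (length l') * / Rpower 2 (/ al) ^ J <= INR k * INR Cst * 2 ^ d * q ^ J).
    { apply Rle_trans with (INR (k * (Cst * (2 ^ S J) ^ d)) * / Rpower 2 (/ al) ^ J).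
      - apply Rmult_le_compat_r; [lra|]. now apply le_INR.
      - rewrite !mult_INR, !pow_INR. replace (INR 2) with 2 by (simpl; lra). unfold q.
        rewrite Rpow_mult_distr, pow_inv. right.
        replace ((2 ^ S J) ^ d) with (2 ^ d * (2 ^ d) ^ J); [ring|].
        rewrite <- !pow_mult, <- pow_add. f_equal. lia. }
    assert (H4 : INR k * INR Cst * 2 ^ d * q ^ J =
      INR k * (INR Cst * 2 ^ d / (1 - q)) * (q ^ J - q ^ S J)) by (simpl; field; lra).
    lra.
Qed.

(** The bound is uniform in the position of the window and linear in its length, so that the [i]-th
    orbit can later be assigned the share [(/ 2) ^ i]. *)
Lemma weights_small eps : 0 < eps -> exists N, (1 <= N)%nat /\ forall k z x l, in_window k z x l ->
  fsum (fun H => / weight N H) l <= INR k * eps.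
Proof.
  intros Heps. pose proof q_range as Hq. set (K := INR Cst * 2 ^ d / (1 - q)).
  assert (HK : 0 <= K).
  { unfold K. apply Rmult_le_pos; [|left; apply Rinv_0_lt_compat; lra].
    apply Rmult_le_pos; [apply pos_INR|apply pow_le; lra]. }
  destruct (pow_lt_1_zero q) with (y := eps / (K + 1)) as [j0 Hj0].
  { rewrite Rabs_right; lra. }
  { apply Rdiv_lt_0_compat; lra. }
  specialize (Hj0 j0 (le_n j0)). rewrite Rabs_right in Hj0 by (apply Rle_ge, pow_le; lra).
  exists (2 ^ j0)%nat. split; [pose proof (Nat.pow_nonzero 2 j0); lia|].
  intros k z x l Hl.
  assert (HJ : exists J, (j0 <= J)%nat /\ forall H, In H l -> (L H + 2 ^ j0 < 2 ^ J)%nat).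
  { clear Hl. induction l as [|H l [J [HJ1 HJ2]]].
    - exists j0. split; auto. intros H [].
    - exists (J + (L H + 2 ^ j0))%nat. split; [lia|]. intros H' [<-|HH].
      + pose proof (Nat.pow_gt_lin_r 2 (J + (L H + 2 ^ j0))). lia.
      + apply Nat.lt_le_trans with (2 ^ J)%nat; auto. apply Nat.pow_le_mono_r; lia. }
  destruct HJ as [J [HJ1 HJ2]]. apply Rle_trans with (1 := weight_dyadic j0 J k z x l HJ1 Hl HJ2).
  fold K. rewrite Rmult_assoc. apply Rmult_le_compat_l; [apply pos_INR|].
  assert (0 < q ^ J) by (apply pow_lt; lra).
  apply Rle_trans with (K * q ^ j0); [apply Rmult_le_compat_l; lra|].
  apply (Rmult_lt_compat_l (K + 1)) in Hj0; [|lra].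
  replace ((K + 1) * (eps / (K + 1))) with eps in Hj0 by (field; lra).
  assert (0 < q ^ j0) by (apply pow_lt; lra). nra.
Qed.

Lemma weight_ge_1 N H : (1 <= N)%nat -> 1 <= weight N H.
Proof.
  intros HN. unfold weight. replace 1 with (Rpower 1 (/ al)) at 1.
  - apply Rle_Rpower_l; [left; now apply Rinv_0_lt_compat|]. split; [lra|].
    replace 1 with (INR 1) by reflexivity. apply le_INR. lia.
  - unfold Rpower. now rewrite ln_1, Rmult_0_r, exp_0.
Qed.

Lemma weight_comparable lam : al <= 1 -> 0 <= lam -> exists c, forall v v', 1 <= v -> 1 <= v' ->
  Rabs (v' - v) <= lam -> comparable al c (Rpower v (/ al)) (Rpower v' (/ al)).
Proof.
  intros Hal1 Hlam. set (c1 := Rpower (1 + lam) (/ al)). set (m := / al * 2).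
  assert (Hia : 0 < / al) by now apply Rinv_0_lt_compat.
  assert (Hia1 : 1 <= / al) by (rewrite <- Rinv_1; apply Rinv_le_contravar; lra).
  (* Here [m = 2 / al] is the exponent of the squares, and [c2] comes from the mean value theorem
     for [v ^ m] on a range bounded by [(1 + lam) * v]. *)
  set (c2 := lam * m * Rpower (1 + lam) (m - 1)).
  assert (Hc2 : 0 <= c2) by (unfold c2, m; pose proof (Rpower_pos (1 + lam) (/ al * 2 - 1)); 
    apply Rmult_le_pos; [apply Rmult_le_pos|]; lra).
  assert (Hc1 : 0 < c1) by apply Rpower_pos.
  assert (Hone : forall y, 0 < y -> forall w, 1 <= w -> 1 <= Rpower w y).
  { intros y Hy w Hw. replace 1 with (Rpower 1 y) at 1.
    - apply Rle_Rpower_l; lra.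
    - unfold Rpower. now rewrite ln_1, Rmult_0_r, exp_0. }
  assert (Hratio : forall v v', 1 <= v -> 1 <= v' -> Rabs (v' - v) <= lam ->
    Rpower v' (/ al) <= c1 * Rpower v (/ al)).
  { intros v v' Hv Hv' Hd. unfold c1. rewrite Rpower_mult_distr by lra.
    apply Rle_Rpower_l; [lra|]. split; [lra|]. apply Rabs_le_inv in Hd. nra. }
  exists (1 + c1 + c2). intros v v' Hv Hv' Hd.
  pose proof (Rpower_pos v (/ al)) as P1. pose proof (Rpower_pos v' (/ al)) as P2.
  split; try (apply Hone; lra); [lra| |].
  - rewrite Rabs_minus_sym in Hd. pose proof (Hratio v' v Hv' Hv Hd). nra.
  - assert (Esq : forall w, 1 <= w -> Rpower w (/ al) ^ 2 = Rpower w m).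
    { intros w Hw. rewrite <- Rpower_sq by apply Rpower_pos. now rewrite Rpower_mult. }
    rewrite !Esq, Rpower_mult by auto.
    replace (/ al * - al) with (-1) by (field; lra).
    assert (Hmv : forall w w', 1 <= w -> w < w' -> w' <= (1 + lam) * v -> w' - w <= lam -> 
      Rabs (Rpower w' m - Rpower w m) <= c2 * (Rpower v m * Rpower v (-1))).
    { intros w w' Hw Hww Hw' Hl.
      destruct (MVT_cor2 (fun t => Rpower t m) (fun t => m * Rpower t (m - 1)) w w' Hww) as [xi [E Hxi]].
      { intros t Ht. apply derivable_pt_lim_power. lra. }
      rewrite E. assert (0 < m) by (unfold m; lra). pose proof (Rpower_pos xi (m - 1)).
      rewrite Rabs_right by (apply Rle_ge, Rmult_le_pos; [apply Rmult_le_pos|]; lra).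
      replace (c2 * (Rpower v m * Rpower v (-1))) with (m * Rpower ((1 + lam) * v) (m - 1) * lam).
      2: { rewrite <- Rpower_plus, <- Rpower_mult_distr by lra. replace (m + -1) with (m - 1) by lra.
           unfold c2. ring. }
      apply Rmult_le_compat; try lra.
      - apply Rmult_le_pos; lra.
      - apply Rmult_le_compat_l; [lra|]. apply Rle_Rpower_l; [unfold m; lra|lra]. }
    assert (Hfin : Rabs (Rpower v m - Rpower v' m) <= c2 * (Rpower v m * Rpower v (-1))).
    { apply Rabs_le_inv in Hd. destruct (Rtotal_order v v') as [Hlt|[E|Hgt]].
      - rewrite Rabs_minus_sym. apply Hmv; try lra. nra.
      - rewrite E, Rminus_diag, Rabs_R0. apply Rmult_le_pos; [auto|].
        pose proof (Rpower_pos v' m). pose proof (Rpower_pos v' (-1)). nra.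
      - apply Hmv; try lra. nra. }
    apply Rle_trans with (1 := Hfin). rewrite !Rmult_assoc. apply Rmult_le_compat_r; [|lra].
    pose proof (Rpower_pos v m). pose proof (Rpower_pos v (-1)). nra.
Qed.

End Weights.

(** * The measure and the Hoelder estimate *)

(** An infimum over infinitely many indices need not be attained; a loss by the factor 2 is harmless
    in [close_estimate]. *)
Lemma almost_min {T : Type} (Q : T -> Prop) (r : T -> R) : (exists g, Q g) -> (forall g, Q g -> 1 <= r g) ->
  exists g0, Q g0 /\ forall g, Q g -> r g0 <= 2 * r g.
Proof.
  intros [g1 H1] Hr. destruct (completeness (fun y => exists g, Q g /\ y = - r g)) as [s [S1 S2]].
  - exists (-1). intros y [g [Hg ->]]. pose proof (Hr g Hg). lra.
  - exists (- r g1); eauto.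
  - apply NNPP; intros Hn.
    assert (s <= 2 * s).
    { apply S2. intros y [g [Hg ->]]. apply Rnot_lt_le; intros Hlt. apply Hn. exists g. split; auto.
      intros h Hh. assert (- r h <= s) by (apply S1; eauto). lra. }
    assert (- r g1 <= s) by (apply S1; eauto). 
    assert (s <= -1); [|lra]. apply S2. intros y [g [Hg ->]]. pose proof (Hr g Hg). lra.
Qed.

Lemma Rpower_ge_self x al : 0 < x <= 1 -> 0 < al <= 1 -> x <= Rpower x al.
Proof.
  intros Hx Ha. rewrite <- (Rpower_1 x) at 1 by lra. unfold Rpower.
  assert (ln x <= 0). { destruct (Req_dec x 1) as [->|]; [rewrite ln_1; lra|]. rewrite <- ln_1. left. apply ln_increasing; lra. }
  assert (1 * ln x <= al * ln x) by nra. destruct H0 as [H0| ->]; [left; now apply exp_increasing|lra].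
Qed.

Section Measure.
Variables (Gam : (R -> R) -> Prop) (L : (R -> R) -> nat) (Cst d : nat) (al : R).
Hypothesis HL : lgroup Gam L Cst d.
Hypothesis Hal : 0 < al <= 1.
Variables (V : nat -> Prop) (a b : nat -> R) (p : nat -> R -> R).
Hypothesis Hgood : forall i, V i -> good Gam (a i) (b i) (p i).
Hypothesis Hdisj : forall i j h u, V i -> V j -> Gam h -> a i < u < b i -> a j < h u < b j -> i = j.
Hypothesis Hdense : forall x y, x < y -> exists i h z, V i /\ Gam h /\ x < z < y /\ a i < h z < b i.
Variable N : nat -> nat.
Hypothesis HN1 : forall i, (1 <= N i)%nat.
Hypothesis HN : forall i k z x l, in_window Gam k z x l ->
  fsum (fun H => / weight L al (N i) H) l <= INR k * (/ 2) ^ i.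

Let HG := lg_ig _ _ _ _ HL.

(* The index [(i, h)] stands for the pullback by [h] of the density living on the interval [(a i, b i)];
   pulling back instead of pushing forward avoids inverses. *)
Definition idx := (nat * (R -> R))%type.
Definition inI (g : idx) : Prop := V (fst g) /\ Gam (snd g).
Definition scale (g : idx) : R := weight L al (N (fst g)) (snd g).
Definition hits (g : idx) (x : R) : Prop := a (fst g) < snd g x < b (fst g).
Definition mass (A : R) (g : idx) (x : R) : R := Th (a (fst g)) (b (fst g)) (p (fst g)) A (snd g x).

Lemma scale_ge_1 g : 1 <= scale g.
Proof. apply weight_ge_1; auto. apply Hal. Qed.

Lemma good_ne g : inI g -> a (fst g) < b (fst g).
Proof. intros [HV _]. apply (gd_ne _ _ _ _ (Hgood _ HV)). Qed.

Lemma good_pincr g : inI g -> forall u v, a (fst g) < u -> u < v -> v < b (fst g) -> p (fst g) u < p (fst g) v.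
Proof. intros [HV _]. apply (gd_incr _ _ _ _ (Hgood _ HV)). Qed.

Lemma good_psurj g : inI g -> forall y, exists u, a (fst g) < u < b (fst g) /\ p (fst g) u = y.
Proof. intros [HV _]. apply (gd_surj _ _ _ _ (Hgood _ HV)). Qed.

Lemma inI_incr g : inI g -> incr (snd g).
Proof. intros [_ HH]. now apply (ig_incr _ HG). Qed.

Lemma mass_mono A g x y : 0 < A -> inI g -> x <= y -> mass A g x <= mass A g y.
Proof.
  intros HA Hg Hxy. apply Th_mono; auto using good_ne.
  - now apply good_pincr.
  - apply incr_le; auto. now apply inI_incr.
Qed.

(** For fixed [i] the condition confines [h z] to a window of length at most [k + 1], because the
    interval has length at most 1. The bounds in [HN] then form a geometric series in [i]. *)
Lemma window_sum k z l : on_P inI l -> (forall g, In g l -> a (fst g) - INR k <= snd g z < b (fst g)) ->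
  fsum (fun g => / scale g) l <= 2 * INR (S k).
Proof.
  intros Hl Hw.
  assert (Hind : forall n l, on_P inI l -> 
    (forall g, In g l -> (fst g < n)%nat /\ a (fst g) - INR k <= snd g z < b (fst g)) ->
    fsum (fun g => / scale g) l <= INR (S k) * (2 - 2 * (/ 2) ^ n)).
  { clear l Hl Hw. induction n as [|n IH]; intros l [Hnd Hl] Hw.
    - destruct l as [|g l]; [simpl; lra|]. destruct (Hw g (or_introl eq_refl)). lia.
    - set (t := fun g : idx => Nat.eqb (fst g) n). rewrite (fsum_filter _ t).
      assert (H1 : fsum (fun g => / scale g) (filter (fun g => negb (t g)) l) <= INR (S k) * (2 - 2 * (/ 2) ^ n)).
      { apply IH.
        - split; [now apply NoDup_filter|]. intros g Hg. apply filter_In in Hg as [Hg _]. auto.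
        - intros g Hg. apply filter_In in Hg as [Hg Ht]. destruct (Hw g Hg) as [W1 W2]. split; auto.
          unfold t in Ht. rewrite Bool.negb_true_iff, Nat.eqb_neq in Ht. lia. }
      set (l' := filter t l).
      assert (Hl' : forall g, In g l' -> In g l /\ fst g = n).
      { intros g Hg. apply filter_In in Hg as [Hg Ht]. unfold t in Ht. now rewrite Nat.eqb_eq in Ht. }
      assert (H2 : fsum (fun g => / scale g) l' <= INR (S k) * (/ 2) ^ n).
      { replace (fsum (fun g => / scale g) l') with (fsum (fun H => / weight L al (N n) H) (map snd l')).
        - apply (HN n (S k) (a n - INR k) z). split.
          + apply NoDup_map_NoDup_ForallPairs; [|now apply NoDup_filter].
            intros g g' Hg Hg' E. apply Hl' in Hg as [_ Hg]. apply Hl' in Hg' as [_ Hg'].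
            destruct g, g'; simpl in *; congruence.
          + intros H HH. apply in_map_iff in HH as (g & <- & Hg). apply Hl' in Hg as [Hg En].
            destruct (Hl g Hg) as [HV HH]. destruct (Hw g Hg) as [_ W2]. rewrite En in *.
            pose proof (good_length Gam L Cst d HL _ _ _ (Hgood n HV)).
            split; auto. rewrite S_INR. lra.
        - clearbody l'. clear -Hl'. induction l' as [|g l' IH]; simpl; auto.
          rewrite IH; [|intros; apply Hl'; now right]. unfold scale. now rewrite (proj2 (Hl' g (or_introl eq_refl))). }
      simpl pow. lra. }
  assert (Hn : exists n, forall g, In g l -> (fst g < n)%nat).
  { clear. induction l as [|g l [n Hn]].
    - exists O. intros g [].
    - exists (S (n + fst g)). intros g' [<-|Hg]; [lia|]. pose proof (Hn g' Hg). lia. }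
  destruct Hn as [n Hn].
  apply Rle_trans with (INR (S k) * (2 - 2 * (/ 2) ^ n)).
  - apply Hind; auto.
  - pose proof (pos_INR (S k)). assert (0 < (/ 2) ^ n) by (apply pow_lt; lra). nra.
Qed.

Lemma mass_const A g x y : 0 < A -> inI g -> x <= y ->
  (forall w, x <= w <= y -> ~ hits g w) -> mass A g x = mass A g y.
Proof.
  intros HA Hg Hxy Hno. pose proof (good_ne g Hg) as Hab. unfold mass.
  assert (Hle : snd g x <= snd g y) by (apply incr_le; auto; now apply inI_incr).
  destruct (Rle_lt_dec (snd g y) (a (fst g))) as [H1|H1]; [rewrite !Th_left; auto; lra|].
  destruct (Rle_lt_dec (b (fst g)) (snd g x)) as [H2|H2]; [rewrite !Th_right; auto; lra|].
  exfalso. pose proof (Hno x). pose proof (Hno y). unfold hits in *.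
  assert (Hx : snd g x <= a (fst g)) by lra. assert (Hy : b (fst g) <= snd g y) by lra.
  destruct (ig_inv _ HG (snd g) (proj2 Hg)) as [h [Hh [I1 I2]]].
  pose proof (ig_incr _ HG h Hh) as Ih. set (m := (a (fst g) + b (fst g)) / 2).
  apply (Hno (h m)).
  - rewrite <- (I1 x), <- (I1 y). split; apply incr_le; auto; unfold m; lra.
  - rewrite I2. unfold m; lra.
Qed.

Lemma mass_sum_bound m x y l : x <= y <= x + INR m -> on_P inI l ->
  fsum (fun g => mass (scale g) g y - mass (scale g) g x) l <= PI * (2 * INR (S m)).
Proof.
  (* Only indices whose interval is met between [h x] and [h y] contribute. As [h y <= h x + m],
     these satisfy the test [t]. *)
  intros Hxy Hl. set (t := fun g : idx => btest (a (fst g) - INR m <= snd g x < b (fst g))).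
  rewrite (fsum_filter _ t).
  assert (H1 : fsum (fun g => mass (scale g) g y - mass (scale g) g x) (filter t l) <= PI * (2 * INR (S m))).
  { apply Rle_trans with (PI * fsum (fun g => / scale g) (filter t l)).
    - rewrite <- fsum_scal. apply fsum_le. intros g Hg. apply filter_In in Hg as [Hg _].
      pose proof (scale_ge_1 g). assert (Hg' : inI g) by now apply Hl.
      pose proof (Th_bounds _ _ (p (fst g)) (good_ne g Hg') (scale g) (snd g y)).
      pose proof (Th_bounds _ _ (p (fst g)) (good_ne g Hg') (scale g) (snd g x)).
      unfold mass, Rdiv in *. lra.
    - apply Rmult_le_compat_l; [left; apply PI_RGT_0|]. apply (window_sum m x).
      + split; [apply NoDup_filter, Hl|]. intros g Hg. apply filter_In in Hg as [Hg _]. now apply Hl.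
      + intros g Hg. apply filter_In in Hg as [_ Hg]. unfold t in Hg. now rewrite btest_true in Hg. }
  assert (H2 : fsum (fun g => mass (scale g) g y - mass (scale g) g x) (filter (fun g => negb (t g)) l) <= 0).
  { apply Rle_trans with (fsum (fun _ => 0) (filter (fun g => negb (t g)) l)); [|rewrite fsum_const; lra].
    apply fsum_le. intros g Hg. apply filter_In in Hg as [Hg Ht].
    unfold t in Ht. rewrite Bool.negb_true_iff, btest_false in Ht.
    assert (Hg' : inI g) by now apply Hl. pose proof (scale_ge_1 g). 
    assert (Hyx : snd g x <= snd g y <= snd g x + INR m).
    { pose proof (inI_incr g Hg') as I. split; [apply incr_le; auto; lra|].
      rewrite <- (com_n Gam L Cst d HL (snd g) m x) by apply Hg'. apply incr_le; auto; lra. }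
    rewrite (mass_const (scale g) g x y); auto; try lra.
    intros w Hw Hhit. unfold hits in Hhit. apply Ht.
    pose proof (incr_le _ _ _ (inI_incr g Hg') (proj1 Hw)).
    pose proof (incr_le _ _ _ (inI_incr g Hg') (proj2 Hw)). lra. }
  lra.
Qed.

Lemma measure_exists x y : exists s, has_sum inI (fun g => mass (scale g) g y - mass (scale g) g x) s.
Proof.
  assert (Hle : forall x y, x <= y -> exists s, has_sum inI (fun g => mass (scale g) g y - mass (scale g) g x) s).
  { clear x y. intros x y Hxy. destruct (INR_unbounded (y - x)) as [m Hm].
    destruct (has_sum_exists inI (fun g => mass (scale g) g y - mass (scale g) g x) (PI * (2 * INR (S m))))
      as [s [Hs _]]; [| |eauto].
    - intros g Hg. pose proof (scale_ge_1 g). assert (mass (scale g) g x <= mass (scale g) g y); [|lra].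
      apply mass_mono; auto; lra.
    - intros l Hl. apply mass_sum_bound; auto; lra. }
  destruct (Rle_lt_dec x y) as [H|H]; auto. destruct (Hle y x) as [s Hs]; [lra|].
  exists ((-1) * s). apply (has_sum_ext inI (fun g => (-1) * (mass (scale g) g x - mass (scale g) g y))); [intros; lra|].
  now apply has_sum_scal.
Qed.

(** Counted from [0], because half-lines have infinite mass: the measure is invariant under
    [shift]. *)
Definition psi (x : R) : R :=
  epsilon (inhabits 0) (has_sum inI (fun g => mass (scale g) g x - mass (scale g) g 0)).

Lemma psi_sum x y : has_sum inI (fun g => mass (scale g) g y - mass (scale g) g x) (psi y - psi x).
Proof.
  assert (H : forall x, has_sum inI (fun g => mass (scale g) g x - mass (scale g) g 0) (psi x)).
  { intros z. unfold psi. apply epsilon_spec. apply measure_exists. }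
  apply (has_sum_ext inI (fun g => (mass (scale g) g y - mass (scale g) g 0) - (mass (scale g) g x - mass (scale g) g 0)));
    [intros; lra|].
  now apply has_sum_minus.
Qed.

Lemma mass_diff_pos x y g : x <= y -> inI g -> 0 <= mass (scale g) g y - mass (scale g) g x.
Proof.
  intros Hxy Hg. pose proof (scale_ge_1 g).
  assert (mass (scale g) g x <= mass (scale g) g y); [apply mass_mono; auto; lra|lra].
Qed.

Lemma psi_ge_term x y g : x <= y -> inI g -> mass (scale g) g y - mass (scale g) g x <= psi y - psi x.
Proof.
  intros Hxy Hg.
  apply (has_sum_ge_term inI (fun g => mass (scale g) g y - mass (scale g) g x) _ g (psi_sum x y)); auto.
  intros h Hh. now apply mass_diff_pos.
Qed.

Lemma psi_incr : incr psi.
Proof.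
  intros x y Hxy. destruct (Hdense x y Hxy) as (i & h & z & HV & Hh & Hz & Hhit).
  assert (Hg : inI (i, h)) by now split.
  pose proof (psi_ge_term x y (i, h) (Rlt_le _ _ Hxy) Hg).
  assert (mass (scale (i, h)) (i, h) x < mass (scale (i, h)) (i, h) y); [|lra].
  pose proof (scale_ge_1 (i, h)). pose proof (ig_incr _ HG h Hh) as Ih.
  unfold mass. cbn [fst snd].
  apply (Th_strict (a i) (b i) (p i) (good_ne (i, h) Hg) (good_pincr (i, h) Hg) _ _ (h z)); auto.
  - lra.
  - apply Ih; lra.
  - left. apply Ih; lra.
Qed.

Lemma finite_near_right x l eps : (forall g, In g l -> inI g) -> 0 < eps -> exists y, x < y <= x + 1 /\
  fsum (fun g => mass (scale g) g y - mass (scale g) g x) l < eps.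
Proof.
  revert eps. induction l as [|g l IH]; intros eps Hl Heps.
  - exists (x + 1). split; [lra|simpl; auto].
  - destruct (IH (eps / 2)) as [y1 [Y1 Y2]]; [intros; apply Hl; now right|lra|].
    assert (Hg : inI g) by (apply Hl; now left).
    destruct (Th_near_right _ _ (p (fst g)) (good_ne g Hg) (good_pincr g Hg) (good_psurj g Hg) (scale g) (snd g x) (eps / 2))
      as [v [V1 V2]]; [apply scale_ge_1|lra|].
    destruct (ig_inv _ HG (snd g) (proj2 Hg)) as [h [Hh [I1 I2]]].
    exists (Rmin y1 (h v)). pose proof (Rmin_l y1 (h v)) as R1. pose proof (Rmin_r y1 (h v)) as R2.
    assert (x < Rmin y1 (h v)).
    { apply Rmin_glb_lt; [lra|]. rewrite <- (I1 x). now apply (ig_incr _ HG). }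
    split; [lra|]. simpl.
    assert (fsum (fun g => mass (scale g) g (Rmin y1 (h v)) - mass (scale g) g x) l <=
      fsum (fun g => mass (scale g) g y1 - mass (scale g) g x) l).
    { apply fsum_le. intros g' Hg'. assert (Ig' : inI g') by (apply Hl; now right).
      pose proof (mass_diff_pos _ _ g' R1 Ig'). lra. }
    pose proof (mass_diff_pos _ _ g R2 Hg). unfold mass in *. rewrite I2 in *. lra.
Qed.

Lemma finite_near_left x l eps : (forall g, In g l -> inI g) -> 0 < eps -> exists y, x - 1 <= y < x /\
  fsum (fun g => mass (scale g) g x - mass (scale g) g y) l < eps.
Proof.
  revert eps. induction l as [|g l IH]; intros eps Hl Heps.
  - exists (x - 1). split; [lra|simpl; auto].
  - destruct (IH (eps / 2)) as [y1 [Y1 Y2]]; [intros; apply Hl; now right|lra|].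
    assert (Hg : inI g) by (apply Hl; now left).
    destruct (Th_near_left _ _ (p (fst g)) (good_ne g Hg) (good_pincr g Hg) (good_psurj g Hg) (scale g) (snd g x) (eps / 2))
      as [v [V1 V2]]; [apply scale_ge_1|lra|].
    destruct (ig_inv _ HG (snd g) (proj2 Hg)) as [h [Hh [I1 I2]]].
    exists (Rmax y1 (h v)). pose proof (Rmax_l y1 (h v)) as R1. pose proof (Rmax_r y1 (h v)) as R2.
    assert (Rmax y1 (h v) < x).
    { apply Rmax_lub_lt; [lra|]. rewrite <- (I1 x). now apply (ig_incr _ HG). }
    split; [lra|]. simpl.
    assert (fsum (fun g => mass (scale g) g x - mass (scale g) g (Rmax y1 (h v))) l <=
      fsum (fun g => mass (scale g) g x - mass (scale g) g y1) l).
    { apply fsum_le. intros g' Hg'. assert (Ig' : inI g') by (apply Hl; now right).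
      pose proof (mass_diff_pos _ _ g' R1 Ig'). lra. }
    pose proof (mass_diff_pos _ _ g R2 Hg). unfold mass in *. rewrite I2 in *. lra.
Qed.

Definition nearby (f : R -> R) : Prop := forall x eps, 0 < eps ->
  (exists y, x < y /\ f y < f x + eps) /\ (exists y, y < x /\ f x - eps < f y).

(** Up to [eps / 2] the mass of the unit interval beside [x] comes from finitely many indices, and
    each of these has a continuous distribution function. *)
Lemma psi_nearby : nearby psi.
Proof.
  intros x eps Heps. split.
  - destruct (has_sum_tail inI _ _ (eps / 2) (psi_sum x (x + 1))) as [l [Hl Ht]]; [|lra|].
    { intros g Hg. apply mass_diff_pos; auto; lra. }
    destruct (finite_near_right x l (eps / 2)) as [y [Hy Hs]]; [apply Hl|lra|].
    exists y. split; [lra|].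
    assert (Hge : fsum (fun g => mass (scale g) g (x + 1) - mass (scale g) g y) l <= psi (x + 1) - psi y).
    { apply (has_sum_ge_fsum inI); [apply psi_sum| |auto]. intros g Hg. apply mass_diff_pos; auto; lra. }
    assert (E : fsum (fun g => mass (scale g) g (x + 1) - mass (scale g) g x) l =
      fsum (fun g => mass (scale g) g (x + 1) - mass (scale g) g y) l + fsum (fun g => mass (scale g) g y - mass (scale g) g x) l).
    { rewrite <- fsum_plus. apply fsum_ext. intros; lra. }
    lra.
  - destruct (has_sum_tail inI _ _ (eps / 2) (psi_sum (x - 1) x)) as [l [Hl Ht]]; [|lra|].
    { intros g Hg. apply mass_diff_pos; auto; lra. }
    destruct (finite_near_left x l (eps / 2)) as [y [Hy Hs]]; [apply Hl|lra|].
    exists y. split; [lra|].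
    assert (Hge : fsum (fun g => mass (scale g) g y - mass (scale g) g (x - 1)) l <= psi y - psi (x - 1)).
    { apply (has_sum_ge_fsum inI); [apply psi_sum| |auto]. intros g Hg. apply mass_diff_pos; auto; lra. }
    assert (E : fsum (fun g => mass (scale g) g x - mass (scale g) g (x - 1)) l =
      fsum (fun g => mass (scale g) g x - mass (scale g) g y) l + fsum (fun g => mass (scale g) g y - mass (scale g) g (x - 1)) l).
    { rewrite <- fsum_plus. apply fsum_ext. intros; lra. }
    lra.
Qed.

Definition twist (Fi : R -> R) (g : idx) : idx := (fst g, fun x => snd g (Fi x)).

Lemma twist_inI Fi g : Gam Fi -> inI g -> inI (twist Fi g).
Proof. intros HF [H1 H2]. split; auto. simpl. now apply (ig_comp _ HG (snd g)). Qed.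

Lemma twist_twist F Fi g : inv_of F Fi -> twist F (twist Fi g) = g.
Proof.
  intros [I1 I2]. destruct g as [i H]. unfold twist. simpl. f_equal.
  apply functional_extensionality; intros x. now rewrite I1.
Qed.

(** Reindexing by composition with [Fi] turns the masses at [F x] and [F y] back into masses at [x]
    and [y]; only the scales change. *)
Lemma psi_pushed F Fi x y : Gam F -> Gam Fi -> inv_of F Fi ->
  has_sum inI (fun g => mass (scale (twist Fi g)) g y - mass (scale (twist Fi g)) g x) (psi (F y) - psi (F x)).
Proof.
  intros HF HFi HI. pose proof (psi_sum (F x) (F y)) as Hs.
  apply (has_sum_reindex inI _ _ (twist Fi) (twist F)) in Hs.
  - refine (has_sum_ext inI _ _ _ _ Hs). intros g Hg. unfold mass, twist. simpl. now rewrite !(proj1 HI).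
  - intros g Hg. split; [now apply twist_inI|]. now apply twist_twist.
  - intros g Hg. split; [now apply twist_inI|]. apply twist_twist. now apply inv_of_sym.
Qed.

(** Composition with [shift] does not change lengths, hence leaves all scales fixed in
    [psi_pushed]. *)
Lemma psi_shift x : psi (x + 1) - psi 1 = psi x - psi 0.
Proof.
  destruct (ig_inv _ HG shift (lg_shift _ _ _ _ HL)) as [s [Hs HI]].
  pose proof (psi_pushed shift s 0 x (lg_shift _ _ _ _ HL) Hs HI) as H1.
  change (psi (shift x) - psi (shift 0)) with (psi (x + 1) - psi (0 + 1)) in H1.
  rewrite Rplus_0_l in H1. apply (has_sum_unique inI _ _ _ H1).
  apply (has_sum_ext inI (fun g => mass (scale g) g x - mass (scale g) g 0)); [|apply psi_sum].
  intros g [_ Hg]. replace (scale (twist s g)) with (scale g); auto.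
  unfold scale, weight. do 3 f_equal. simpl.
  pose proof (lg_Lshift _ _ _ _ HL) as L0. pose proof (lg_Linv _ _ _ _ HL _ _ (lg_shift _ _ _ _ HL) HI) as L1.
  pose proof (lg_Lcomp _ _ _ _ HL (snd g) s Hg Hs) as L2.
  assert (Hgs : Gam (fun x => snd g (s x))) by now apply (ig_comp _ HG (snd g)).
  pose proof (lg_Lcomp _ _ _ _ HL _ shift Hgs (lg_shift _ _ _ _ HL)) as L3.
  cbn beta in L3. replace (fun x => snd g (s (shift x))) with (snd g) in L3; [lia|].
  apply functional_extensionality; intros y. now rewrite (proj1 HI).
Qed.

Lemma twist_comparable F Fi : Gam F -> Gam Fi -> inv_of F Fi ->
  exists c, forall g, inI g -> comparable al c (scale g) (scale (twist Fi g)).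
Proof.
  intros HF HFi HI. destruct (weight_comparable al (proj1 Hal) (INR (L F)) (proj2 Hal) (pos_INR _)) as [c Hc].
  exists c. intros g [_ Hg]. unfold scale, weight. apply Hc.
  - replace 1 with (INR 1) by reflexivity. apply le_INR. pose proof (HN1 (fst g)). lia.
  - replace 1 with (INR 1) by reflexivity. apply le_INR. pose proof (HN1 (fst (twist Fi g))). lia.
  - simpl. rewrite !plus_INR.
    pose proof (lg_Linv _ _ _ _ HL F Fi HF HI) as L1.
    pose proof (lg_Lcomp _ _ _ _ HL (snd g) Fi Hg HFi) as L2.
    assert (Hgs : Gam (fun x => snd g (Fi x))) by now apply (ig_comp _ HG (snd g)).
    pose proof (lg_Lcomp _ _ _ _ HL _ F Hgs HF) as L3.
    cbn beta in L3. replace (fun x => snd g (Fi (F x))) with (snd g) in L3.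
    2: { apply functional_extensionality; intros y. now rewrite (proj1 HI). }
    apply le_INR in L2, L3. rewrite plus_INR in L2, L3. rewrite L1 in L2. apply Rabs_le. lra.
Qed.

(** * The derivative of a conjugated element *)

Section Conjugate.
Variables (F Fi : R -> R) (c : R).
Hypothesis HF : Gam F.
Hypothesis HFi : Gam Fi.
Hypothesis HI : inv_of F Fi.
Hypothesis Hcmp : forall g, inI g -> comparable al c (scale g) (scale (twist Fi g)).
Hypothesis Hc : 1 <= c.

Let scale' g := scale (twist Fi g).

Definition coord (g : idx) (x : R) : R := p (fst g) (snd g x).

(** No derivative of the chart enters: the charts of all indices that hit [x] differ by
    translations, so all densities are taken with respect to one common coordinate. *)
Definition kern (A : idx -> R) (x : R) (g : idx) : R :=
  if excluded_middle_informative (hits g x) then ker (A g) (coord g x) else 0.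

Definition ksum (A : idx -> R) (x : R) : R := epsilon (inhabits 0) (has_sum inI (kern A x)).

(* The ratio of the densities of the measure pulled back by [F] and of the measure itself. *)
Definition rate (x : R) : R :=
  if excluded_middle_informative (exists g, inI g /\ hits g x) then ksum scale' x / ksum scale x else 1.

Lemma kern_hit A x g : hits g x -> kern A x g = ker (A g) (coord g x).
Proof. intros H. unfold kern. destruct (excluded_middle_informative (hits g x)); tauto. Qed.

Lemma kern_miss A x g : ~ hits g x -> kern A x g = 0.
Proof. intros H. unfold kern. destruct (excluded_middle_informative (hits g x)); tauto. Qed.

Lemma ker_le_inv A t : 1 <= A -> ker A t <= / A.
Proof. intros HA. unfold ker. apply Rinv_le_contravar; nra. Qed.

Lemma kern_sum_exists (A : idx -> R) K x : (forall g, inI g -> 1 <= A g) -> 0 <= K ->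
  (forall g, inI g -> hits g x -> ker (A g) (coord g x) <= K * / scale g) -> exists s, has_sum inI (kern A x) s.
Proof.
  intros HA HK Hle. destruct (has_sum_exists inI (kern A x) (K * (2 * INR 1))) as [s [Hs _]]; [| |eauto].
  - intros g Hg. destruct (classic (hits g x)) as [Hh|Hh]; [rewrite kern_hit by auto|rewrite kern_miss by auto; lra].
    left. apply ker_pos. pose proof (HA g Hg). lra.
  - intros l Hl. set (t := fun g : idx => btest (hits g x)). rewrite (fsum_filter _ t).
    assert (H1 : fsum (kern A x) (filter t l) <= K * fsum (fun g => / scale g) (filter t l)).
    { rewrite <- fsum_scal. apply fsum_le. intros g Hg. apply filter_In in Hg as [Hg Ht].
      unfold t in Ht. rewrite btest_true in Ht. rewrite kern_hit by auto. apply Hle; auto. now apply Hl. }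
    assert (H2 : fsum (fun g => / scale g) (filter t l) <= 2 * INR 1).
    { apply (window_sum 0 x).
      - split; [apply NoDup_filter, Hl|]. intros g Hg. apply filter_In in Hg as [Hg _]. now apply Hl.
      - intros g Hg. apply filter_In in Hg as [_ Hg]. unfold t in Hg. rewrite btest_true in Hg.
        unfold hits in Hg. simpl. lra. }
    assert (H3 : fsum (kern A x) (filter (fun g => negb (t g)) l) = 0).
    { rewrite (fsum_ext _ (fun _ => 0)); [rewrite fsum_const; lra|]. intros g Hg.
      apply filter_In in Hg as [_ Hg]. unfold t in Hg. rewrite Bool.negb_true_iff, btest_false in Hg.
      now apply kern_miss. }
    rewrite H3, Rplus_0_r. apply Rle_trans with (1 := H1). now apply Rmult_le_compat_l.
Qed.

Lemma ksum_scale x : has_sum inI (kern scale x) (ksum scale x).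
Proof.
  unfold ksum. apply epsilon_spec. apply (kern_sum_exists scale 1); [intros; apply scale_ge_1|lra|].
  intros g _ _. rewrite Rmult_1_l. apply ker_le_inv, scale_ge_1.
Qed.

Lemma Rpower_le_1 r : 1 <= r -> Rpower r (- al) <= 1.
Proof.
  intros Hr. apply Rle_trans with (Rpower 1 (- al)).
  - apply Rpower_anti; lra.
  - right. unfold Rpower. now rewrite ln_1, Rmult_0_r, exp_0.
Qed.

Lemma rad_ge_1 g t : 1 <= rad (scale g) t.
Proof. pose proof (scale_ge_1 g). pose proof (rad_ge (scale g) t). lra. Qed.

Lemma ksum_scale' x : has_sum inI (kern scale' x) (ksum scale' x).
Proof.
  unfold ksum. apply epsilon_spec. apply (kern_sum_exists scale' (1 + c ^ 3)).
  - intros g Hg. apply scale_ge_1.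
  - pose proof (pow_le c 3). lra.
  - intros g Hg _. pose proof (ker_close al c _ _ Hal (Hcmp g Hg) (coord g x)) as Hk.
    apply Rabs_le_inv in Hk. pose proof (Rpower_le_1 _ (rad_ge_1 g (coord g x))).
    pose proof (ker_le_inv (scale g) (coord g x) (scale_ge_1 g)).
    assert (0 < ker (scale g) (coord g x)) by (apply ker_pos; pose proof (scale_ge_1 g); lra).
    assert (1 <= c ^ 3) by (apply pow_R1_Rle; auto).
    assert (c ^ 3 * Rpower (rad (scale g) (coord g x)) (- al) * ker (scale g) (coord g x) <= c ^ 3 * 1 * ker (scale g) (coord g x)).
    { apply Rmult_le_compat_r; [lra|]. apply Rmult_le_compat_l; lra. }
    fold (scale' g) in Hk. nra.
Qed.

Lemma kern_nonneg x g : 0 <= kern scale x g.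
Proof.
  unfold kern. destruct (excluded_middle_informative (hits g x)); [|lra].
  left. apply ker_pos. pose proof (scale_ge_1 g). lra.
Qed.

Lemma ksum_pos x g : inI g -> hits g x -> ker (scale g) (coord g x) <= ksum scale x.
Proof.
  intros Hg Hh. rewrite <- (kern_hit scale) by auto.
  apply (has_sum_ge_term inI (kern scale x) _ g (ksum_scale x)); auto. intros; apply kern_nonneg.
Qed.

Lemma ksum_pos' x g : inI g -> hits g x -> 0 < ksum scale x.
Proof.
  intros Hg Hh. apply Rlt_le_trans with (2 := ksum_pos x g Hg Hh). apply ker_pos. pose proof (scale_ge_1 g). lra.
Qed.

Lemma rate_close x eta : 0 <= eta ->
  (forall g, inI g -> hits g x -> Rpower (rad (scale g) (coord g x)) (- al) <= eta) ->
  Rabs (rate x - 1) <= c ^ 3 * eta.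
Proof.
  intros He H. unfold rate. destruct (excluded_middle_informative _) as [[g [Hg Hh]]|_].
  - pose proof (ksum_pos' x g Hg Hh) as Hpos.
    assert (Habs : Rabs (ksum scale' x - ksum scale x) <= c ^ 3 * eta * ksum scale x).
    { apply (has_sum_abs_le inI (fun g => kern scale' x g - kern scale x g) (fun g => c ^ 3 * eta * kern scale x g)).
      - apply has_sum_minus; [apply ksum_scale'|apply ksum_scale].
      - apply has_sum_scal, ksum_scale.
      - intros g' Hg'. destruct (classic (hits g' x)) as [Hh'|Hh'].
        + rewrite !kern_hit by auto. apply Rle_trans with (1 := ker_close al c _ _ Hal (Hcmp g' Hg') (coord g' x)).
          apply Rmult_le_compat_r; [left; apply ker_pos; pose proof (scale_ge_1 g'); lra|].
          apply Rmult_le_compat_l; [apply pow_le; lra|]. auto.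
        + rewrite !kern_miss by auto. rewrite Rminus_diag, Rabs_R0. lra. }
    replace (ksum scale' x / ksum scale x - 1) with ((ksum scale' x - ksum scale x) * / ksum scale x) by (field; lra).
    rewrite Rabs_mult, (Rabs_right (/ _)) by (left; now apply Rinv_0_lt_compat).
    apply Rmult_le_reg_r with (ksum scale x); auto. rewrite Rmult_assoc, Rinv_l; lra.
  - rewrite Rminus_diag, Rabs_R0. pose proof (pow_le c 3). apply Rmult_le_pos; [apply pow_le; lra|auto].
Qed.

(** * The two-point estimate *)

Section Pair.
Variables (x y : R).
Hypothesis Hxy : x < y.

Let delta := psi y - psi x.
Let delta' := psi (F y) - psi (F x).

Lemma delta_pos : 0 < delta.
Proof. unfold delta. pose proof (psi_incr x y Hxy). lra. Qed.

Lemma delta_sum : has_sum inI (fun g => mass (scale g) g y - mass (scale g) g x) delta.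
Proof. apply psi_sum. Qed.

Lemma delta'_sum : has_sum inI (fun g => mass (scale' g) g y - mass (scale' g) g x) delta'.
Proof. apply (psi_pushed F Fi); auto. Qed.

Lemma delta_ge g : inI g -> mass (scale g) g y - mass (scale g) g x <= delta.
Proof. intros Hg. apply (psi_ge_term); auto. lra. Qed.

(** If every radius [r] met on the segment satisfies [kap / r <= delta], then [r ^ (- al)] is at
    most [delta ^ al / kap]. The quotient [delta' / delta] and [rate z] are then both close to 1,
    and comparing each of them with 1 suffices. *)
Lemma near_estimate kap z : 0 < kap <= 1 -> z = x \/ z = y ->
  (forall g v, inI g -> a (fst g) < v < b (fst g) -> snd g x <= v <= snd g y ->
     kap / rad (scale g) (p (fst g) v) <= delta) ->
  Rabs (delta' - rate z * delta) <= 2 * c ^ 3 * / kap * (delta * Rpower delta al).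
Proof.
  intros Hk Hz Hnear. pose proof delta_pos as Hd.
  set (eta := / kap * Rpower delta al).
  assert (Hki : 1 <= / kap) by (rewrite <- Rinv_1; apply Rinv_le_contravar; lra).
  assert (Heta : 0 <= eta) by (unfold eta; pose proof (Rpower_pos delta al); nra).
  assert (Hrad : forall g t, kap / rad (scale g) t <= delta -> Rpower (rad (scale g) t) (- al) <= eta).
  { intros g t H. pose proof (rad_ge_1 g t) as Hr.
    rewrite Rpower_Ropp, <- Rpower_inv by lra. unfold eta.
    assert (H1 : / rad (scale g) t <= / kap * delta).
    { apply (Rmult_le_compat_l (/ kap)) in H; [|lra]. unfold Rdiv in H. rewrite <- Rmult_assoc, Rinv_l, Rmult_1_l in H; lra. }
    apply Rle_trans with (Rpower (/ kap * delta) al).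
    - apply Rle_Rpower_l; [lra|]. split; auto. apply Rinv_0_lt_compat. lra.
    - rewrite <- Rpower_mult_distr by lra. apply Rmult_le_compat_r; [left; apply Rpower_pos|].
      rewrite <- (Rpower_1 (/ kap)) at 2 by lra. apply Rle_Rpower; lra. }
  assert (H1 : Rabs (delta' - delta) <= c ^ 3 * eta * delta).
  { apply (has_sum_abs_le inI (fun g => (mass (scale' g) g y - mass (scale' g) g x) - (mass (scale g) g y - mass (scale g) g x))
      (fun g => c ^ 3 * eta * (mass (scale g) g y - mass (scale g) g x))).
    - apply has_sum_minus; [apply delta'_sum|apply delta_sum].
    - apply has_sum_scal, delta_sum.
    - intros g Hg. unfold mass. apply (Th_close _ _ _ (good_ne g Hg)
        (good_pincr g Hg) (good_psurj g Hg) al); auto.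
      apply incr_le; [apply (ig_incr _ HG), Hg|lra]. }
  assert (H2 : Rabs (rate z - 1) <= c ^ 3 * eta).
  { apply rate_close; auto. intros g Hg Hh. apply Hrad. apply Hnear; auto.
    pose proof (ig_incr _ HG _ (proj2 Hg) x y Hxy). destruct Hz as [-> | ->]; lra. }
  replace (delta' - rate z * delta) with ((delta' - delta) - (rate z - 1) * delta) by ring.
  apply Rle_trans with (1 := Rabs_triang _ _). rewrite Rabs_Ropp, Rabs_mult, (Rabs_right delta) by lra.
  assert (Rabs (rate z - 1) * delta <= c ^ 3 * eta * delta) by (apply Rmult_le_compat_r; lra).
  unfold eta in *. nra.
Qed.

(** On one side of [v] the segment covers a full radius of the kernel in the chart or reaches the
    end of the interval; in either case its mass is at least [1 / (4 * r)]. *)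
Lemma tail_mass_bound v g : inI g -> a (fst g) < v < b (fst g) -> snd g x <= v <= snd g y ->
  (snd g y < b (fst g) -> p (fst g) v + rad (scale g) (p (fst g) v) <= p (fst g) (snd g y)) \/
  (a (fst g) < snd g x -> p (fst g) (snd g x) <= p (fst g) v - rad (scale g) (p (fst g) v)) ->
  / 4 / rad (scale g) (p (fst g) v) <= delta.
Proof.
  intros Hg Hv Hxv Hor. apply Rle_trans with (2 := delta_ge g Hg).
  pose proof (scale_ge_1 g) as Hs. assert (Hs0 : 0 < scale g) by lra.
  pose proof (rad_ge_1 g (p (fst g) v)) as Hr.
  replace (/ 4 / rad (scale g) (p (fst g) v)) with (1 / (4 * rad (scale g) (p (fst g) v))) by (field; lra).
  unfold mass.
  pose proof (good_ne g Hg) as G1. pose proof (good_pincr g Hg) as G2.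
  pose proof (Th_mono _ _ _ G1 G2 (scale g) _ _ Hs0 (proj1 Hxv)) as M1.
  pose proof (Th_mono _ _ _ G1 G2 (scale g) _ _ Hs0 (proj2 Hxv)) as M2.
  destruct Hor as [Hor|Hor].
  - pose proof (Th_mass_right _ _ (p (fst g)) G1 (scale g) v (snd g y) 1 Hs0 ltac:(lra) Hv (proj2 Hxv)) as M.
    rewrite Rmult_1_l in M. specialize (M Hor). lra.
  - pose proof (Th_mass_left (a (fst g)) (b (fst g)) (p (fst g)) (scale g) v (snd g x) 1 Hs0 ltac:(lra) Hv (proj1 Hxv)) as M.
    rewrite Rmult_1_l in M. specialize (M Hor). lra.
Qed.

(** No interval of an index contains both images, so from any [v] the segment reaches an end of the
    interval and [tail_mass_bound] applies everywhere. *)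
Lemma separated_estimate z : z = x \/ z = y -> (~ exists g, inI g /\ hits g x /\ hits g y) ->
  Rabs (delta' - rate z * delta) <= 8 * c ^ 3 * (delta * Rpower delta al).
Proof.
  intros Hz Hsep. replace (8 * c ^ 3) with (2 * c ^ 3 * / / 4) by field.
  apply near_estimate; auto; [lra|]. intros g v Hg Hv Hxv. apply tail_mass_bound; auto.
  destruct (Rlt_le_dec (snd g y) (b (fst g))) as [H1|H1]; [|left; intros; lra]. right. intros H2.
  exfalso. apply Hsep. exists g. unfold hits. split; [auto|lra].
Qed.

(* When [x] and [y] lie in one interval of the family, all the charts through it differ by translations. *)
Lemma same_interval g0 g w : inI g0 -> hits g0 x -> hits g0 y -> inI g -> x <= w <= y -> hits g w ->
  forall w', x <= w' <= y -> hits g w' /\ 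
    coord g w' - coord g x = coord g0 w' - coord g0 x.
Proof.
  intros Hg0 Hx Hy Hg Hw Hh. pose proof (ig_incr _ HG _ (proj2 Hg0)) as I0.
  destruct (ig_inv _ HG _ (proj2 Hg0)) as [e [He [E1 E2]]].
  assert (Hin : forall w', x <= w' <= y -> hits g0 w').
  { intros w' Hw'. unfold hits in *. pose proof (incr_le _ _ _ I0 (proj1 Hw')).
    pose proof (incr_le _ _ _ I0 (proj2 Hw')). lra. }
  assert (Hge : Gam (fun u => snd g (e u))) by (apply (ig_comp _ HG (snd g)); auto; apply Hg).
  assert (Ei : fst g0 = fst g).
  { apply (Hdisj (fst g0) (fst g) (fun u => snd g (e u)) (snd g0 w)); auto; try apply Hg; try apply Hg0.
    - now apply Hin.
    - rewrite E1. exact Hh. }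
  destruct (gd_trans _ _ _ _ (Hgood _ (proj1 Hg0)) _ Hge) as [t Ht].
  { exists (snd g0 w). split; [now apply Hin|]. rewrite E1, Ei. exact Hh. }
  assert (Hall : forall w', x <= w' <= y -> hits g w' /\ coord g w' = coord g0 w' + t).
  { intros w' Hw'. destruct (Ht (snd g0 w') (Hin w' Hw')) as [H1 H2]. rewrite E1 in H1, H2.
    unfold hits, coord. rewrite <- Ei. split; auto. }
  intros w' Hw'. destruct (Hall w' Hw') as [H1 H2]. destruct (Hall x) as [H3 H4]; [lra|]. split; auto. lra.
Qed.

Lemma coord_incr g u v : inI g -> hits g u -> hits g v -> u < v -> coord g u < coord g v.
Proof.
  intros Hg Hu Hv Huv. apply (good_pincr g Hg); [apply Hu| |apply Hv].
  now apply (ig_incr _ HG _ (proj2 Hg)).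
Qed.

(** Here the chart length [s] is small against all radii at [z]. By the definition of [rate z] the
    terms linear in [s] cancel, and a second difference of relative size [(s / rho) * rho ^ (- al)]
    remains. The lower bounds [delta >= s * K / 2] and [delta >= s / (8 * rho ^ 2)] turn it into
    [delta ^ (1 + al)]. *)
Lemma far_estimate g0 g1 z s R0 : inI g0 -> hits g0 x -> hits g0 y -> z = x \/ z = y ->
  s = coord g0 y - coord g0 x -> inI g1 -> hits g1 z -> R0 = rad (scale g1) (coord g1 z) ->
  (forall g, inI g -> hits g z -> R0 <= 2 * rad (scale g) (coord g z)) -> s < R0 / (16 * c) ->
  Rabs (delta' - rate z * delta) <= 256 * c ^ 4 * (delta * Rpower delta al).
Proof.
  intros Hg0 H0x H0y Hz Es Hg1 H1z ER Hmin Hs.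
  assert (Hzxy : x <= z <= y) by (destruct Hz; lra).
  assert (Hspos : 0 < s) by (rewrite Es; pose proof (coord_incr g0 x y Hg0 H0x H0y Hxy); lra).
  pose proof (rad_ge_1 g1 (coord g1 z)) as HR1. rewrite <- ER in HR1.
  (* A lower bound for the radii of all indices that hit [z], as [R0] is minimal up to the factor
     2. *)
  set (rho := R0 / 2). assert (Hrho : 0 < rho) by (unfold rho; lra).
  assert (Hc3 : 1 <= c ^ 3) by (apply pow_R1_Rle; auto). assert (Hc4 : c ^ 3 <= c ^ 4) by (simpl; nra).
  assert (Hs' : s * (8 * c) < rho).
  { unfold rho. apply (Rmult_lt_compat_r (16 * c)) in Hs; [|lra]. unfold Rdiv in *. rewrite Rmult_assoc, Rinv_l in Hs; lra. }
  assert (Hsr : s <= rho) by nra.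
  set (P := Rpower rho (- al)). assert (HP : 0 < P) by apply Rpower_pos.
  assert (HradP : forall g, inI g -> hits g z -> rho <= rad (scale g) (coord g z) /\
    Rpower (rad (scale g) (coord g z)) (- al) <= P).
  { intros g Hg Hh. pose proof (Hmin g Hg Hh). assert (rho <= rad (scale g) (coord g z)) by (unfold rho; lra).
    split; auto. apply Rpower_anti; lra. }
  assert (Hrate : Rabs (rate z - 1) <= c ^ 3 * P).
  { apply rate_close; [lra|]. intros g Hg Hh. now apply HradP. }
  assert (Hseg : forall g, inI g -> hits g z -> exists t1 t2, hits g x /\ hits g y /\ 
     coord g x = t1 /\ coord g y = t2 /\ t2 - t1 = s /\ t1 <= coord g z <= t2).
  { intros g Hg Hh. pose proof (same_interval g0 g z Hg0 H0x H0y Hg Hzxy Hh) as Hall.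
    destruct (Hall x) as [A1 A2]; [lra|]. destruct (Hall y) as [B1 B2]; [lra|]. destruct (Hall z Hzxy) as [C1 C2].
    exists (coord g x), (coord g y). repeat split; try apply A1; try apply B1; try lra;
    destruct Hz as [-> | ->]; lra. }
  assert (Hmiss : forall A g, 0 < A -> inI g -> ~ hits g z -> mass A g x = mass A g y).
  { intros A g HA Hg Hh. apply (mass_const); auto; [lra|].
    intros w Hw Hhw. apply Hh. apply (same_interval g0 g w Hg0 H0x H0y Hg Hw Hhw z Hzxy). }
  assert (Hmass : forall A g, inI g -> hits g x -> mass A g x = cdf A (coord g x)).
  { intros A g Hg Hh. unfold mass, coord. apply Th_in; auto. }
  assert (Hmassy : forall A g, inI g -> hits g y -> mass A g y = cdf A (coord g y)).
  { intros A g Hg Hh. unfold mass, coord. apply Th_in; auto. }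
  set (K := ksum scale z). assert (HK : 0 < K) by now apply (ksum_pos' z g1).
  assert (Hrem : forall g xi, inI g -> hits g z -> Rabs (xi - coord g z) <= s ->
    Rabs (ker (scale g) xi - ker (scale g) (coord g z)) <= 4 * (s / rho) * ker (scale g) (coord g z)).
  { intros g xi Hg Hh Hxi. destruct (HradP g Hg Hh) as [Hr1 _]. pose proof (scale_ge_1 g).
    assert (0 < ker (scale g) (coord g z)) by (apply ker_pos; lra).
    apply Rle_trans with (4 * (Rabs (xi - coord g z) / rad (scale g) (coord g z)) * ker (scale g) (coord g z)).
    - apply ker_variation; [lra|]. nra.
    - apply Rmult_le_compat_r; [lra|]. apply Rmult_le_compat_l; [lra|].
      unfold Rdiv. apply Rmult_le_compat; [apply Rabs_pos|left; apply Rinv_0_lt_compat; lra|auto|].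
      apply Rinv_le_contravar; lra. }
  assert (Hxi_s : forall t1 t2 tz xi, t2 - t1 = s -> t1 <= tz <= t2 -> t1 < xi < t2 -> Rabs (xi - tz) <= s).
  { intros t1 t2 tz xi E1 E2 E3. apply Rabs_le. lra. }
  assert (Hsq : 0 <= s / rho) by (apply Rmult_le_pos; [lra|left; now apply Rinv_0_lt_compat]).
  assert (Hsq2 : 4 * (s / rho) <= / 2).
  { apply Rmult_le_reg_r with rho; auto. unfold Rdiv. rewrite !Rmult_assoc, Rinv_l by lra. nra. }
  assert (Hmain : Rabs (delta' - rate z * delta) <= 16 * c ^ 4 * (s * (s / rho)) * P * K).
  (* The subtracted terms [s * (kern scale' z g - rate z * kern scale z g)] sum to zero; they remove
     the first-order part of each summand. *)
  { assert (Hsum : has_sum inI (fun g => 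
        ((mass (scale' g) g y - mass (scale' g) g x) - rate z * (mass (scale g) g y - mass (scale g) g x))
        - s * (kern scale' z g - rate z * kern scale z g)) ((delta' - rate z * delta) - s * (ksum scale' z - rate z * K))).
    { apply has_sum_minus; [apply has_sum_minus; [apply delta'_sum|apply has_sum_scal, delta_sum]|].
      apply has_sum_scal. apply has_sum_minus; [apply ksum_scale'|apply has_sum_scal, ksum_scale]. }
    assert (E0 : ksum scale' z - rate z * K = 0).
    { unfold rate. destruct (excluded_middle_informative _) as [_|Hn]; [|exfalso; apply Hn; eauto].
      fold K. field. lra. }
    rewrite E0, Rmult_0_r, Rminus_0_r in Hsum.
    apply (has_sum_abs_le inI _ (fun g => 16 * c ^ 4 * (s * (s / rho)) * P * kern scale z g) _ _ Hsum).
    { apply has_sum_scal, ksum_scale. }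
    intros g Hg. pose proof (scale_ge_1 g) as S1. assert (S2 : 1 <= scale' g) by apply scale_ge_1.
    destruct (classic (hits g z)) as [Hh|Hh].
    2: { rewrite !kern_miss by auto. rewrite !(Hmiss _ g) by (auto; lra). rewrite !Rminus_diag.
         rewrite !Rmult_0_r, !Rminus_diag, Rmult_0_r, Rminus_0_r, Rabs_R0. lra. }
    destruct (Hseg g Hg Hh) as (t1 & t2 & Hhx & Hhy & <- & <- & Est & Htz).
    destruct (HradP g Hg Hh) as [Hr1 Hr2].
    rewrite !kern_hit, !Hmass, !Hmassy by auto.
    set (tz := coord g z) in *. set (t1 := coord g x) in *. set (t2 := coord g y) in *.
    set (A := scale g) in *. set (B := scale' g) in *.
    assert (Hkp : 0 < ker A tz) by (apply ker_pos; lra).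
    destruct (cdf_mvt1 A t1 t2) as [xi1 [X1 Y1]]; try lra.
    destruct (cdf_mvt (-1) A 1 B t1 t2) as [xi2 [X2 Y2]]; try lra.
    replace (cdf B t2 - cdf B t1 - rate z * (cdf A t2 - cdf A t1) - s * (ker B tz - rate z * ker A tz))
      with (s * ((ker B xi2 - ker A xi2) - (ker B tz - ker A tz)) - (rate z - 1) * (s * (ker A xi1 - ker A tz))).
    2: { rewrite Est in Y1, Y2. replace (cdf B t2 - cdf B t1) with (cdf A t2 - cdf A t1 + s * (-1 * ker A xi2 + 1 * ker B xi2)) by lra.
         rewrite Y1. ring. }
    assert (T1 : Rabs (s * ((ker B xi2 - ker A xi2) - (ker B tz - ker A tz))) <= 12 * c ^ 4 * (s * (s / rho)) * P * ker A tz).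
    { rewrite Rabs_mult, (Rabs_right s) by lra.
      assert (Hx2 : Rabs (xi2 - tz) <= s) by (apply (Hxi_s t1 t2); auto).
      assert (Hv : Rabs ((ker B xi2 - ker A xi2) - (ker B tz - ker A tz)) <=
        12 * c ^ 4 * (s / rho) * P * ker A tz).
      { apply Rle_trans with (12 * c ^ 4 * (Rabs (xi2 - tz) / rad A tz) * Rpower (rad A tz) (- al) * ker A tz).
        - apply ker_close_variation; auto.
          + now apply Hcmp.
          + apply Rmult_le_reg_r with (8 * c); [lra|]. unfold Rdiv. rewrite Rmult_assoc, Rinv_l; nra.
        - apply Rmult_le_compat_r; [lra|]. assert (0 <= 12 * c ^ 4) by lra.
          assert (0 <= Rabs (xi2 - tz) / rad A tz) by (apply Rmult_le_pos; [apply Rabs_pos|left; apply Rinv_0_lt_compat; lra]).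
          assert (Rabs (xi2 - tz) / rad A tz <= s / rho).
          { unfold Rdiv. apply Rmult_le_compat; [apply Rabs_pos|left; apply Rinv_0_lt_compat; lra|auto|].
            apply Rinv_le_contravar; lra. }
          apply Rmult_le_compat; auto; [nra|left; apply Rpower_pos|]. apply Rmult_le_compat_l; auto. }
      apply Rle_trans with (s * (12 * c ^ 4 * (s / rho) * P * ker A tz)); [|right; ring].
      apply Rmult_le_compat_l; lra. }
    assert (T2 : Rabs ((rate z - 1) * (s * (ker A xi1 - ker A tz))) <= 4 * c ^ 4 * (s * (s / rho)) * P * ker A tz).
    { rewrite !Rabs_mult, (Rabs_right s) by lra.
      assert (Hx1 : Rabs (xi1 - tz) <= s) by (apply (Hxi_s t1 t2); auto).
      pose proof (Hrem g xi1 Hg Hh Hx1) as Hv. fold A tz in Hv.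
      apply Rle_trans with ((c ^ 4 * P) * (s * (4 * (s / rho) * ker A tz))); [|right; ring].
      apply Rmult_le_compat; [apply Rabs_pos|apply Rmult_le_pos; [lra|apply Rabs_pos]| |apply Rmult_le_compat_l; lra].
      apply Rle_trans with (1 := Hrate). apply Rmult_le_compat_r; lra. }
    apply Rle_trans with (1 := Rabs_triang _ _). rewrite Rabs_Ropp. lra. }
  assert (Hdl : / 2 * s * K <= delta).
  { apply (has_sum_le inI (fun g => / 2 * s * kern scale z g) _ _ _ (has_sum_scal inI (/ 2 * s) _ _ (ksum_scale z)) delta_sum).
    intros g Hg. pose proof (scale_ge_1 g) as S1. destruct (classic (hits g z)) as [Hh|Hh].
    - destruct (Hseg g Hg Hh) as (t1 & t2 & Hhx & Hhy & <- & <- & Est & Htz).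
      rewrite kern_hit, Hmass, Hmassy by auto.
      destruct (cdf_mvt1 (scale g) (coord g x) (coord g y)) as [xi1 [X1 Y1]]; try lra.
      rewrite Y1, Est. assert (Hkp : 0 < ker (scale g) (coord g z)) by (apply ker_pos; lra).
      pose proof (Hrem g xi1 Hg Hh (Hxi_s _ _ _ _ Est Htz X1)) as Hv. apply Rabs_le_inv in Hv.
      assert (/ 2 * ker (scale g) (coord g z) <= ker (scale g) xi1) by nra.
      rewrite (Rmult_comm (/ 2)), Rmult_assoc. apply Rmult_le_compat_l; lra.
    - rewrite kern_miss by auto. rewrite (Hmiss (scale g) g) by (auto; lra). lra. }
  assert (Hdl2 : s / (8 * rho ^ 2) <= delta).
  { apply Rle_trans with (2 := Hdl). pose proof (ksum_pos z g1 Hg1 H1z) as Hk1. fold K in Hk1.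
    pose proof (scale_ge_1 g1). rewrite ker_rad, <- ER in Hk1 by lra.
    replace (s / (8 * rho ^ 2)) with (/ 2 * s * / R0 ^ 2) by (unfold rho; field; lra).
    apply Rmult_le_compat_l; lra. }
  (* From [Hdl2], [delta ^ al] dominates the product of the powers [al] of [/ 8], [s / rho] and
     [/ rho]. As [al <= 1], the first two powers are at least their bases, which are at most 1. *)
  assert (Hpow : s / rho * P <= 8 * Rpower delta al).
  { assert (H1 : Rpower (/ 8 * ((s / rho) * / rho)) al <= Rpower delta al).
    { apply Rle_Rpower_l; [lra|]. split.
      - apply Rmult_lt_0_compat; [lra|]. apply Rmult_lt_0_compat; [|now apply Rinv_0_lt_compat].
        apply Rmult_lt_0_compat; [lra|now apply Rinv_0_lt_compat].
      - replace (/ 8 * (s / rho * / rho)) with (s / (8 * rho ^ 2)) by (field; lra). auto. }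
    assert (Hsr0 : 0 < s / rho) by (apply Rmult_lt_0_compat; [lra|now apply Rinv_0_lt_compat]).
    assert (Hri : 0 < / rho) by now apply Rinv_0_lt_compat.
    rewrite <- !Rpower_mult_distr in H1; try lra; [|apply Rmult_lt_0_compat; auto].
    rewrite (Rpower_inv rho), <- Rpower_Ropp in H1 by auto. fold P in H1.
    assert (H2 : / 8 <= Rpower (/ 8) al) by (apply Rpower_ge_self; lra).
    assert (H3 : s / rho <= Rpower (s / rho) al) by (apply Rpower_ge_self; lra).
    assert (H4 : / 8 * (s / rho * P) <= Rpower (/ 8) al * (Rpower (s / rho) al * P)).
    { apply Rmult_le_compat; [lra|nra|auto|]. apply Rmult_le_compat_r; lra. }
    lra. }
  apply Rle_trans with (1 := Hmain).
  replace (16 * c ^ 4 * (s * (s / rho)) * P * K) with (32 * c ^ 4 * ((/ 2 * s * K) * (s / rho * P))) by (field; lra).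
  replace (256 * c ^ 4 * (delta * Rpower delta al)) with (32 * c ^ 4 * (delta * (8 * Rpower delta al))) by ring.
  apply Rmult_le_compat_l; [lra|]. apply Rmult_le_compat; auto.
  - apply Rmult_le_pos; lra.
  - apply Rmult_le_pos; lra.
Qed.

(** When [s] is not small against [R0], the index [g1] alone makes [delta] at least of order
    [1 / R0], which covers all radii above [R0 / 8]. If the radius at [v] is smaller, then, the
    radius at [z] being at least [R0 / 2], the points [v] and [z] are more than one radius apart and
    [tail_mass_bound] applies. *)
Lemma close_estimate g0 z : inI g0 -> hits g0 x -> hits g0 y -> z = x \/ z = y ->
  Rabs (delta' - rate z * delta) <= 1024 * c ^ 4 * (delta * Rpower delta al).
Proof.
  intros Hg0 H0x H0y Hz. pose proof delta_pos as Hd. pose proof (Rpower_pos delta al) as Hdp.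
  assert (Hzxy : x <= z <= y) by (destruct Hz; lra).
  assert (H0z : hits g0 z) by (destruct Hz; subst; auto).
  destruct (almost_min (fun g => inI g /\ hits g z) (fun g => rad (scale g) (coord g z))) as [g1 [[Hg1 H1z] Hmin]].
  { eauto. }
  { intros g _. apply rad_ge_1. }
  set (R0 := rad (scale g1) (coord g1 z)) in *. set (s := coord g0 y - coord g0 x).
  pose proof (rad_ge_1 g1 (coord g1 z)) as HR0. fold R0 in HR0.
  destruct (Rlt_le_dec s (R0 / (16 * c))) as [Hs|Hs].
  { apply Rle_trans with (256 * c ^ 4 * (delta * Rpower delta al)).
    - apply (far_estimate g0 g1 z s R0); auto.
    - apply Rmult_le_compat_r; [nra|]. pose proof (pow_le c 4). lra. }
  set (m := / (16 * c)). assert (Hm : 0 < m <= / 16).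
  { unfold m. split; [apply Rinv_0_lt_compat; lra|]. apply Rinv_le_contravar; lra. }
  assert (Hsm : m * R0 <= s) by (unfold m, Rdiv in *; lra).
  assert (Htr : forall g w, inI g -> x <= w <= y -> hits g w -> forall w', x <= w' <= y -> hits g w' /\ 
    coord g w' - coord g x = coord g0 w' - coord g0 x).
  { intros g w Hg Hw Hh. now apply (same_interval g0 g w). }
  assert (Hmass1 : m / (4 * R0) <= delta).
  { apply Rle_trans with (2 := delta_ge g1 Hg1).
    pose proof (Htr g1 z Hg1 Hzxy H1z) as H1.
    destruct (H1 x) as [X1 X2]; [lra|]. destruct (H1 y) as [Y1 Y2]; [lra|].
    pose proof (good_ne g1 Hg1) as G1.
    assert (Hs0 : 0 < scale g1) by (pose proof (scale_ge_1 g1); lra).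
    pose proof (ig_incr _ HG _ (proj2 Hg1) x y Hxy) as Hlt.
    unfold mass. unfold s in Hsm. unfold R0, coord in *. destruct Hz as [-> | ->].
    - apply Th_mass_right; auto; lra.
    - apply Th_mass_left; auto; lra. }
  (* The product of [m / 4] from [Hmass1] and the factor [1 / 8] allowed between the radius and
     [R0]. *)
  set (kap := m / 32). 
  replace (1024 * c ^ 4) with (2 * c ^ 3 * / kap) by (unfold kap, m; field; lra).
  apply near_estimate; auto; [unfold kap; lra|].
  intros g v Hg Hv Hxv. set (r := rad (scale g) (p (fst g) v)). assert (Hr : 1 <= r) by apply rad_ge_1.
  assert (Hri : 0 < / r) by (apply Rinv_0_lt_compat; lra).
  destruct (Rle_lt_dec (R0 / 8) r) as [Hr8|Hr8].
  - apply Rle_trans with (2 := Hmass1). apply Rmult_le_reg_r with (4 * R0 * r); [nra|].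
    unfold kap. replace (m / 32 / r * (4 * R0 * r)) with (m * (R0 / 8)) by (field; lra).
    replace (m / (4 * R0) * (4 * R0 * r)) with (m * r) by (field; lra). apply Rmult_le_compat_l; lra.
  - apply Rle_trans with (/ 4 / r); [apply Rmult_le_compat_r; unfold kap; lra|].
    destruct (ig_inv _ HG _ (proj2 Hg)) as [e [He [E1 E2]]]. pose proof (ig_incr _ HG _ He) as Ie.
    assert (Hw : x <= e v <= y).
    { rewrite <- (E1 x) at 1. rewrite <- (E1 y). split; apply incr_le; auto; lra. }
    assert (Hhw : hits g (e v)) by (unfold hits; now rewrite E2).
    pose proof (Htr g (e v) Hg Hw Hhw) as H1. destruct (H1 z Hzxy) as [Hhz _].
    pose proof (Hmin g (conj Hg Hhz)) as Hmg.
    destruct (H1 x) as [X1 X2]; [lra|]. destruct (H1 y) as [Y1 Y2]; [lra|].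
    assert (Hlip : rad (scale g) (coord g z) <= r + Rabs (coord g z - p (fst g) v)).
    { apply rad_lip. pose proof (scale_ge_1 g). lra. }
    assert (Hcv : coord g (e v) = p (fst g) v) by (unfold coord; now rewrite E2).
    apply tail_mass_bound; auto. fold r. change (p (fst g) (snd g y)) with (coord g y).
    change (p (fst g) (snd g x)) with (coord g x). rewrite <- Hcv in *.
    assert (Hcx : coord g x <= coord g (e v) <= coord g y).
    { split.
      - destruct (proj1 Hw) as [H|H]; [left; now apply coord_incr|rewrite <- H; lra].
      - destruct (proj2 Hw) as [H|H]; [left; now apply coord_incr|rewrite H; lra]. }
    destruct Hz as [-> | ->].
    + right. intros _. rewrite Rabs_left1 in Hlip by lra. lra.
    + left. intros _. rewrite Rabs_right in Hlip by lra. lra.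
Qed.

Lemma pair_estimate z : z = x \/ z = y ->
  Rabs (delta' - rate z * delta) <= 1024 * c ^ 4 * (delta * Rpower delta al).
Proof.
  intros Hz. destruct (classic (exists g, inI g /\ hits g x /\ hits g y)) as [(g & Hg & Hx & Hy)|Hsep].
  - now apply (close_estimate g).
  - apply Rle_trans with (1 := separated_estimate z Hz Hsep).
    pose proof delta_pos. pose proof (Rpower_pos delta al). apply Rmult_le_compat_r; [nra|].
    assert (1 <= c ^ 3) by (apply pow_R1_Rle; auto). simpl in *. nra.
Qed.

End Pair.
End Conjugate.
End Measure.

(** * The smoothing homeomorphism *)

Lemma fsum_perm {X : Type} (f : X -> R) l l' : Permutation l l' -> fsum f l = fsum f l'.
Proof. induction 1; simpl; lra. Qed.

Lemma max_list {X : Type} (P : list X -> Prop) M : P nil -> (forall l, P l -> (length l <= M)%nat) ->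
  exists l, P l /\ forall l', P l' -> (length l' <= length l)%nat.
Proof.
  intros H0 HM. assert (Hex : forall k, (k <= M)%nat -> (exists l, P l /\ (M - k <= length l)%nat) -> 
    exists l, P l /\ forall l', P l' -> (length l' <= length l)%nat).
  { induction k as [|k IH]; intros Hk [l [Hl1 Hl2]].
    - exists l. split; auto. intros l' Hl'. pose proof (HM l' Hl'). lia.
    - destruct (classic (exists l', P l' /\ (M - k <= length l')%nat)) as [H|H].
      + apply IH; auto. lia.
      + exists l. split; auto. intros l' Hl'. apply Nat.nlt_ge. intros Hlt. apply H. exists l'. split; auto. lia. }
  apply (Hex M); auto. exists nil. split; auto. simpl. lia.
Qed.

(** * Growth of degree zero *)

Section Finite.
Variables (Gam : (R -> R) -> Prop) (L : (R -> R) -> nat) (Cst : nat).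
Hypothesis HL : lgroup Gam L Cst 0.
Let HG := lg_ig _ _ _ _ HL.

Lemma int_translation m : Gam (fun x => x + IZR m).
Proof.
  destruct (Z.le_gt_cases 0 m) as [H|H].
  - rewrite <- (Z2Nat.id m) by auto. rewrite <- INR_IZR_INZ.
    pose proof (it_in Gam (Z.to_nat m) shift HG (lg_shift _ _ _ _ HL)) as Hs.
    replace (fun x => x + INR (Z.to_nat m)) with (it (Z.to_nat m) shift); auto.
    apply functional_extensionality; intros x. induction (Z.to_nat m) as [|k IH]; [simpl; lra|].
    rewrite S_INR. simpl. rewrite IH; [unfold shift; lra|]. apply it_in; auto. apply (lg_shift _ _ _ _ HL).
  - destruct (shift_back Gam L Cst 0 HL (Z.to_nat (- m))) as [g [Hg E]].
    replace (fun x => x + IZR m) with g; auto. apply functional_extensionality; intros x.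
    rewrite E, INR_IZR_INZ, Z2Nat.id, opp_IZR by lia. lra.
Qed.

(** Modulo integer translations the group is finite, and [p] is the sum of one representative of
    each class. An element [h] permutes the classes, so [p (h x)] and [p x] differ by a sum of
    integers. The resulting translations are smooth for every exponent. *)
Lemma finite_translations : exists p, incr p /\ nearby p /\
  forall h, Gam h -> exists c, forall x, p (h x) = p x + c.
Proof.
  set (P := fun l : list (R -> R) => NoDup l /\ forall F, In F l -> Gam F /\ 0 <= F 0 < 1).
  (* For degree zero the growth bound does not depend on the radius, so at most [Cst] elements have
     their value at [0] in [[0, 1)]. *)
  destruct (max_list P Cst) as [l [[Hnd Hl] Hmax]].
  { split; [constructor|intros F []]. }
  { intros l [Hnd Hl].
    assert (Hn : exists n, (1 <= n)%nat /\ forall F, In F l -> (L F <= n)%nat).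
    { clear. induction l as [|F l [n [H1 Hn]]].
      - exists 1%nat. split; auto. intros F [].
      - exists (n + L F)%nat. split; [lia|]. intros F' [<-|HF]; [lia|]. pose proof (Hn F' HF). lia. }
    destruct Hn as [n [Hn1 Hn]].
    rewrite <- (Nat.mul_1_r Cst). rewrite <- (Nat.pow_0_r n).
    apply (lg_growth _ _ _ _ HL n 0 0); auto. intros F HF. destruct (Hl F HF). rewrite Rplus_0_l. auto. }
  assert (Hall : forall F, Gam F -> 0 <= F 0 < 1 -> In F l).
  { intros F HF H0. apply NNPP; intros Hn.
    assert (length (F :: l) <= length l)%nat; [|simpl in *; lia]. apply Hmax. split; [now constructor|].
    intros F' [<-|HF']; auto. }
  assert (Hid : In (fun x => x) l) by (apply Hall; [apply (ig_id _ HG)|lra]).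
  set (p := fun x => fsum (fun F : R -> R => F x) l). exists p.
  assert (Hle : forall l' x y, (forall F, In F l' -> Gam F) -> x <= y -> 
    fsum (fun F : R -> R => F x) l' <= fsum (fun F : R -> R => F y) l').
  { intros l' x y Hl' Hxy. apply fsum_le. intros F HF. apply incr_le; auto. now apply (ig_incr _ HG), Hl'. }
  split; [|split].
  - intros x y Hxy. unfold p. apply in_split in Hid as (l1 & l2 & El).
    assert (Hin : forall F, In F l1 \/ In F l2 -> Gam F).
    { intros F HF. apply Hl. rewrite El. apply in_app_iff. simpl. tauto. }
    rewrite El, !fsum_app. simpl.
    pose proof (Hle l1 x y (fun F HF => Hin F (or_introl HF))). pose proof (Hle l2 x y (fun F HF => Hin F (or_intror HF))). lra.
  - assert (Hr : forall l', (forall F, In F l' -> Gam F) -> forall x eps, 0 < eps ->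
      (exists y, x < y /\ fsum (fun F : R -> R => F y) l' < fsum (fun F : R -> R => F x) l' + eps) /\
      (exists y, y < x /\ fsum (fun F : R -> R => F x) l' - eps < fsum (fun F : R -> R => F y) l')).
    { induction l' as [|F l' IH]; intros Hl' x eps Heps.
      - simpl. split; [exists (x + 1)|exists (x - 1)]; lra.
      - destruct (IH (fun F HF => Hl' F (or_intror HF)) x (eps / 2)) as [[y1 [Y1 Y2]] [z1 [Z1 Z2]]]; [lra|].
        assert (HF : Gam F) by (apply Hl'; now left). pose proof (ig_incr _ HG F HF) as IF.
        destruct (ig_inv _ HG F HF) as [g [Hg [I1 I2]]]. pose proof (ig_incr _ HG g Hg) as Ig.
        assert (Hl'' : forall F, In F l' -> Gam F) by (intros; apply Hl'; now right).
        split.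
        + exists (Rmin y1 (g (F x + eps / 2))). pose proof (Rmin_l y1 (g (F x + eps / 2))) as R1.
          pose proof (Rmin_r y1 (g (F x + eps / 2))) as R2. split.
          * apply Rmin_glb_lt; auto. rewrite <- (I1 x) at 1. apply Ig. lra.
          * simpl. pose proof (Hle l' _ _ Hl'' R1). apply (incr_le F) in R2; auto. rewrite I2 in R2. lra.
        + exists (Rmax z1 (g (F x - eps / 2))). pose proof (Rmax_l z1 (g (F x - eps / 2))) as R1.
          pose proof (Rmax_r z1 (g (F x - eps / 2))) as R2. split.
          * apply Rmax_lub_lt; auto. rewrite <- (I1 x) at 2. apply Ig. lra.
          * simpl. pose proof (Hle l' _ _ Hl'' R1). apply (incr_le F) in R2; auto. rewrite I2 in R2. lra. }
    intros x eps. apply Hr. apply Hl.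
  - intros h Hh. destruct (ig_inv _ HG h Hh) as [g [Hg [I1 I2]]].
    set (m := fun F : R -> R => Int_part (F (h 0))).
    set (nrm := fun (F : R -> R) x => F (h x) + IZR (- m F)).
    assert (Hm : forall F, 0 <= nrm F 0 < 1).
    { intros F. unfold nrm, m. rewrite opp_IZR. pose proof (base_Int_part (F (h 0))). lra. }
    assert (Hperm : Permutation (map nrm l) l).
    { apply NoDup_Permutation_bis.
      - apply NoDup_map_NoDup_ForallPairs; auto. intros F F' HF HF' E.
        assert (E2 : forall x, F x + IZR (- m F) = F' x + IZR (- m F')).
        { intros x. rewrite <- (I2 x). exact (f_equal (fun k => k (g x)) E). }
        destruct (Hl F HF) as [_ B1]. destruct (Hl F' HF') as [_ B2].
        pose proof (E2 0) as E0. rewrite !opp_IZR in E0.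
        assert (m F = m F').
        { assert (IZR (m F - m F') < 1 /\ -1 < IZR (m F - m F')) as [J1 J2] by (rewrite minus_IZR; lra).
          apply lt_IZR in J1, J2. lia. }
        apply functional_extensionality; intros x. pose proof (E2 x) as Ex. rewrite H in Ex. lra.
      - rewrite length_map. auto.
      - intros F HF. apply in_map_iff in HF as (F' & <- & HF'). apply Hall; auto.
        apply (ig_comp _ HG (fun x => x + IZR (- m F')) (fun x => F' (h x))); [apply int_translation|].
        apply (ig_comp _ HG F' h); auto. now apply Hl. }
    exists (fsum (fun F => IZR (m F)) l). intros x. unfold p.
    rewrite <- (fsum_perm _ _ _ Hperm) at 1.
    rewrite <- (fsum_perm (fun F : R -> R => F x) _ _ Hperm). 
    assert (Hgen : forall l', fsum (fun F : R -> R => F (h x)) l' = 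
       fsum (fun F => F x) (map nrm l') + fsum (fun F => IZR (m F)) l').
    { induction l' as [|F l' IH]; simpl; [lra|]. rewrite IH. unfold nrm at 2. rewrite opp_IZR. lra. }
    rewrite (fsum_perm _ _ _ Hperm). apply Hgen.
Qed.

End Finite.

(* Applied at both [u] and [v], this estimate makes [D] the derivative of [G] and Hoelder at once. *)
Definition C1a (al : R) (G : R -> R) : Prop := exists (D : R -> R) (C : R), 0 <= C /\
  forall u v, Rabs (G v - G u - D u * (v - u)) <= C * (Rabs (v - u) * Rpower (Rabs (v - u)) al).

Lemma nearby_surj f : incr f -> nearby f -> (forall x, f (x + 1) = f x + 1) -> exists g, inv_of f g.
Proof.
  intros Hf Hn H1.
  assert (HN : forall n x, f (x + INR n) = f x + INR n /\ f (x - INR n) = f x - INR n).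
  { induction n as [|n IH]; intros x.
    - simpl. rewrite Rplus_0_r, !Rminus_0_r. lra.
    - rewrite S_INR. split.
      + rewrite <- Rplus_assoc, H1, (proj1 (IH x)). lra.
      + pose proof (H1 (x - (INR n + 1))) as E. replace (x - (INR n + 1) + 1) with (x - INR n) in E by lra.
        rewrite (proj2 (IH x)) in E. lra. }
  assert (Hs : forall y, exists x, f x = y).
  { intros y. destruct (INR_unbounded (Rabs (y - f 0))) as [n Hnn].
    destruct (HN n 0) as [E1 E2]. rewrite Rplus_0_l in E1.
    assert (Hb : f (0 - INR n) <= y < f (INR n)) by (unfold Rabs in Hnn; destruct (Rcase_abs (y - f 0)); lra).
    destruct (completeness (fun x => f x <= y)) as [x [X1 X2]].
    - exists (INR n). intros x Hx. apply Rnot_lt_le; intros Hlt. pose proof (Hf _ _ Hlt). lra.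
    - exists (0 - INR n). lra.
    - exists x. destruct (Rtotal_order (f x) y) as [Hlt|[E|Hgt]]; auto; exfalso.
      + destruct (Hn x (y - f x)) as [[z [Z1 Z2]] _]; [lra|]. assert (z <= x) by (apply X1; lra). lra.
      + destruct (Hn x (f x - y)) as [_ [z [Z1 Z2]]]; [lra|]. assert (x <= z); [|lra].
        apply X2. intros w Hw. apply Rnot_lt_le; intros Hlt. pose proof (Hf _ _ Hlt). lra. }
  exists (fun y => epsilon (inhabits 0) (fun x => f x = y)).
  assert (Hg : forall y, f (epsilon (inhabits 0) (fun x => f x = y)) = y) by (intros y; apply epsilon_spec, Hs).
  split; auto. intros x. apply (incr_inj f); auto.
Qed.

(** * The normalized conjugating map *)

Section Smoothing.
Variables (Gam : (R -> R) -> Prop) (L : (R -> R) -> nat) (Cst d : nat) (al : R).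
Hypothesis HL : lgroup Gam L Cst d.
Hypothesis Hal : 0 < al.
Hypothesis Hald : al * INR d < 1.
Let HG := lg_ig _ _ _ _ HL.

Definition translates (p : R -> R) : Prop := forall F, Gam F -> exists c, forall x, p (F x) = p x + c.

Definition two_point (p : R -> R) : Prop := forall F, Gam F -> exists D C, 0 <= C /\
  forall x y z, x < y -> z = x \/ z = y ->
    Rabs (p (F y) - p (F x) - D z * (p y - p x)) <= C * ((p y - p x) * Rpower (p y - p x) al).

(** The measure is used only for [d >= 1], where [al * d < 1] forces [al < 1]; the second
    alternative records this for the line. For [d = 0] the first alternative holds, with [al]
    arbitrary. *)
Lemma chart_exists : exists p, incr p /\ nearby p /\ (forall x, p (x + 1) - p 1 = p x - p 0) /\
  (translates p \/ (al < 1 /\ two_point p)).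
Proof.
  assert (Htr : forall p, incr p -> nearby p -> translates p -> exists p, incr p /\ nearby p /\ 
    (forall x, p (x + 1) - p 1 = p x - p 0) /\ (translates p \/ (al < 1 /\ two_point p))).
  { intros p H1 H2 H3. exists p. repeat (split; auto).
    intros x. destruct (H3 shift (lg_shift _ _ _ _ HL)) as [c Hc]. unfold shift in Hc.
    rewrite Hc. pose proof (Hc 0) as E. rewrite Rplus_0_l in E. lra. }
  destruct (Nat.eq_0_gt_0_cases d) as [Hd|Hd].
  - assert (HL0 : lgroup Gam L Cst 0) by (rewrite <- Hd; exact HL).
    destruct (finite_translations Gam L Cst HL0) as (p & H1 & H2 & H3). eauto.
  - assert (Hal1 : al < 1).
    { apply le_INR in Hd. simpl in Hd. nra. }
    destruct (family_exists Gam L Cst d HL) as [[p [H1 [H2 H3]]]|(V & a & b & p & Hgood & Hdisj & Hdense)].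
    + apply (Htr p); auto. intros x eps Heps. split.
      * destruct (H2 (p x + eps / 2)) as [y Hy]. exists y. split; [apply (incr_lt_inv p); auto|]; lra.
      * destruct (H2 (p x - eps / 2)) as [y Hy]. exists y. split; [apply (incr_lt_inv p); auto|]; lra.
    + assert (HN : forall i : nat, exists N, (1 <= N)%nat /\ forall k z x l, in_window Gam k z x l ->
        fsum (fun H => / weight L al N H) l <= INR k * (/ 2) ^ i).
      { intros i. apply (weights_small Gam L Cst d al HL Hal Hald). apply pow_lt. lra. }
      set (N := fun i => proj1_sig (constructive_indefinite_description _ (HN i))).
      assert (HN1 : forall i, (1 <= N i)%nat) by (intros i; apply (proj2_sig (constructive_indefinite_description _ (HN i)))).
      assert (HN2 : forall i k z x l, in_window Gam k z x l ->
        fsum (fun H => / weight L al (N i) H) l <= INR k * (/ 2) ^ i) by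
        (intros i; apply (proj2_sig (constructive_indefinite_description _ (HN i)))).
      assert (Hal' : 0 < al <= 1) by lra.
      exists (psi Gam L al V a b p N). split; [|split; [|split; [|right; split; auto]]].
      * now apply (psi_incr Gam L Cst d al HL Hal' V a b p Hgood).
      * now apply (psi_nearby Gam L Cst d al HL Hal' V a b p Hgood).
      * now apply (psi_shift Gam L Cst d al HL Hal' V a b p Hgood).
      * intros F HF. destruct (ig_inv _ HG F HF) as [Fi [HFi HI]].
        destruct (twist_comparable Gam L Cst d al HL Hal' V N HN1 F Fi HF HFi HI) as [c Hc].
        assert (Hc' : forall g, inI Gam V g -> comparable al (Rmax c 1) (scale L al N g) (scale L al N (twist Fi g))).
        { intros g Hg. pose proof (cp_c _ _ _ _ (Hc g Hg)). rewrite Rmax_left by auto. auto. }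
        pose proof (Rmax_r c 1) as Hc1.
        exists (rate Gam L al V a b p N Fi), (1024 * Rmax c 1 ^ 4). split.
        { pose proof (pow_le (Rmax c 1) 4). lra. }
        intros x y z Hxy Hz.
        now apply (pair_estimate Gam L Cst d al HL Hal' V a b p Hgood Hdisj Hdense N HN1 HN2 F Fi).
Qed.

Theorem smoothing_homeo : exists phi phii, incr phi /\ inv_of phi phii /\ phi 0 = 0 /\
  (forall x, phi (x + 1) = phi x + 1) /\
  (translates phi \/ (al < 1 /\ forall F, Gam F -> C1a al (fun u => phi (F (phii u))))).
Proof.
  destruct chart_exists as (p & Hinc & Hn & Hsh & Hor).
  set (c := p 1 - p 0). assert (Hc : 0 < c) by (unfold c; pose proof (Hinc 0 1); lra).
  set (phi := fun x => (p x - p 0) / c).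
  assert (Hd : forall x y, p y - p x = c * (phi y - phi x)) by (intros; unfold phi; field; lra).
  assert (Hphi : incr phi).
  { intros x y Hxy. pose proof (Hinc x y Hxy). pose proof (Hd x y). nra. }
  assert (Hnp : nearby phi).
  { intros x eps Heps. assert (0 < c * eps) by now apply Rmult_lt_0_compat.
    destruct (Hn x (c * eps) H) as [[y [Y1 Y2]] [z [Z1 Z2]]].
    split; [exists y|exists z]; split; auto; [pose proof (Hd x y)|pose proof (Hd z x)]; nra. }
  assert (Hsp : forall x, phi (x + 1) = phi x + 1).
  { intros x. pose proof (Hsh x). apply Rmult_eq_reg_l with c; [|lra].
    pose proof (Hd x (x + 1)). unfold c in *. nra. }
  destruct (nearby_surj phi Hphi Hnp Hsp) as [phii HI].
  exists phi, phii. split; auto. split; auto. split; [unfold phi; field; lra|]. split; auto.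
  destruct Hor as [Htr|[Hal1 Htp]]; [left|right; split; auto].
  - intros F HF. destruct (Htr F HF) as [t Ht]. exists (t / c). intros x. unfold phi. rewrite Ht. field. lra.
  - intros F HF. destruct (Htp F HF) as (D & C & HC & HD).
    exists (fun u => D (phii u)), (C * Rpower c al). split.
    { pose proof (Rpower_pos c al). nra. }
    assert (Hlt : forall x y z, x < y -> z = x \/ z = y ->
      Rabs (phi (F y) - phi (F x) - D z * (phi y - phi x)) <= C * Rpower c al * ((phi y - phi x) * Rpower (phi y - phi x) al)).
    { intros x y z Hxy Hz. pose proof (HD x y z Hxy Hz) as H. rewrite !Hd in H.
      pose proof (Hphi x y Hxy). rewrite <- Rpower_mult_distr in H by lra.
      replace (c * (phi (F y) - phi (F x)) - D z * (c * (phi y - phi x)))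
        with (c * (phi (F y) - phi (F x) - D z * (phi y - phi x))) in H by ring.
      rewrite Rabs_mult, (Rabs_right c) in H by lra.
      apply Rmult_le_reg_l with c; auto. lra. }
    (* Only the occurrences outside [phii] are expanded, so that everything is expressed through
       [x = phii u] and [y = phii v]. *)
    intros u v. rewrite <- (proj2 HI u) at 3 4 5.
    rewrite <- (proj2 HI v) at 2 3 4.
    set (x := phii u). set (y := phii v).
    destruct (Rtotal_order x y) as [Hxy|[E|Hxy]].
    + rewrite (Rabs_right (phi y - phi x)); [apply Hlt; auto|]. pose proof (Hphi x y Hxy). lra.
    + rewrite E, !Rminus_diag, Rmult_0_r, Rminus_diag, Rabs_R0. lra.
    + rewrite (Rabs_left (phi y - phi x)) by (pose proof (Hphi y x Hxy); lra).
      replace (phi (F y) - phi (F x) - D x * (phi y - phi x)) with (- (phi (F x) - phi (F y) - D x * (phi x - phi y))) by ring.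
      rewrite Rabs_Ropp. replace (- (phi y - phi x)) with (phi x - phi y) by ring. apply Hlt; auto.
Qed.

End Smoothing.

(** * Lifts *)

Lemma val_inj {m} (x y : pt m) : val x = val y -> x = y.
Proof. destruct x as [x Hx], y as [y Hy]. unfold val; simpl. intros <-. f_equal. apply proof_irrelevance. Qed.

Lemma eval_app {m} (w1 w2 : list (Mmap m)) : eval_word (w1 ++ w2) = mcomp (eval_word w1) (eval_word w2).
Proof. induction w1 as [|s w1 IH]; simpl; auto. unfold eval_word in *. now rewrite IH. Qed.

Lemma inverse_maps_comp {m} (f fi g gi : Mmap m) :
  inverse_maps f fi -> inverse_maps g gi -> inverse_maps (mcomp f g) (mcomp gi fi).
Proof.
  intros [F1 F2] [G1 G2].
  pose proof (fun x => equal_f F1 x) as F1'. pose proof (fun x => equal_f F2 x) as F2'.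
  pose proof (fun x => equal_f G1 x) as G1'. pose proof (fun x => equal_f G2 x) as G2'.
  unfold mcomp, idm in *.
  split; apply functional_extensionality; intros x; unfold mcomp, idm.
  - now rewrite F1', G1'.
  - now rewrite G2', F2'.
Qed.

Lemma inverse_maps_sym {m} (f g : Mmap m) : inverse_maps f g -> inverse_maps g f.
Proof. intros [H1 H2]; split; auto. Qed.

Section Balls.
Context {m : oneManifold}.
Variable S : list (Mmap m).

Lemma ball_app n k g h : in_ball S n g -> in_ball S k h -> in_ball S (n + k) (mcomp g h).
Proof.
  intros (w1 & A1 & A2 & ->) (w2 & B1 & B2 & ->). exists (w1 ++ w2). split; [|split].
  - intros s Hs. apply in_app_iff in Hs as [|]; auto.
  - rewrite length_app. lia.
  - now rewrite eval_app.
Qed.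

Lemma ball_weaken n k g : (n <= k)%nat -> in_ball S n g -> in_ball S k g.
Proof. intros H (w & A1 & A2 & A3). exists w. repeat split; auto. lia. Qed.

Lemma ball_inverse n g : symmetric_set S -> in_ball S n g -> exists gi, in_ball S n gi /\ inverse_maps g gi.
Proof.
  intros Hsym (w & A1 & A2 & ->). revert n A2. induction w as [|s w IH]; intros n A2.
  - exists idm. split; [exists nil; split; [intros s []|split; [simpl; lia|reflexivity]]|]. split; reflexivity.
  - destruct n as [|n]; simpl in A2; [lia|].
    destruct (IH (fun s Hs => A1 s (or_intror Hs)) n) as (gi & Bg & Ig); [lia|].
    destruct (Hsym s (A1 s (or_introl eq_refl))) as (t & Ht & It).
    exists (mcomp gi t). split.
    + replace (Datatypes.S n) with (n + 1)%nat by lia. apply ball_app; auto.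
      exists (t :: nil). split; [intros u [<-|[]]; auto|split; [simpl; lia|reflexivity]].
    + now apply inverse_maps_comp.
Qed.

Lemma ball_finite n : exists l, forall g, in_ball S n g -> In g l.
Proof.
  induction n as [|n [l Hl]].
  - exists (idm :: nil). intros g (w & _ & A2 & ->). destruct w; simpl in *; [auto|lia].
  - exists (idm :: flat_map (fun s => map (mcomp s) l) S). intros g (w & A1 & A2 & ->).
    destruct w as [|s w]; [now left|]. right. apply in_flat_map. exists s. split; [apply A1; now left|].
    change (eval_word (s :: w)) with (mcomp s (eval_word w)). apply in_map, Hl. exists w. split; [intros u Hu; apply A1; now right|split; auto]. simpl in A2. lia.
Qed.

Lemma ball_card n : exists k, has_card (in_ball S n) k.
Proof.
  destruct (ball_finite n) as [l Hl].
  set (l' := nodup (fun f g => excluded_middle_informative (f = g)) (filter (fun g => btest (in_ball S n g)) l)).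
  exists (length l'), l'. split; [apply NoDup_nodup|split; auto].
  intros g. unfold l'. rewrite nodup_In, filter_In, btest_true. split; [tauto|]. intros Hg. split; auto.
Qed.

End Balls.

Lemma ball_in_group {m} (G : Mmap m -> Prop) S n g : generates S G -> in_ball S n g -> G g.
Proof. intros [_ H] (w & A1 & _ & A3). apply H. eauto. Qed.

Lemma group_in_ball {m} (G : Mmap m -> Prop) S g : generates S G -> G g -> exists n, in_ball S n g.
Proof. intros [_ H] Hg. apply H in Hg as (w & A1 & A2). exists (length w), w. auto. Qed.

Definition degree_one (F : R -> R) : Prop := incr F /\ forall x, F (x + 1) = F x + 1.

Lemma degree_one_Z F k x : degree_one F -> F (x + IZR k) = F x + IZR k.
Proof.
  intros [_ H]. revert k. apply Z.peano_ind.
  - now rewrite !Rplus_0_r.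
  - intros k IH. unfold Z.succ. rewrite plus_IZR, <- !Rplus_assoc, H, IH. reflexivity.
  - intros k IH. unfold Z.pred. rewrite plus_IZR. pose proof (H (x + (IZR k + -1))) as E.
    replace (x + (IZR k + -1) + 1) with (x + IZR k) in E by lra. lra.
Qed.

Lemma degree_one_comp F H : degree_one F -> degree_one H -> degree_one (fun x => F (H x)).
Proof.
  intros [F1 F2] [H1 H2]. split.
  - intros x y Hxy. apply F1, H1, Hxy.
  - intros x. now rewrite H2, F2.
Qed.

Lemma degree_one_trans k : degree_one (fun x => x + IZR k).
Proof. split; [intros x y Hxy|intros x]; lra. Qed.

Section Lifting.
Variables (m : oneManifold) (G : Mmap m -> Prop) (S : list (Mmap m)) (d : nat).
(** [rel g F] stands for [F] being a lift of [g]; it is abstract because the circle and the glued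
    intervals use different relations. *)
Variable rel : Mmap m -> (R -> R) -> Prop.
Hypothesis HGsub : is_subgroup m G.
Hypothesis HSsym : symmetric_set S.
Hypothesis HSgen : generates S G.
Hypothesis Hgrow : poly_growth S d.
Hypothesis rel_id : forall k, rel idm (fun x => x + IZR k).
Hypothesis rel_comp : forall g h F H, degree_one F -> degree_one H -> rel g F -> rel h H ->
  rel (mcomp g h) (fun x => F (H x)).
Hypothesis rel_ex : forall g, G g -> exists F, degree_one F /\ rel g F.
Hypothesis rel_id_inv : forall F, degree_one F -> rel idm F -> exists k, forall x, F x = x + IZR k.

Definition lifts (F : R -> R) : Prop := degree_one F /\ exists g, G g /\ rel g F.

(** A lift of [gi] inverts [F] up to an integer on either side. The two integers agree, so one
    correction gives a two-sided inverse. *)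
Lemma rel_inverse g gi F : G gi -> inverse_maps g gi -> degree_one F -> rel g F ->
  exists H, degree_one H /\ rel gi H /\ inv_of F H.
Proof.
  intros Hgi [I1 I2] HF Hrel. destruct (rel_ex gi Hgi) as [H [HH Hrel']].
  destruct (rel_id_inv (fun x => H (F x))) as [k Hk].
  { now apply degree_one_comp. }
  { rewrite <- I1. now apply rel_comp. }
  destruct (rel_id_inv (fun x => F (H x))) as [k' Hk'].
  { now apply degree_one_comp. }
  { rewrite <- I2. now apply rel_comp. }
  assert (E : IZR k = IZR k').
  { pose proof (Hk (H 0)) as E. rewrite Hk' in E. rewrite (degree_one_Z H) in E by auto. lra. }
  exists (fun x => H x + IZR (- k)). split; [|split].
  - apply (degree_one_comp (fun x => x + IZR (- k)) H); auto. apply degree_one_trans.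
  - apply (rel_comp idm gi (fun x => x + IZR (- k)) H); auto. apply degree_one_trans.
  - split; intros x.
    + rewrite Hk, opp_IZR. lra.
    + rewrite (degree_one_Z F), Hk', opp_IZR by auto. lra.
Qed.

Lemma inv_of_unique F H H' : inv_of F H -> inv_of F H' -> H = H'.
Proof.
  intros [A1 A2] [B1 B2]. apply functional_extensionality; intros x. rewrite <- (B2 x) at 1. apply A1.
Qed.

Lemma rel_unique g F F' : G g -> degree_one F -> degree_one F' -> rel g F -> rel g F' ->
  exists k, forall x, F' x = F x + IZR k.
Proof.
  intros Hg HF HF' Hr Hr'. destruct HGsub as (_ & _ & Hinv). destruct (Hinv g Hg) as [gi [Hgi HI]].
  destruct (rel_inverse g gi F) as (H & H1 & H2 & H3); auto.
  destruct (rel_id_inv (fun x => F' (H x))) as [k Hk].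
  { now apply degree_one_comp. }
  { rewrite <- (proj2 HI). now apply rel_comp. }
  exists k. intros x. rewrite <- Hk. now rewrite (proj1 H3).
Qed.

Definition at_most (F : R -> R) (n : nat) : Prop := exists g, in_ball S n g /\ rel g F.

(** The least word length of an element below [F]; integer translations have length zero, as
    [lgroup] demands. *)
Definition len (F : R -> R) : nat :=
  epsilon (inhabits O) (fun n => at_most F n /\ forall k, at_most F k -> (n <= k)%nat).

Lemma len_spec F : lifts F -> at_most F (len F) /\ forall k, at_most F k -> (len F <= k)%nat.
Proof.
  intros (_ & g & Hg & Hr). unfold len. apply epsilon_spec.
  destruct (group_in_ball G S g HSgen Hg) as [n Hn].
  destruct (Wf_nat.dec_inh_nat_subset_has_unique_least_element (at_most F)) as [k [[K1 K2] _]].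
  - intros k. apply classic.
  - exists n, g. auto.
  - exists k. auto.
Qed.

Lemma len_inv F H : lifts F -> inv_of F H -> (len H <= len F)%nat /\ lifts H.
Proof.
  intros HF HI. destruct (len_spec F HF) as [(g & Bg & Hr) _].
  destruct (ball_inverse S _ g HSsym Bg) as (gi & Bgi & Igi).
  assert (Hgi : G gi) by now apply (ball_in_group G S (len F)).
  destruct (rel_inverse g gi F) as (H' & H1 & H2 & H3); auto; [apply HF|].
  replace H with H' by now apply (inv_of_unique F).
  assert (HL : lifts H') by (split; eauto). split; auto.
  apply (len_spec H' HL). now exists gi.
Qed.

Lemma lifts_lgroup : exists C, lgroup lifts len C d.
Proof.
  destruct Hgrow as (C & HC & Hcount). exists (C * C ^ d)%nat.
  pose proof HGsub as (Gid & Gcomp & Ginv).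
  assert (Hig : igroup lifts).
  { split.
    - split.
      + split; auto. intros x y; auto.
      + exists idm. split; auto. replace (fun x : R => x) with (fun x => x + IZR 0); auto.
        apply functional_extensionality; intros x; lra.
    - intros F H (HF & g & Hg & Hr) (HH & h & Hh & Hr'). split; [now apply degree_one_comp|].
      exists (mcomp g h). split; auto.
    - intros F HF. pose proof HF as (HF1 & g & Hg & Hr). destruct (Ginv g Hg) as [gi [Hgi HI]].
      destruct (rel_inverse g gi F) as (H & H1 & H2 & H3); auto. exists H. split; auto. split; eauto.
    - intros F HF. apply HF. }
  assert (Hshift : lifts shift).
  { split; [exact (degree_one_trans 1)|]. exists idm. split; auto. exact (rel_id 1). }
  split; auto.
  - intros F HF. apply HF.
  - intros F H HF HH. apply len_spec; [now apply (ig_comp _ Hig F)|].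
    destruct (len_spec F HF) as [(g & Bg & Hr) _]. destruct (len_spec H HH) as [(h & Bh & Hr') _].
    exists (mcomp g h). split; [now apply ball_app|]. apply rel_comp; auto; [apply HF|apply HH].
  - intros F H HF HI. destruct (len_inv F H HF HI) as [L1 L2].
    destruct (len_inv H F L2 (inv_of_sym _ _ HI)) as [L3 _]. lia.
  - destruct (len_spec shift Hshift) as [_ Hs].
    assert (len shift <= 0)%nat; [|lia]. apply Hs. exists idm. split; [|exact (rel_id 1)].
    exists nil. split; [intros s []|split; auto].
  - intros n z x l Hn Hnd Hl.
    destruct (ball_card S n) as [k Hk]. pose proof (proj1 (Hcount n k Hn) Hk) as Hkb.
    assert (Hlk : (length l <= k)%nat).
    (* Each [F] is assigned an element of the ball below it. Lifts of one element differ by an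
       integer, which the window of length 1 forces to be zero. *)
    { set (gf := fun F => epsilon (inhabits (@idm m)) (fun g => in_ball S n g /\ rel g F)).
      assert (Hgf : forall F, In F l -> in_ball S n (gf F) /\ rel (gf F) F).
      { intros F HF. destruct (Hl F HF) as (L1 & L2 & _). unfold gf. apply epsilon_spec.
        destruct (len_spec F L1) as [(g & Bg & Hr) _]. exists g. split; auto. now apply (ball_weaken S (len F)). }
      destruct Hk as (lk & Nk & <- & Hin). rewrite <- (length_map gf l). apply NoDup_incl_length.
      - apply NoDup_map_NoDup_ForallPairs; auto. intros F F' HF HF' E.
        destruct (Hgf F HF) as [B1 R1]. destruct (Hgf F' HF') as [B2 R2]. rewrite <- E in R2.
        destruct (Hl F HF) as (L1 & _ & W1). destruct (Hl F' HF') as (L2 & _ & W2).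
        destruct (rel_unique (gf F) F F') as [q Hq]; auto; try apply L1; try apply L2.
        { now apply (ball_in_group G S n). }
        assert (q = 0%Z).
        { rewrite Hq in W2. assert (IZR q < 1) as Q1 by lra. assert (-1 < IZR q) as Q2 by lra.
          apply lt_IZR in Q1, Q2. lia. }
        subst q. apply functional_extensionality; intros y. rewrite Hq. lra.
      - intros g Hg. apply in_map_iff in Hg as (F & <- & HF). apply Hin. now apply Hgf. }
    rewrite Nat.pow_mul_l in Hkb. nia.
Qed.

End Lifting.

Definition frac (x : R) : R := x - IZR (Int_part x).

Lemma frac_range x : 0 <= frac x < 1.
Proof. unfold frac. pose proof (base_Int_part x). lra. Qed.

Lemma Int_part_unique x k : IZR k <= x < IZR k + 1 -> Int_part x = k.
Proof.
  intros H. pose proof (base_Int_part x).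
  assert (IZR (Int_part x - k) < 1 /\ -1 < IZR (Int_part x - k)) as [J1 J2] by (rewrite minus_IZR; lra).
  apply lt_IZR in J1, J2. lia.
Qed.

Lemma lift_exists (e : R -> R) c : (forall s t, 0 <= s -> s < t -> t < 1 -> e s < e t) ->
  (forall t, 0 <= t < 1 -> c <= e t < c + 1) ->
  exists F, degree_one F /\ (forall t, 0 <= t < 1 -> F t = e t) /\ F 1 = e 0 + 1.
Proof.
  intros He Hc. exists (fun x => e (frac x) + IZR (Int_part x)).
  assert (Hi : forall x, IZR (Int_part x) <= x < IZR (Int_part x) + 1).
  { intros x. pose proof (base_Int_part x). lra. }
  assert (H1 : forall x, Int_part (x + 1) = (Int_part x + 1)%Z).
  { intros x. apply Int_part_unique. rewrite plus_IZR. pose proof (Hi x). lra. }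
  assert (H0 : forall t, 0 <= t < 1 -> Int_part t = 0%Z).
  { intros t Ht. apply Int_part_unique. lra. }
  split; [split|split].
  - intros x y Hxy. pose proof (Hi x). pose proof (Hi y). pose proof (frac_range x). pose proof (frac_range y).
    pose proof (Hc (frac x)). pose proof (Hc (frac y)).
    destruct (Z.lt_total (Int_part x) (Int_part y)) as [Hz|[Hz|Hz]].
    + assert (Int_part x + 1 <= Int_part y)%Z as J by lia. apply IZR_le in J. rewrite plus_IZR in J. lra.
    + rewrite Hz. apply Rplus_lt_compat_r. apply He; try lra. unfold frac. rewrite Hz. lra.
    + assert (Int_part y + 1 <= Int_part x)%Z as J by lia. apply IZR_le in J. rewrite plus_IZR in J. lra.
  - intros x. unfold frac. rewrite H1, plus_IZR. replace (x + 1 - (IZR (Int_part x) + 1)) with (x - IZR (Int_part x)) by lra. lra.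
  - intros t Ht. unfold frac. rewrite H0 by auto. rewrite Rminus_0_r. lra.
  - assert (E1 : Int_part 1 = 1%Z) by (apply Int_part_unique; lra).
    unfold frac. rewrite E1. replace (1 - 1) with 0 by lra. reflexivity.
Qed.

Lemma degree_one_const F k : degree_one F -> (forall t, 0 <= t < 1 -> F t = t + IZR k) ->
  forall x, F x = x + IZR k.
Proof.
  intros HF Ht x. pose proof (frac_range x) as Hx. unfold frac in Hx.
  replace x with (x - IZR (Int_part x) + IZR (Int_part x)) by lra.
  rewrite degree_one_Z, Ht by auto. lra.
Qed.

(** * Lifts of circle maps *)

Section Circle.

Definition circle_rel (g : Mmap Mcircle) (F : R -> R) : Prop :=
  forall x, exists k, F (val x) = val (g x) + IZR k.

Lemma circle_rel_id k : circle_rel idm (fun x => x + IZR k).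
Proof. intros x. now exists k. Qed.

Lemma circle_rel_comp g h F H : degree_one F -> degree_one H -> circle_rel g F -> circle_rel h H ->
  circle_rel (mcomp g h) (fun x => F (H x)).
Proof.
  intros HF HH Hg Hh x. destruct (Hh x) as [k Hk]. destruct (Hg (h x)) as [k' Hk'].
  exists (k' + k)%Z. rewrite Hk, degree_one_Z, Hk', plus_IZR by auto. unfold mcomp. lra.
Qed.

Definition cpt (t : R) (H : 0 <= t < 1) : pt Mcircle := exist _ t H.

Lemma circle_rel_ex g : Homeo_plus Mcircle g -> exists F, degree_one F /\ circle_rel g F.
Proof.
  intros [[gi [[I1 I2] _]] Hor]. simpl in Hor.
  assert (Hinj : forall x y, g x = g y -> x = y).
  { intros x y E. pose proof (equal_f I1 x) as E1. pose proof (equal_f I1 y) as E2.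
    unfold mcomp, idm in *. congruence. }
  assert (H0 : 0 <= 0 < 1) by lra. set (c := val (g (cpt 0 H0))).
  assert (Hc : 0 <= c < 1) by exact (proj2_sig (g (cpt 0 H0))).
  (* Values below [c], the image of the base point, are raised by one, which cuts the circle at [c]
     and makes [e] increasing. *)
  set (e := fun t => match excluded_middle_informative (0 <= t < 1) with
    | left H => let v := val (g (cpt t H)) in if Rle_dec c v then v else v + 1
    | right _ => 0 end).
  assert (Ee : forall t (H : 0 <= t < 1), e t = if Rle_dec c (val (g (cpt t H))) then val (g (cpt t H)) else val (g (cpt t H)) + 1).
  { intros t H. unfold e. destruct (excluded_middle_informative (0 <= t < 1)) as [H'|]; [|tauto].
    now rewrite (proof_irrelevance _ H' H). }
  assert (Hv : forall x, 0 <= val (g x) < 1) by (intros x; exact (proj2_sig (g x))).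
  assert (Hr : forall t, 0 <= t < 1 -> c <= e t < c + 1).
  { intros t Ht. rewrite (Ee t Ht). pose proof (Hv (cpt t Ht)). destruct (Rle_dec c (val (g (cpt t Ht)))); lra. }
  assert (Hne : forall t (Ht : 0 <= t < 1), t <> 0 -> val (g (cpt t Ht)) <> c).
  { intros t Ht Hn E. apply Hn. apply val_inj, Hinj in E. exact (f_equal val E). }
  destruct (lift_exists e c) as (F & HF & HFe & _); auto.
  - intros s t Hs Hst Ht. assert (Hs' : 0 <= s < 1) by lra. assert (Ht' : 0 <= t < 1) by lra.
    rewrite (Ee s Hs'), (Ee t Ht'). pose proof (Hne t Ht' ltac:(lra)) as Hnt.
    pose proof (Hv (cpt s Hs')). pose proof (Hv (cpt t Ht')).
    destruct Hs as [Hs|Hs].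
    + assert (Hcy : cyc c (val (g (cpt s Hs'))) (val (g (cpt t Ht')))).
      { apply Hor. left. simpl. unfold val; simpl. lra. }
      destruct (Rle_dec c (val (g (cpt s Hs')))), (Rle_dec c (val (g (cpt t Ht')))); destruct Hcy as [?|[?|?]]; lra.
    + subst s. replace (cpt 0 Hs') with (cpt 0 H0) by (apply val_inj; reflexivity).
      fold c. destruct (Rle_dec c c), (Rle_dec c (val (g (cpt t Ht')))); lra.
  - exists F. split; auto. intros x. assert (Ht : 0 <= val x < 1) by exact (proj2_sig x).
    assert (Ex : cpt (val x) Ht = x) by (apply val_inj; reflexivity).
    rewrite HFe, (Ee (val x) Ht), Ex by auto.
    destruct (Rle_dec c (val (g x))); [exists 0%Z|exists 1%Z]; lra.
Qed.

Lemma circle_rel_id_inv F : degree_one F -> circle_rel idm F -> exists k, forall x, F x = x + IZR k.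
Proof.
  intros HF Hr. assert (H0 : 0 <= 0 < 1) by lra. destruct (Hr (cpt 0 H0)) as [k Hk].
  exists k. apply degree_one_const; auto. intros t Ht.
  destruct (Hr (cpt t Ht)) as [k' Hk']. unfold val, cpt, idm in Hk, Hk'. simpl in Hk, Hk'.
  assert (k' = k); [|subst; auto].
  destruct Ht as [[Ht|<-] Ht1].
  - pose proof (proj1 HF 0 t Ht). pose proof (proj1 HF t (0 + 1) ltac:(lra)) as H2. rewrite (proj2 HF) in H2.
    assert (IZR (k' - k) < 1 /\ -1 < IZR (k' - k)) as [J1 J2] by (rewrite minus_IZR; lra).
    apply lt_IZR in J1, J2. lia.
  - apply eq_IZR. lra.
Qed.

End Circle.

(** * Intervals closed up to circles *)

Section Linear.
Variable m : oneManifold.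
Hypothesis Hm : m <> Mcircle.
(** The inclusion for bounded intervals and [theta_inv] for the line; the ends [0] and [1] may or
    may not be attained. *)
Variable emb : pt m -> R.
Hypothesis emb_range : forall x, 0 <= emb x <= 1.
Hypothesis emb_incr : forall x y, val x < val y <-> emb x < emb y.
Hypothesis emb_onto : forall t, 0 < t < 1 -> exists x, emb x = t.

(* The ends of the interval are glued at the integers, which [F] therefore permutes. *)
Definition linear_rel (g : Mmap m) (F : R -> R) : Prop :=
  exists k, F 0 = IZR k /\ forall x, F (emb x) = emb (g x) + IZR k.

Lemma linear_rel_id k : linear_rel idm (fun x => x + IZR k).
Proof. exists k. split; [lra|auto]. Qed.

Lemma linear_rel_comp g h F H : degree_one F -> degree_one H -> linear_rel g F -> linear_rel h H ->
  linear_rel (mcomp g h) (fun x => F (H x)).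
Proof.
  intros HF HH [k [K1 K2]] [k' [K3 K4]]. exists (k + k')%Z. rewrite plus_IZR. split.
  - rewrite K3. replace (IZR k') with (0 + IZR k') by lra. rewrite degree_one_Z by auto. lra.
  - intros x. rewrite K4, degree_one_Z, K2 by auto. unfold mcomp. lra.
Qed.

Lemma linear_rel_id_inv F : degree_one F -> linear_rel idm F -> exists k, forall x, F x = x + IZR k.
Proof.
  intros HF [k [K1 K2]]. exists k. apply degree_one_const; auto. intros t [[Ht|<-] Ht1]; [|lra].
  destruct (emb_onto t) as [x <-]; [lra|]. apply K2.
Qed.

Lemma emb_inj x y : emb x = emb y -> x = y.
Proof.
  intros E. apply val_inj. destruct (Rtotal_order (val x) (val y)) as [H|[H|H]]; auto;
  apply emb_incr in H; lra.
Qed.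

Lemma linear_orient g : Homeo_plus m g -> forall x y, emb x < emb y <-> emb (g x) < emb (g y).
Proof.
  intros [_ Hor].
  assert (Hor' : forall x y, val x < val y -> val (g x) < val (g y)) by (destruct m; [exact Hor|exact Hor|exact Hor|tauto]).
  intros x y. rewrite <- !emb_incr. split; auto. intros H.
  destruct (Rtotal_order (val x) (val y)) as [H1|[H1|H1]]; auto.
  - apply val_inj in H1. subst. lra.
  - apply Hor' in H1. lra.
Qed.

Lemma linear_onto g : Homeo_plus m g -> forall y, exists x, g x = y.
Proof. intros [[gi [[_ I2] _]] _] y. exists (gi y). exact (equal_f I2 y). Qed.

Lemma linear_rel_ex g : Homeo_plus m g -> exists F, degree_one F /\ linear_rel g F.
Proof.
  intros Hg. pose proof (linear_orient g Hg) as Ho. pose proof (linear_onto g Hg) as Hs.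
  (* The value at [0] is [0] by default, whether or not [0] is the image of a point of the
     manifold. *)
  set (e := fun t => match excluded_middle_informative (0 < t /\ exists x, emb x = t) with
    | left H => emb (g (proj1_sig (constructive_indefinite_description _ (proj2 H))))
    | right _ => 0 end).
  assert (Ee : forall x, 0 < emb x -> e (emb x) = emb (g x)).
  { intros x Hx. unfold e. destruct (excluded_middle_informative _) as [H|H]; [|exfalso; eauto].
    do 2 f_equal. apply emb_inj. apply (proj2_sig (constructive_indefinite_description _ (proj2 H))). }
  assert (E0 : e 0 = 0). { unfold e. destruct (excluded_middle_informative _) as [H|H]; [exfalso; destruct H; lra|auto]. }
  assert (Hzero : forall x, emb x = 0 -> emb (g x) = 0).
  { intros x Ex. destruct (Hs x) as [y Hy]. apply Rle_antisym; [|apply emb_range].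
    rewrite <- Ex. rewrite <- Hy at 2. apply Rnot_lt_le; intros H. apply Ho in H. pose proof (emb_range y). lra. }
  assert (Hpos : forall x, 0 < emb x -> 0 < emb (g x)).
  { intros x Hx. destruct (emb_onto (emb x / 2)) as [y Hy]; [pose proof (emb_range x); lra|].
    assert (H : emb y < emb x) by lra. apply Ho in H. pose proof (emb_range (g y)). lra. }
  assert (Hone : forall x, emb x = 1 -> emb (g x) = 1).
  { intros x Ex. destruct (Hs x) as [y Hy]. apply Rle_antisym; [apply emb_range|].
    rewrite <- Ex. rewrite <- Hy at 1. apply Rnot_lt_le; intros H. apply Ho in H. pose proof (emb_range y). lra. }
  destruct (lift_exists e 0) as (F & HF & HFe & HF1).
  - intros s t Hs0 Hst Ht. destruct (emb_onto t) as [y <-]; [lra|]. rewrite (Ee y) by lra.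
    destruct Hs0 as [Hs0|<-]; [|rewrite E0; apply Hpos; lra].
    destruct (emb_onto s) as [x <-]; [lra|]. rewrite (Ee x) by lra. apply (proj1 (Ho x y)); lra.
  - intros t [[Ht|<-] Ht1]; [|lra]. destruct (emb_onto t) as [x <-]; [lra|]. rewrite Ee by lra.
    pose proof (emb_range (g x)). destruct (emb_onto ((emb x + 1) / 2)) as [y Hy]; [lra|].
    assert (H1 : emb x < emb y) by lra. apply Ho in H1. pose proof (emb_range (g y)). lra.
  - exists F. split; auto. exists 0%Z. assert (F0 : F 0 = 0) by (rewrite HFe; lra).
    split; [auto|]. intros x. rewrite Rplus_0_r. pose proof (emb_range x) as [[H0|H0] [H1|H1]].
    + rewrite HFe by lra. now apply Ee.
    + rewrite H1, HF1, E0, (Hone x); lra.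
    + rewrite <- H0, F0. symmetry. now apply Hzero.
    + lra.
Qed.

End Linear.

(** * Transfer to the four manifolds *)

Lemma Rpower_small C eps al : 0 <= C -> 0 < eps -> 0 < al ->
  exists delta, 0 < delta /\ forall t, 0 < t < delta -> C * Rpower t al < eps.
Proof.
  intros HC He Ha. exists (Rpower (eps / (C + 1)) (/ al)). split; [apply Rpower_pos|].
  intros t [Ht1 Ht2]. assert (He' : 0 < eps / (C + 1)) by (apply Rdiv_lt_0_compat; lra).
  assert (H : Rpower t al < eps / (C + 1)).
  { apply Rlt_le_trans with (Rpower (Rpower (eps / (C + 1)) (/ al)) al); [apply Rlt_Rpower_l; auto|].
    rewrite Rpower_mult, Rinv_l, Rpower_1; lra. }
  apply (Rmult_lt_compat_l (C + 1)) in H; [|lra].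
  replace ((C + 1) * (eps / (C + 1))) with eps in H by (field; lra).
  pose proof (Rpower_pos t al). lra.
Qed.

Lemma Rpower_mono al s t : 0 < al -> 0 < s -> s <= t -> Rpower s al <= Rpower t al.
Proof. intros. apply Rle_Rpower_l; lra. Qed.

Lemma Rpower_unit al t : 0 < al -> 0 < t <= 1 -> Rpower t al <= 1.
Proof.
  intros Ha Ht. replace 1 with (Rpower 1 al).
  - apply Rpower_mono; lra.
  - unfold Rpower. now rewrite ln_1, Rmult_0_r, exp_0.
Qed.

(** * Functions with Hölder derivative *)

Definition C1a_with (al : R) (G D : R -> R) (C : R) : Prop := 0 <= C /\
  forall u v, Rabs (G v - G u - D u * (v - u)) <= C * (Rabs (v - u) * Rpower (Rabs (v - u)) al).

Section C1aFacts.
Variables (al : R) (G D : R -> R) (C : R).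
Hypothesis Hal : 0 < al.
Hypothesis HG : C1a_with al G D C.

Lemma C1a_quotient u h : h <> 0 -> Rabs ((G (u + h) - G u) / h - D u) <= C * Rpower (Rabs h) al.
Proof.
  intros Hh. assert (Hp : 0 < Rabs h) by now apply Rabs_pos_lt.
  pose proof (proj2 HG u (u + h)) as H. replace (u + h - u) with h in H by ring.
  replace ((G (u + h) - G u) / h - D u) with ((G (u + h) - G u - D u * h) * / h) by (field; auto).
  rewrite Rabs_mult, Rabs_inv. apply Rmult_le_reg_r with (Rabs h); auto.
  rewrite Rmult_assoc, Rinv_l; lra.
Qed.

Lemma C1a_holder u v : u <> v -> Rabs (D u - D v) <= 2 * C * Rpower (Rabs (v - u)) al.
Proof.
  intros Huv. pose proof (C1a_quotient u (v - u)) as H1. pose proof (C1a_quotient v (u - v)) as H2.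
  replace (u + (v - u)) with v in H1 by ring. replace (v + (u - v)) with u in H2 by ring.
  replace ((G u - G v) / (u - v)) with ((G v - G u) / (v - u)) in H2 by (field; lra).
  rewrite (Rabs_minus_sym u v) in H2. specialize (H1 ltac:(lra)). specialize (H2 ltac:(lra)).
  apply Rabs_le_inv in H1, H2. apply Rabs_le. lra.
Qed.

Lemma C1a_deriv u : derivable_pt_lim G u (D u).
Proof.
  intros eps He. destruct (Rpower_small C eps al) as [dl [H1 H2]]; auto; [apply HG|].
  exists (mkposreal dl H1). simpl. intros h Hh Hd.
  apply Rle_lt_trans with (1 := C1a_quotient u h Hh). apply H2. split; [now apply Rabs_pos_lt|auto].
Qed.

(** [D] is the derivative of [G], hence determined by it and invariant under the same
    translations. *)
Lemma C1a_periodic k u : (forall x, G (x + IZR k) = G x + IZR k) -> D (u + IZR k) = D u.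
Proof.
  intros Hk. apply (uniqueness_limite G u).
  - intros eps He. destruct (C1a_deriv (u + IZR k) eps He) as [dl H]. exists dl. intros h Hh Hd.
    specialize (H h Hh Hd). replace (u + IZR k + h) with (u + h + IZR k) in H by ring.
    rewrite !Hk in H. replace (G (u + h) + IZR k - (G u + IZR k)) with (G (u + h) - G u) in H by ring. auto.
  - apply C1a_deriv.
Qed.

Lemma C1a_bounded : exists B, 0 <= B /\ forall u, 0 <= u <= 1 -> Rabs (D u) <= B.
Proof.
  pose proof (proj1 HG). exists (Rabs (D 0) + 2 * C). split; [pose proof (Rabs_pos (D 0)); lra|].
  intros u [Hu1 Hu2]. destruct Hu1 as [Hu1|<-]; [|lra].
  pose proof (C1a_holder u 0 ltac:(lra)) as H1.
  assert (Hp : Rpower (Rabs (0 - u)) al <= 1) by (apply Rpower_unit; auto; rewrite Rabs_left; lra).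
  pose proof (Rpower_pos (Rabs (0 - u)) al).
  pose proof (Rabs_triang_inv (D u) (D 0)). nra.
Qed.

Lemma C1a_lipschitz : exists B, 0 <= B /\ forall u v, 0 <= u <= 1 -> 0 <= v <= 1 -> Rabs (G v - G u) <= B * Rabs (v - u).
Proof.
  destruct C1a_bounded as [B [HB0 HB]]. pose proof (proj1 HG) as HC. exists (B + C). split; [lra|].
  intros u v Hu Hv. destruct (Req_dec u v) as [<-|Hn].
  - rewrite !Rminus_diag, Rabs_R0. lra.
  - pose proof (proj2 HG u v) as H. pose proof (HB u Hu).
    assert (Hp : 0 < Rabs (v - u) <= 1) by (split; [apply Rabs_pos_lt; lra|apply Rabs_le; lra]).
    pose proof (Rpower_unit al _ Hal Hp).
    replace (G v - G u) with ((G v - G u - D u * (v - u)) + D u * (v - u)) by ring.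
    apply Rle_trans with (1 := Rabs_triang _ _). rewrite (Rabs_mult (D u)).
    assert (Rabs (D u) * Rabs (v - u) <= B * Rabs (v - u)) by (apply Rmult_le_compat_r; lra).
    assert (C * (Rabs (v - u) * Rpower (Rabs (v - u)) al) <= C * (Rabs (v - u) * 1)).
    { apply Rmult_le_compat_l; auto. apply Rmult_le_compat_l; lra. }
    lra.
Qed.

End C1aFacts.

(** The one-sided part of [Diff1alpha]; the homeomorphism and the inverse are supplied by
    [conjugate_Diff]. *)
Definition smooth (m : oneManifold) (al : R) (h : Mmap m) : Prop :=
  exists df, C1_with m h df /\ exists C, forall x y, x <> y -> Rabs (df x - df y) <= C * Rpower (dist m x y) al.

Lemma sdiff_circle x y : 0 <= x < 1 -> 0 <= y < 1 ->
  Rabs (sdiff Mcircle y x) <= / 2 /\ exists k, sdiff Mcircle y x = y - x + IZR k.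
Proof.
  intros Hx Hy. simpl. destruct (Rlt_dec (1 / 2) (y - x)); [|destruct (Rle_dec (y - x) (- (1 / 2)))].
  - split; [apply Rabs_le; lra|]. exists (-1)%Z. lra.
  - split; [apply Rabs_le; lra|]. exists 1%Z. lra.
  - split; [apply Rabs_le; lra|]. exists 0%Z. lra.
Qed.

Lemma sdiff_circle_unique x y k : 0 <= x < 1 -> 0 <= y < 1 -> Rabs (y - x + IZR k) < / 2 ->
  sdiff Mcircle y x = y - x + IZR k.
Proof.
  intros Hx Hy Hk. destruct (sdiff_circle x y Hx Hy) as [H1 [k' H2]]. rewrite H2 in *.
  apply Rabs_le_inv in H1. apply Rabs_def2 in Hk.
  assert (IZR (k' - k) < 1 /\ -1 < IZR (k' - k)) as [J1 J2] by (rewrite minus_IZR; lra).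
  apply lt_IZR in J1, J2. now replace k' with k by lia.
Qed.

Lemma val_range_circle (x : pt Mcircle) : 0 <= val x < 1.
Proof. exact (proj2_sig x). Qed.

Lemma dist_eq_0 m (x y : pt m) : dist m x y = 0 -> x = y.
Proof.
  unfold dist. intros H. apply val_inj.
  assert (Hs : sdiff m (val y) (val x) = 0) by (destruct (Req_dec (sdiff m (val y) (val x)) 0); auto; now apply Rabs_no_R0 in H0).
  destruct m; simpl in Hs; try lra.
  pose proof (val_range_circle x). pose proof (val_range_circle y).
  destruct (Rlt_dec (1 / 2) (val y - val x)); [lra|]. destruct (Rle_dec (val y - val x) (- (1 / 2))); lra.
Qed.

Lemma dist_pos m (x y : pt m) : x <> y -> 0 < dist m x y.
Proof.
  intros H. destruct (Rabs_pos (sdiff m (val y) (val x))) as [|E]; auto.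
  exfalso. apply H, dist_eq_0. now symmetry.
Qed.

Lemma smooth_intro m al (h : Mmap m) df C : 0 < al -> 0 <= C -> (forall x, has_deriv m h x (df x)) ->
  (forall x y, x <> y -> Rabs (df x - df y) <= C * Rpower (dist m x y) al) -> smooth m al h.
Proof.
  intros Ha HC Hd Hh. exists df. split; [split; auto|eauto].
  intros x eps He. destruct (Rpower_small C eps al) as [dl [D1 D2]]; auto. exists dl. split; auto.
  intros y Hy. destruct (classic (x = y)) as [<-|Hn]; [rewrite Rminus_diag, Rabs_R0; auto|].
  rewrite Rabs_minus_sym. apply Rle_lt_trans with (1 := Hh x y Hn). apply D2. split; [now apply dist_pos|auto].
Qed.

(* [F] induces [h]: displacements of [h] are displacements of [F], up to the choice of the
   representative on the circle, which is determined as soon as it is shorter than [1/2]. *)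
Definition induces (m : oneManifold) (F : R -> R) (h : Mmap m) : Prop := forall x y,
  let s := sdiff m (val y) (val x) in
  Rabs (F (val x + s) - F (val x)) < / 2 ->
  sdiff m (val (h y)) (val (h x)) = F (val x + s) - F (val x).

Lemma circle_induces F h : degree_one F -> circle_rel h F -> induces Mcircle F h.
Proof.
  intros HF Hr x y s Hs. pose proof (val_range_circle x) as Hx. pose proof (val_range_circle y) as Hy.
  destruct (sdiff_circle (val x) (val y) Hx Hy) as [_ [k Hk]]. fold s in Hk.
  destruct (Hr x) as [k1 E1]. destruct (Hr y) as [k2 E2].
  assert (E : F (val x + s) - F (val x) = val (h y) - val (h x) + IZR (k2 + k - k1)).
  { rewrite Hk. replace (val x + (val y - val x + IZR k)) with (val y + IZR k) by ring.
    rewrite degree_one_Z, E1, E2, minus_IZR, plus_IZR by auto. ring. }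
  rewrite E in *. apply sdiff_circle_unique; auto; apply val_range_circle.
Qed.

Lemma linear_induces m F (h : Mmap m) k : m <> Mcircle -> (forall x, F (val x) = val (h x) + IZR k) -> induces m F h.
Proof.
  intros Hm HF x y s _.
  assert (Hs : forall u v, sdiff m v u = v - u) by (intros; destruct m; auto; tauto).
  unfold s. rewrite !Hs. replace (val x + (val y - val x)) with (val y) by ring. rewrite !HF. ring.
Qed.

Lemma incr_continuous F g x eps : incr F -> inv_of F g -> 0 < eps ->
  exists delta, 0 < delta /\ forall s, Rabs s < delta -> Rabs (F (x + s) - F x) < eps.
Proof.
  intros HF HI He. pose proof (inv_of_incr _ _ HF HI) as Hg. destruct HI as [I1 I2].
  assert (A1 : x < g (F x + eps)) by (rewrite <- (I1 x) at 1; apply Hg; lra).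
  assert (A2 : g (F x - eps) < x) by (rewrite <- (I1 x) at 2; apply Hg; lra).
  exists (Rmin (g (F x + eps) - x) (x - g (F x - eps))). split; [apply Rmin_glb_lt; lra|].
  intros s Hs. pose proof (Rmin_l (g (F x + eps) - x) (x - g (F x - eps))).
  pose proof (Rmin_r (g (F x + eps) - x) (x - g (F x - eps))). apply Rabs_def2 in Hs.
  apply Rabs_def1.
  - assert (F (x + s) < F (g (F x + eps))) by (apply HF; lra). rewrite I2 in *. lra.
  - assert (F (g (F x - eps)) < F (x + s)) by (apply HF; lra). rewrite I2 in *. lra.
Qed.

Lemma induces_continuous m F g (h : Mmap m) : incr F -> inv_of F g -> induces m F h -> continuous_M m h.
Proof.
  intros HF HI Hind x eps He.
  destruct (incr_continuous F g (val x) (Rmin eps (/ 2)) HF HI) as [dl [D1 D2]]; [apply Rmin_glb_lt; lra|].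
  exists dl. split; auto. intros y Hy. specialize (D2 _ Hy).
  pose proof (Rmin_l eps (/ 2)). pose proof (Rmin_r eps (/ 2)).
  unfold dist. rewrite Hind; lra.
Qed.

Lemma induces_smooth m al F (h : Mmap m) D C : 0 < al -> C1a_with al F D C -> induces m F h ->
  (forall x y : pt m, D (val x + sdiff m (val y) (val x)) = D (val y)) -> smooth m al h.
Proof.
  intros Ha HF Hind HD. pose proof (proj1 HF) as HC.
  apply (smooth_intro m al h (fun x => D (val x)) (2 * C)); auto; [lra| |].
  - intros x eps He. destruct (Rpower_small C eps al) as [d1 [D1 D2]]; auto.
    (* [B] bounds the difference quotients over distances up to 1, so displacements below
       [/ (2 * B)] have images below [/ 2], as [induces] requires. *)
    set (B := Rabs (D (val x)) + C + 1). assert (HB : 0 < B) by (unfold B; pose proof (Rabs_pos (D (val x))); lra).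
    assert (HB' : 0 < / (2 * B)) by (apply Rinv_0_lt_compat; lra).
    exists (Rmin d1 (Rmin 1 (/ (2 * B)))). split; [repeat apply Rmin_glb_lt; lra|].
    intros y [Hy1 Hy2].
    pose proof (Rmin_l d1 (Rmin 1 (/ (2 * B)))). pose proof (Rmin_r d1 (Rmin 1 (/ (2 * B)))).
    pose proof (Rmin_l 1 (/ (2 * B))). pose proof (Rmin_r 1 (/ (2 * B))).
    set (s := sdiff m (val y) (val x)) in *. unfold dist in Hy1, Hy2. fold s in Hy1, Hy2.
    assert (Hs : s <> 0) by (intros E; rewrite E, Rabs_R0 in Hy1; lra).
    assert (Hsmall : Rabs (F (val x + s) - F (val x)) < / 2).
    { pose proof (proj2 HF (val x) (val x + s)) as E. replace (val x + s - val x) with s in E by ring.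
      assert (Hp : Rpower (Rabs s) al <= 1) by (apply Rpower_unit; lra).
      replace (F (val x + s) - F (val x)) with ((F (val x + s) - F (val x) - D (val x) * s) + D (val x) * s) by ring.
      apply Rle_lt_trans with (1 := Rabs_triang _ _). rewrite (Rabs_mult (D (val x))).
      assert (C * (Rabs s * Rpower (Rabs s) al) <= C * (Rabs s * 1)).
      { apply Rmult_le_compat_l; auto. apply Rmult_le_compat_l; lra. }
      assert (Rabs s * B < / 2).
      { apply Rlt_le_trans with (/ (2 * B) * B); [apply Rmult_lt_compat_r; lra|right; field; lra]. }
      unfold B in *. nra. }
    pose proof (Hind x y Hsmall) as E. fold s in E. rewrite E.
    apply Rle_lt_trans with (1 := C1a_quotient al F D C HF (val x) s Hs). apply D2. lra.
  - intros x y Hxy. rewrite <- (HD x y). unfold dist. set (s := sdiff m (val y) (val x)).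
    assert (Hs : s <> 0). { pose proof (dist_pos m x y Hxy) as H. intros E. unfold dist in H. fold s in H. rewrite E, Rabs_R0 in H. lra. }
    replace s with (val x + s - val x) at 2 by ring. apply (C1a_holder al F D C HF). lra.
Qed.

Definition order_map {m} (psi : Mmap m) : Prop := forall x y, val x < val y -> val (psi x) < val (psi y).

Lemma order_map_orient {m} (psi : Mmap m) : order_map psi -> orient_pres m psi.
Proof.
  intros H. destruct m; try exact H. intros x y z [[H1 H2]|[[H1 H2]|[H1 H2]]].
  - left. split; now apply H.
  - right; left. split; now apply H.
  - right; right. split; now apply H.
Qed.

Lemma orient_comp m (f g : Mmap m) : orient_pres m f -> orient_pres m g -> orient_pres m (mcomp f g).
Proof. intros Hf Hg. destruct m; unfold mcomp; simpl in *; auto. Qed.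

Lemma continuous_comp m (f g : Mmap m) : continuous_M m f -> continuous_M m g -> continuous_M m (mcomp f g).
Proof.
  intros Hf Hg x eps He. destruct (Hf (g x) eps He) as [d1 [D1 D2]].
  destruct (Hg x d1 D1) as [d2 [D3 D4]]. exists d2. split; auto. intros y Hy. apply D2, D4, Hy.
Qed.

(** The inverse of the conjugate is the conjugate of an element of the group, so its derivative
    comes from the same hypothesis and not from an inverse function theorem. *)
Lemma conjugate_Diff m (G : Mmap m -> Prop) al psi psi_inv :
  (forall f, G f -> Homeo_plus m f) -> is_subgroup m G ->
  inverse_maps psi psi_inv -> continuous_M m psi -> continuous_M m psi_inv ->
  order_map psi -> order_map psi_inv ->
  (forall g, G g -> smooth m al (mcomp psi (mcomp g psi_inv))) ->
  forall g, G g -> Diff1alpha m al (mcomp psi (mcomp g psi_inv)).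
Proof.
  intros HG (_ & _ & Ginv) HI Hc1 Hc2 Ho1 Ho2 Hs g Hg.
  destruct (Ginv g Hg) as [gi [Hgi Igi]].
  assert (HIc : inverse_maps (mcomp psi (mcomp g psi_inv)) (mcomp psi (mcomp gi psi_inv))).
  { apply (inverse_maps_comp psi psi_inv (mcomp g psi_inv) (mcomp psi gi)) ; auto.
    now apply (inverse_maps_comp g gi psi_inv psi); [|apply inverse_maps_sym]. }
  assert (Hcont : forall k, G k -> continuous_M m (mcomp psi (mcomp k psi_inv))).
  { intros k Hk. apply continuous_comp; auto. apply continuous_comp; auto.
    destruct (HG k Hk) as [[ki (_ & Hck & _)] _]. auto. }
  split; [split|].
  - exists (mcomp psi (mcomp gi psi_inv)). auto.
  - apply orient_comp; [now apply order_map_orient|]. apply orient_comp; [|now apply order_map_orient].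
    apply HG; auto.
  - destruct (Hs g Hg) as (df & H1 & H2). exists df. split; [auto|split; [|auto]].
    destruct (Hs gi Hgi) as (dg & H3 & _). exists (mcomp psi (mcomp gi psi_inv)), dg. auto.
Qed.

Lemma translate_C1a al F c : (forall u, F u = u + c) -> C1a al F.
Proof.
  intros HF. exists (fun _ => 1), 0. split; [lra|]. intros u v. rewrite !HF.
  replace (v + c - (u + c) - 1 * (v - u)) with 0 by ring. rewrite Rabs_R0. lra.
Qed.

Lemma degree_one_inv F g : degree_one F -> inv_of F g -> degree_one g.
Proof.
  intros [H1 H2] HI. pose proof (inv_of_incr _ _ H1 HI) as Hg. destruct HI as [I1 I2]. split; auto.
  intros x. rewrite <- (I2 x) at 1. rewrite <- H2, I1. reflexivity.
Qed.

(** * From the unit interval to the line *)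

Definition pw (al t : R) : R := Rpower (Rabs t) al.

Lemma pw_nonneg al t : 0 <= pw al t.
Proof. left. apply Rpower_pos. Qed.

(** [G x / x] is the mean of [D (x * s)] over [s] in [[0, 1]] and inherits the exponent of [D]; a
    mean value theorem in [s] replaces the integral. Passing to reciprocals costs [Lam ^ 2]. *)
Lemma ratio_holder al G D C Lam : 0 < al -> C1a_with al G D C -> G 0 = 0 -> 0 <= Lam ->
  (forall x, 0 < x < 1 -> 0 < G x /\ x <= Lam * G x) ->
  forall x y, 0 < x < 1 -> 0 < y < 1 ->
    Rabs (y / G y - x / G x) <= 2 * C * Lam ^ 2 * pw al (y - x).
Proof.
  intros Ha HG G0 HLam Hlow x y Hx Hy. destruct (Req_dec x y) as [<-|Hxy].
  { rewrite Rminus_diag, Rabs_R0. pose proof (proj1 HG). pose proof (pw_nonneg al (x - x)).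
    apply Rmult_le_pos; auto. apply Rmult_le_pos; [lra|apply pow_le; auto]. }
  destruct (Hlow x Hx) as [Gx Lx]. destruct (Hlow y Hy) as [Gy Ly]. pose proof (proj1 HG) as HC.
  assert (Hk : Rabs (G x / x - G y / y) <= 2 * C * pw al (y - x)).
  { destruct (MVT_cor2 (fun s => / x * G (x * s) - / y * G (y * s)) (fun s => D (x * s) - D (y * s)) 0 1)
      as [xi [E Hxi]]; [lra| |].
    - intros s _.
      assert (Hgen : forall t, 0 < t -> derivable_pt_lim (fun s => / t * G (t * s)) s (D (t * s))).
      { intros t Ht. replace (D (t * s)) with (/ t * (D (t * s) * (t * 1))) by (field; lra).
        apply derivable_pt_lim_scal with (f := fun s => G (t * s)).
        apply (derivable_pt_lim_comp (fun s => t * s) G).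
        - apply derivable_pt_lim_scal with (f := fun s => s). apply derivable_pt_lim_id.
        - now apply (C1a_deriv al G D C). }
      apply (derivable_pt_lim_minus (fun s => / x * G (x * s)) (fun s => / y * G (y * s))); apply Hgen; lra.
    - rewrite !Rmult_0_r, !Rmult_1_r, G0, !Rmult_0_r, Rminus_diag, !Rminus_0_r, Rmult_1_r in E.
      replace (G x / x - G y / y) with (/ x * G x - / y * G y) by (unfold Rdiv; ring). rewrite E.
      apply Rle_trans with (1 := C1a_holder al G D C HG (x * xi) (y * xi) ltac:(nra)).
      apply Rmult_le_compat_l; [lra|]. unfold pw. apply Rpower_mono; auto.
      + apply Rabs_pos_lt. nra.
      + replace (y * xi - x * xi) with (xi * (y - x)) by ring. rewrite Rabs_mult, (Rabs_right xi) by lra.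
        pose proof (Rabs_pos (y - x)). nra. }
  replace (y / G y - x / G x) with ((y / G y) * (x / G x) * (G x / x - G y / y)) by (field; lra).
  assert (Hb : forall t g, 0 < t -> 0 < g -> t <= Lam * g -> 0 <= t / g <= Lam).
  { intros t g Ht Hg Hl. split; [apply Rlt_le, Rdiv_lt_0_compat; auto|].
    apply Rmult_le_reg_r with g; auto. unfold Rdiv. rewrite Rmult_assoc, Rinv_l; lra. }
  destruct (Hb x (G x)) as [X1 X2]; try lra. destruct (Hb y (G y)) as [Y1 Y2]; try lra.
  rewrite Rabs_mult, (Rabs_right (_ * _)) by (apply Rle_ge, Rmult_le_pos; auto).
  replace (2 * C * Lam ^ 2 * pw al (y - x)) with ((Lam * Lam) * (2 * C * pw al (y - x))) by ring.
  apply Rmult_le_compat; auto; [apply Rmult_le_pos; auto|apply Rabs_pos|apply Rmult_le_compat; auto].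
Qed.

(** Bounded and Hölder in [y] at the diagonal, a class closed under products. The restriction to
    distance [/ 4] keeps [pairing] away from zero. *)
Definition tame (al : R) (f : R -> R -> R) : Prop := exists C, 0 <= C /\
  forall x y, 0 < x < 1 -> 0 < y < 1 -> Rabs (y - x) <= / 4 ->
    Rabs (f x y) <= C /\ Rabs (f x y - f x x) <= C * pw al (y - x).

Lemma tame_mult al f g : tame al f -> tame al g -> tame al (fun x y => f x y * g x y).
Proof.
  intros [C [HC Hf]] [C' [HC' Hg]]. exists (2 * C * C'). split; [nra|]. intros x y Hx Hy Hxy.
  destruct (Hf x y Hx Hy Hxy) as [F1 F2]. destruct (Hg x y Hx Hy Hxy) as [G1 G2].
  destruct (Hf x x Hx Hx) as [F3 _]; [rewrite Rminus_diag, Rabs_R0; lra|].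
  pose proof (Rabs_pos (f x y)). pose proof (Rabs_pos (g x y)). pose proof (Rabs_pos (f x x)).
  pose proof (pw_nonneg al (y - x)). split.
  - rewrite Rabs_mult. assert (Rabs (f x y) * Rabs (g x y) <= C * C') by (apply Rmult_le_compat; lra). nra.
  - replace (f x y * g x y - f x x * g x x) with ((f x y - f x x) * g x y + f x x * (g x y - g x x)) by ring.
    apply Rle_trans with (1 := Rabs_triang _ _). rewrite !Rabs_mult.
    assert (Rabs (f x y - f x x) * Rabs (g x y) <= (C * pw al (y - x)) * C').
    { apply Rmult_le_compat; auto; apply Rabs_pos. }
    assert (Rabs (f x x) * Rabs (g x y - g x x) <= C * (C' * pw al (y - x))).
    { apply Rmult_le_compat; auto; apply Rabs_pos. }
    lra.
Qed.

Lemma pw_ge_abs al t : 0 < al <= 1 -> Rabs t <= 1 -> Rabs t <= pw al t.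
Proof.
  intros Ha Ht. unfold pw. destruct (Rabs_pos t) as [H|H].
  - apply Rpower_ge_self; lra.
  - rewrite <- H. left. apply Rpower_pos.
Qed.

(** The numerator in the difference quotient of [theta], see [theta_diff]. *)
Definition pairing (x y : R) : R := x * y + (1 - x) * (1 - y).

Definition slope (G D : R -> R) (x y : R) : R :=
  if Req_EM_T x y then D x else (G y - G x) / (y - x).

Definition theta (x : R) : R := / (1 - x) - / x.
(** The root in [(0, 1)] of the quadratic equation [theta x = u], rationalized so that [u = 0] is
    not exceptional. *)
Definition theta_inv (u : R) : R := 2 / (2 - u + sqrt (u ^ 2 + 4)).

Lemma theta_inv_den u : Rabs u < sqrt (u ^ 2 + 4).
Proof. rewrite <- sqrt_Rsqr_abs. unfold Rsqr. apply sqrt_lt_1; nra. Qed.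

Lemma theta_inv_range u : 0 < theta_inv u < 1.
Proof.
  pose proof (theta_inv_den u) as H. pose proof (Rle_abs u). unfold theta_inv. split.
  - apply Rdiv_lt_0_compat; lra.
  - apply Rmult_lt_reg_r with (2 - u + sqrt (u ^ 2 + 4)); [lra|].
    replace (2 / (2 - u + sqrt (u ^ 2 + 4)) * (2 - u + sqrt (u ^ 2 + 4))) with 2 by (field; lra). lra.
Qed.

Lemma theta_theta_inv u : theta (theta_inv u) = u.
Proof.
  pose proof (theta_inv_den u) as H. pose proof (Rle_abs u) as H0. unfold theta, theta_inv.
  assert (HS : sqrt (u ^ 2 + 4) * sqrt (u ^ 2 + 4) = u ^ 2 + 4) by (apply sqrt_sqrt; nra).
  set (S := sqrt (u ^ 2 + 4)) in *.
  replace (1 - 2 / (2 - u + S)) with ((S - u) / (2 - u + S)) by (field; lra).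
  apply Rmult_eq_reg_r with (2 * (S - u)); [|lra]. field_simplify; [|lra]. nra.
Qed.

Lemma theta_diff x y : 0 < x < 1 -> 0 < y < 1 ->
  theta y - theta x = (y - x) * (pairing x y / (x * y * ((1 - x) * (1 - y)))).
Proof. intros Hx Hy. unfold theta, pairing. field. lra. Qed.

Lemma pairing_pos x y : 0 < x < 1 -> 0 < y < 1 -> 0 < pairing x y.
Proof. intros Hx Hy. unfold pairing. nra. Qed.

(** Distances on the line dominate those in [(0, 1)], so Hölder bounds in the bounded coordinate
    imply bounds on the line. *)
Lemma theta_expands x y : 0 < x < 1 -> 0 < y < 1 -> Rabs (y - x) <= Rabs (theta y - theta x).
Proof.
  intros Hx Hy. rewrite theta_diff, Rabs_mult by auto. pose proof (Rabs_pos (y - x)).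
  assert (P1 : 0 < x * y) by nra. assert (P2 : 0 < (1 - x) * (1 - y)) by nra.
  assert (P : 0 < x * y * ((1 - x) * (1 - y))) by nra.
  assert (Hq : 1 <= pairing x y / (x * y * ((1 - x) * (1 - y)))).
  { apply Rmult_le_reg_r with (x * y * ((1 - x) * (1 - y))); auto.
    replace (pairing x y / (x * y * ((1 - x) * (1 - y))) * (x * y * ((1 - x) * (1 - y)))) with (pairing x y) by (field; lra).
    assert ((1 - x) * (1 - y) <= 1) by nra. unfold pairing. nra. }
  rewrite (Rabs_right (pairing x y / _)) by lra. nra.
Qed.

Lemma theta_incr x y : 0 < x -> x < y -> y < 1 -> theta x < theta y.
Proof.
  intros H1 H2 H3. assert (0 < theta y - theta x); [|lra]. rewrite theta_diff by lra.
  assert (0 < x * y) by nra. assert (0 < (1 - x) * (1 - y)) by nra.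
  apply Rmult_lt_0_compat; [lra|]. apply Rdiv_lt_0_compat; [apply pairing_pos; lra|nra].
Qed.

Lemma theta_inv_incr : incr theta_inv.
Proof.
  intros u v Huv. apply Rnot_le_lt. intros [H|H].
  - pose proof (theta_inv_range u). pose proof (theta_inv_range v).
    assert (H2 : theta (theta_inv v) < theta (theta_inv u)) by (apply theta_incr; lra).
    rewrite !theta_theta_inv in H2. lra.
  - assert (H2 : theta (theta_inv v) = theta (theta_inv u)) by now f_equal.
    rewrite !theta_theta_inv in H2. lra.
Qed.

Lemma theta_inv_theta x : 0 < x < 1 -> theta_inv (theta x) = x.
Proof.
  intros Hx. pose proof (theta_inv_range (theta x)) as Hr. pose proof (theta_theta_inv (theta x)) as E.
  destruct (Rtotal_order (theta_inv (theta x)) x) as [H|[H|H]]; auto.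
  - pose proof (theta_incr (theta_inv (theta x)) x ltac:(lra) H ltac:(lra)). lra.
  - pose proof (theta_incr x (theta_inv (theta x)) ltac:(lra) H ltac:(lra)). lra.
Qed.

Section LineCase.
Variables (al : R) (G D : R -> R) (C : R) (Gi : R -> R).
Hypothesis Hal : 0 < al < 1.
Hypothesis HG : C1a_with al G D C.
Hypothesis HGi : C1a al Gi.
Hypothesis Ginc : incr G.
Hypothesis HI : inv_of G Gi.
Hypothesis G0 : G 0 = 0.
Hypothesis G1 : G 1 = 1.

Let ratio0 x := x / G x.
Let ratio1 x := (1 - x) / (1 - G x).

Lemma G_range x : 0 < x < 1 -> 0 < G x < 1.
Proof. intros Hx. split; [rewrite <- G0|rewrite <- G1]; apply Ginc; lra. Qed.

(** The Lipschitz bound for the inverse [Gi], read at the fixed points [0] and [1]. *)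
Lemma lower_bound : exists Lam, 0 <= Lam /\ forall x, 0 < x < 1 -> x <= Lam * G x /\ 1 - x <= Lam * (1 - G x).
Proof.
  destruct HGi as (D' & C' & HC' & H). destruct (C1a_lipschitz al Gi D' C' (proj1 Hal)) as [B [HB HL]]; [now split|].
  exists B. split; auto. intros x Hx. pose proof (G_range x Hx) as Hr. destruct HI as [I1 I2].
  assert (E0 : Gi 0 = 0) by (rewrite <- G0 at 1; apply I1). assert (E1 : Gi 1 = 1) by (rewrite <- G1 at 1; apply I1).
  split.
  - pose proof (HL 0 (G x) ltac:(lra) ltac:(lra)) as H1. rewrite I1, E0, !Rminus_0_r, !Rabs_right in H1; lra.
  - pose proof (HL (G x) 1 ltac:(lra) ltac:(lra)) as H1. rewrite I1, E1, !Rabs_right in H1; lra.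
Qed.

Lemma tame_ratios : tame al (fun x _ => ratio0 x) /\ tame al (fun _ y => ratio0 y) /\
  tame al (fun x _ => ratio1 x) /\ tame al (fun _ y => ratio1 y).
Proof.
  destruct lower_bound as [Lam [HLam Hlow]]. pose proof (proj1 HG) as HC.
  assert (H0 : forall x y, 0 < x < 1 -> 0 < y < 1 -> Rabs (ratio0 y - ratio0 x) <= 2 * C * Lam ^ 2 * pw al (y - x)).
  { apply (ratio_holder al G D C); auto; [lra|]. intros x Hx. split; [apply G_range|apply Hlow]; auto. }
  assert (H1 : forall x y, 0 < x < 1 -> 0 < y < 1 -> Rabs (ratio1 y - ratio1 x) <= 2 * C * Lam ^ 2 * pw al (y - x)).
  (* The end [1] is reduced to the end [0] by reflecting [G] at the midpoint. *)
  { assert (HG' : C1a_with al (fun x => 1 - G (1 - x)) (fun x => D (1 - x)) C).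
    { split; auto. intros u v. pose proof (proj2 HG (1 - u) (1 - v)) as H.
      replace (1 - v - (1 - u)) with (- (v - u)) in H by ring. rewrite Rabs_Ropp in H.
      rewrite <- Rabs_Ropp. refine (Rle_trans _ _ _ (Req_le _ _ _) H). f_equal. ring. }
    intros x y Hx Hy.
    pose proof (ratio_holder al _ _ C Lam (proj1 Hal) HG') as H. cbn beta in H.
    specialize (H ltac:(rewrite Rminus_0_r, G1; lra) HLam).
    assert (H' : forall z, 0 < z < 1 -> 0 < 1 - G (1 - z) /\ z <= Lam * (1 - G (1 - z))).
    { intros z Hz. pose proof (G_range (1 - z) ltac:(lra)). pose proof (Hlow (1 - z) ltac:(lra)). lra. }
    specialize (H H' (1 - x) (1 - y) ltac:(lra) ltac:(lra)).
    replace (1 - (1 - x)) with x in H by ring. replace (1 - (1 - y)) with y in H by ring.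
    replace (pw al (1 - y - (1 - x))) with (pw al (y - x)) in H; [exact H|].
    unfold pw. f_equal. rewrite <- Rabs_Ropp. f_equal. ring. }
  assert (B0 : forall x, 0 < x < 1 -> Rabs (ratio0 x) <= Lam /\ Rabs (ratio1 x) <= Lam).
  { intros x Hx. pose proof (G_range x Hx) as Hr. destruct (Hlow x Hx) as [L1 L2]. unfold ratio0, ratio1.
    assert (Hb : forall t g, 0 < t -> 0 < g -> t <= Lam * g -> Rabs (t / g) <= Lam).
    { intros t g Ht Hg Hl. rewrite Rabs_right by (apply Rle_ge, Rlt_le, Rdiv_lt_0_compat; auto).
      apply Rmult_le_reg_r with g; auto. unfold Rdiv. rewrite Rmult_assoc, Rinv_l; lra. }
    split; apply Hb; lra. }
  set (K := Lam + 2 * C * Lam ^ 2). assert (HK2 : 0 <= 2 * C * Lam ^ 2) by (apply Rmult_le_pos; [lra|apply pow_le; auto]).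
  assert (Hgen : forall f : R -> R, (forall x, 0 < x < 1 -> Rabs (f x) <= Lam) ->
    (forall x y, 0 < x < 1 -> 0 < y < 1 -> Rabs (f y - f x) <= 2 * C * Lam ^ 2 * pw al (y - x)) ->
    tame al (fun x _ => f x) /\ tame al (fun _ y => f y)).
  { intros f Hf1 Hf2. split; exists K; (split; [unfold K; lra|]); intros x y Hx Hy _; pose proof (pw_nonneg al (y - x)).
    - pose proof (Hf1 x Hx). rewrite Rminus_diag, Rabs_R0. unfold K. split; nra.
    - pose proof (Hf1 y Hy). pose proof (Hf2 x y Hx Hy). unfold K. split; nra. }
  destruct (Hgen ratio0) as [T1 T2]; auto; [intros; now apply B0|].
  destruct (Hgen ratio1) as [T3 T4]; auto. intros; now apply B0.
Qed.

Lemma tame_pairing_image : tame al (fun x y => pairing (G x) (G y)).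
Proof.
  destruct (C1a_lipschitz al G D C (proj1 Hal) HG) as [B [HB HL]].
  exists (2 + B). split; [lra|]. intros x y Hx Hy Hxy. pose proof (G_range x Hx). pose proof (G_range y Hy). split.
  - unfold pairing. apply Rabs_le. nra.
  - replace (pairing (G x) (G y) - pairing (G x) (G x)) with ((G y - G x) * (2 * G x - 1)) by (unfold pairing; ring).
    rewrite Rabs_mult. assert (Rabs (2 * G x - 1) <= 1) by (apply Rabs_le; lra).
    pose proof (HL x y ltac:(lra) ltac:(lra)). pose proof (pw_ge_abs al (y - x) ltac:(lra) ltac:(lra)).
    pose proof (Rabs_pos (y - x)). pose proof (Rabs_pos (G y - G x)). pose proof (Rabs_pos (2 * G x - 1)). nra.
Qed.

Lemma tame_inv_pairing : tame al (fun x y => / pairing x y).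
Proof.
  assert (Hlow : forall x y, 0 < x < 1 -> 0 < y < 1 -> Rabs (y - x) <= / 4 -> / 4 <= pairing x y).
  { intros x y Hx Hy Hxy. apply Rabs_le_inv in Hxy. unfold pairing. 
    (* On the diagonal [pairing] is at least [/ 2]; moving [y] by at most [/ 4] costs at most
       [/ 4]. *)
    replace (x * y + (1 - x) * (1 - y)) with (/ 2 + 2 * (x - / 2) ^ 2 + (y - x) * (2 * x - 1)) by field.
    assert (- / 4 <= (y - x) * (2 * x - 1)).
    { destruct (Rle_lt_dec 0 (2 * x - 1)); nra. }
    pose proof (pow2_ge_0 (x - / 2)). lra. }
  exists 16. split; [lra|]. intros x y Hx Hy Hxy. pose proof (Hlow x y Hx Hy Hxy) as H1.
  pose proof (Hlow x x Hx Hx ltac:(rewrite Rminus_diag, Rabs_R0; lra)) as H2.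
  assert (Hinv : forall p, / 4 <= p -> 0 < / p <= 4).
  { intros p Hp. split; [apply Rinv_0_lt_compat; lra|]. rewrite <- (Rinv_inv 4). apply Rinv_le_contravar; lra. }
  pose proof (Hinv _ H1) as I1. pose proof (Hinv _ H2) as I2.
  pose proof (pw_ge_abs al (y - x) ltac:(lra) ltac:(lra)) as Hp. pose proof (Rabs_pos (y - x)) as Ha. split.
  - rewrite Rabs_right; lra.
  - replace (/ pairing x y - / pairing x x) with ((pairing x x - pairing x y) * (/ pairing x y * / pairing x x)) by (field; lra).
    replace (pairing x x - pairing x y) with (- ((y - x) * (2 * x - 1))) by (unfold pairing; ring).
    rewrite Rabs_mult, Rabs_Ropp, Rabs_mult, (Rabs_right (_ * / _)) by nra.
    assert (Rabs (2 * x - 1) <= 1) by (apply Rabs_le; lra). pose proof (Rabs_pos (2 * x - 1)).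
    assert (/ pairing x y * / pairing x x <= 16) by nra.
    assert (Rabs (y - x) * Rabs (2 * x - 1) <= pw al (y - x)) by nra.
    rewrite (Rmult_comm 16). apply Rmult_le_compat; nra.
Qed.

Lemma tame_slope : tame al (slope G D).
Proof.
  destruct (C1a_bounded al G D C (proj1 Hal) HG) as [B [HB Hb]]. pose proof (proj1 HG) as HC.
  exists (B + C). split; [lra|]. intros x y Hx Hy Hxy.
  assert (Exx : slope G D x x = D x) by (unfold slope; destruct (Req_EM_T x x); tauto).
  assert (Hd : Rabs (slope G D x y - D x) <= C * pw al (y - x)).
  { unfold slope. destruct (Req_EM_T x y) as [<-|Hn].
    - rewrite Rminus_diag, Rabs_R0. pose proof (pw_nonneg al (x - x)). nra.
    - pose proof (C1a_quotient al G D C HG x (y - x) ltac:(lra)) as H.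
      replace (x + (y - x)) with y in H by ring. exact H. }
  pose proof (Hb x ltac:(lra)) as Hbx. pose proof (pw_nonneg al (y - x)).
  rewrite Exx. split; [|nra]. destruct (Req_EM_T x y) as [<-|Hn].
  - rewrite Exx. lra.
  - assert (pw al (y - x) <= 1).
    { apply Rpower_unit; [lra|]. split; [apply Rabs_pos_lt; lra|lra]. }
    replace (slope G D x y) with ((slope G D x y - D x) + D x) by ring.
    apply Rle_trans with (1 := Rabs_triang _ _). nra.
Qed.

(* The difference quotient of [theta G theta^-1] between [theta x] and [theta y], written as a product
   of functions that are visibly bounded and Hoelder at the diagonal. *)
Definition quot (x y : R) : R :=
  ratio0 x * (ratio0 y * (ratio1 x * (ratio1 y * (pairing (G x) (G y) * (/ pairing x y * slope G D x y))))).

Lemma tame_quot : tame al quot.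
Proof.
  destruct tame_ratios as (T1 & T2 & T3 & T4). unfold quot.
  apply (tame_mult al (fun x _ => ratio0 x)); auto. apply (tame_mult al (fun _ y => ratio0 y)); auto.
  apply (tame_mult al (fun x _ => ratio1 x)); auto. apply (tame_mult al (fun _ y => ratio1 y)); auto.
  apply (tame_mult al (fun x y => pairing (G x) (G y))); [apply tame_pairing_image|].
  apply (tame_mult al (fun x y => / pairing x y)); [apply tame_inv_pairing|apply tame_slope].
Qed.

(** Symmetry allows the diagonal estimate at either point, so the derivatives at [u] and [v] are
    compared through [quot u v]. *)
Lemma quot_sym x y : quot x y = quot y x.
Proof.
  unfold quot. assert (E : slope G D x y = slope G D y x).
  { unfold slope. destruct (Req_EM_T x y) as [<-|H1]; destruct (Req_EM_T _ _) as [H2|H2]; auto; try tauto.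
    - subst; tauto.
    - field. lra. }
  rewrite E. replace (pairing (G x) (G y)) with (pairing (G y) (G x)) by (unfold pairing; ring).
  replace (pairing x y) with (pairing y x) by (unfold pairing; ring). ring.
Qed.

Lemma quot_theta x y : 0 < x < 1 -> 0 < y < 1 -> x <> y ->
  (theta (G y) - theta (G x)) / (theta y - theta x) = quot x y.
Proof.
  intros Hx Hy Hn. pose proof (G_range x Hx) as Gx. pose proof (G_range y Hy) as Gy.
  rewrite !theta_diff by auto. pose proof (pairing_pos x y Hx Hy). 
  unfold quot, ratio0, ratio1, slope. destruct (Req_EM_T x y) as [|_]; [tauto|].
  field. repeat split; lra.
Qed.

Lemma line_smooth (h : Mmap MR) : (forall x, val (h x) = theta (G (theta_inv (val x)))) -> smooth MR al h.
Proof.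
  intros Hh. destruct tame_quot as [K [HK Ht]].
  set (df := fun x : pt MR => quot (theta_inv (val x)) (theta_inv (val x))).
  assert (Hle : forall x y : pt MR, x <> y -> 
     0 < Rabs (theta_inv (val y) - theta_inv (val x)) <= Rabs (val y - val x)).
  { intros x y Hxy. split.
    - apply Rabs_pos_lt. intros E. apply Hxy, val_inj. rewrite <- (theta_theta_inv (val x)), <- (theta_theta_inv (val y)).
      f_equal. lra.
    - rewrite <- (theta_theta_inv (val x)) at 2. rewrite <- (theta_theta_inv (val y)) at 2.
      apply theta_expands; apply theta_inv_range. }
  assert (Hpw : forall x y : pt MR, x <> y -> 
     pw al (theta_inv (val y) - theta_inv (val x)) <= Rpower (dist MR x y) al).
  { intros x y Hxy. destruct (Hle x y Hxy). apply Rpower_mono; auto. lra. }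
  apply (smooth_intro MR al h df (8 * K)); [lra|lra| |].
  - intros x eps He. destruct (Rpower_small K eps al) as [dl [D1 D2]]; auto; [lra|].
    exists (Rmin dl (/ 4)). split; [apply Rmin_glb_lt; lra|]. intros y [Hy1 Hy2].
    pose proof (Rmin_l dl (/ 4)). pose proof (Rmin_r dl (/ 4)).
    assert (Hxy : x <> y). { intros <-. unfold dist in Hy1. simpl in Hy1. rewrite Rminus_diag, Rabs_R0 in Hy1. lra. }
    destruct (Hle x y Hxy) as [L1 L2].
    assert (Hd : dist MR x y = Rabs (val y - val x)) by reflexivity.
    assert (E : sdiff MR (val (h y)) (val (h x)) / sdiff MR (val y) (val x) = quot (theta_inv (val x)) (theta_inv (val y))).
    { simpl. rewrite !Hh. rewrite <- quot_theta; try apply theta_inv_range.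
      - now rewrite !theta_theta_inv.
      - intros E. rewrite E, Rminus_diag, Rabs_R0 in L1. lra. }
    rewrite E. destruct (Ht (theta_inv (val x)) (theta_inv (val y))) as [_ H2]; try apply theta_inv_range; [lra|].
    apply Rle_lt_trans with (1 := H2). apply Rle_lt_trans with (K * Rpower (dist MR x y) al).
    + apply Rmult_le_compat_l; auto.
    + apply D2. lra.
  - intros x y Hxy. destruct (Hle x y Hxy) as [L1 L2]. unfold df.
    pose proof (theta_inv_range (val x)) as Rx. pose proof (theta_inv_range (val y)) as Ry.
    pose proof (Hpw x y Hxy) as Hp. pose proof (Rpower_pos (dist MR x y) al) as Hpos.
    set (u := theta_inv (val x)) in *. set (v := theta_inv (val y)) in *.
    destruct (Rle_lt_dec (Rabs (v - u)) (/ 4)) as [Hs|Hs].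
    + destruct (Ht u v Rx Ry Hs) as [_ H1]. destruct (Ht v u Ry Rx ltac:(rewrite Rabs_minus_sym; auto)) as [_ H2].
      rewrite (quot_sym v u) in H2. replace (pw al (u - v)) with (pw al (v - u)) in H2 by (unfold pw; now rewrite Rabs_minus_sym).
      apply Rabs_le_inv in H1, H2. assert (K * pw al (v - u) <= K * Rpower (dist MR x y) al) by (apply Rmult_le_compat_l; auto).
      apply Rabs_le. nra.
    (* At distance above [/ 4] boundedness suffices: [2 * K <= 8 * K * / 4], which is where the
       factor 8 is needed. *)
    + destruct (Ht u u Rx Rx ltac:(rewrite Rminus_diag, Rabs_R0; lra)) as [H1 _].
      destruct (Ht v v Ry Ry ltac:(rewrite Rminus_diag, Rabs_R0; lra)) as [H2 _].
      assert (H4 : / 4 <= Rpower (dist MR x y) al).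
      { apply Rle_trans with (Rpower (/ 4) al); [apply Rpower_ge_self; lra|]. apply Rpower_mono; [lra|lra|].
        unfold dist. simpl. lra. }
      apply Rabs_le_inv in H1, H2. apply Rabs_le. nra.
Qed.

End LineCase.

Lemma mk_pt {m} t (H : inM m t) : exists x : pt m, val x = t.
Proof. now exists (exist _ t H). Qed.

Lemma smooth_id m al : 0 < al -> smooth m al idm.
Proof.
  intros Ha. apply (smooth_intro m al idm (fun _ => 1) 0); auto; [lra| |].
  - intros x eps He. exists 1. split; [lra|]. intros y [Hy _]. unfold idm.
    assert (sdiff m (val y) (val x) <> 0) by (intros E; unfold dist in Hy; rewrite E, Rabs_R0 in Hy; lra).
    replace (_ / _ - 1) with 0 by (field; auto). rewrite Rabs_R0; auto.
  - intros x y _. rewrite Rminus_diag, Rabs_R0. lra.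
Qed.

Lemma linear_lgroup m G S d emb : m <> Mcircle -> (forall f, G f -> Homeo_plus m f) -> is_subgroup m G ->
  symmetric_set S -> generates S G -> poly_growth S d ->
  (forall x : pt m, 0 <= emb x <= 1) -> (forall x y : pt m, val x < val y <-> emb x < emb y) ->
  (forall t, 0 < t < 1 -> exists x : pt m, emb x = t) ->
  exists C, lgroup (lifts m G (linear_rel m emb)) (len m S (linear_rel m emb)) C d.
Proof.
  intros Hm HG Hsub Hsym Hgen Hgrow E1 E2 E3. apply lifts_lgroup; auto.
  - apply linear_rel_id.
  - apply linear_rel_comp.
  - intros g Hg. apply linear_rel_ex; auto.
  - intros F HF Hr. now apply (linear_rel_id_inv m emb E3).
Qed.

(** * The circle and the bounded intervals *)

Definition lift_rel (m : oneManifold) : Mmap m -> (R -> R) -> Prop :=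
  match m with
  | Mcircle => circle_rel
  | m' => linear_rel m' val
  end.

Lemma linear_lift_rel m : m <> Mcircle -> lift_rel m = linear_rel m val.
Proof. intros Hm. destruct m; auto; tauto. Qed.

Lemma unit_point m t : m <> MR -> 0 < t < 1 -> inM m t.
Proof. intros Hm Ht. destruct m; simpl; auto; lra. Qed.

Lemma unit_val m (x : pt m) : m <> MR -> 0 <= val x <= 1.
Proof.
  intros Hm. assert (H : inM m (val x)) by exact (proj2_sig x).
  destruct m; [tauto| | |]; unfold inM in H; lra.
Qed.

Lemma lift_lgroup m G S d : m <> MR -> (forall f, G f -> Homeo_plus m f) -> is_subgroup m G ->
  symmetric_set S -> generates S G -> poly_growth S d ->
  (exists C, lgroup (lifts m G (lift_rel m)) (len m S (lift_rel m)) C d) /\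
  forall g, G g -> exists F, degree_one F /\ lift_rel m g F.
Proof.
  intros Hm HG Hsub Hsym Hgen Hgrow. destruct (classic (m = Mcircle)) as [->|Hc].
  - split.
    + apply lifts_lgroup; auto.
      * apply circle_rel_id.
      * apply circle_rel_comp.
      * intros g Hg. apply circle_rel_ex; auto.
      * intros F HF Hr. now apply circle_rel_id_inv.
    + intros g Hg. apply circle_rel_ex; auto.
  - rewrite linear_lift_rel by auto.
    assert (E3 : forall t, 0 < t < 1 -> exists x : pt m, val x = t) by (intros t Ht; apply mk_pt, unit_point; auto).
    split.
    + apply linear_lgroup; auto; [intros; now apply unit_val|tauto].
    + intros g Hg. apply linear_rel_ex; auto; [intros; now apply unit_val|tauto].
Qed.

Lemma lift_rel_induces m F h : m <> MR -> degree_one F -> lift_rel m h F -> induces m F h.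
Proof.
  intros Hm HF Hr. destruct (classic (m = Mcircle)) as [->|Hc].
  - now apply circle_induces.
  - rewrite linear_lift_rel in Hr by auto. destruct Hr as [k [_ Hk]]. now apply (linear_induces m F h k).
Qed.

Lemma lift_rel_periodic m al F D C : m <> MR -> 0 < al -> C1a_with al F D C -> degree_one F ->
  forall x y : pt m, D (val x + sdiff m (val y) (val x)) = D (val y).
Proof.
  intros Hm Ha HF Hd x y. destruct (classic (m = Mcircle)) as [->|Hc].
  - destruct (sdiff_circle (val x) (val y) (val_range_circle x) (val_range_circle y)) as [_ [k Hk]].
    rewrite Hk. replace (val x + (val y - val x + IZR k)) with (val y + IZR k) by ring.
    apply (C1a_periodic al F D C); auto. intros z. now apply degree_one_Z.
  - f_equal. destruct m; simpl; try tauto; ring.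
Qed.

Lemma lift_rel_conj m g F phi phii psi psi_inv : m <> MR -> degree_one phi -> phi 0 = 0 -> phii 0 = 0 ->
  (forall x : pt m, val (psi x) = phi (val x)) -> (forall x : pt m, val (psi_inv x) = phii (val x)) ->
  lift_rel m g F -> lift_rel m (mcomp psi (mcomp g psi_inv)) (fun u => phi (F (phii u))).
Proof.
  intros Hm Hphi P0 P0i Hpsi Hpsii Hr. destruct (classic (m = Mcircle)) as [->|Hc].
  - intros u. destruct (Hr (psi_inv u)) as [k Hk]. exists k.
    rewrite <- Hpsii, Hk, degree_one_Z by auto. unfold mcomp. now rewrite Hpsi.
  - rewrite linear_lift_rel in * by auto. destruct Hr as [k [K1 K2]]. exists k. split.
    + rewrite P0i, K1. replace (IZR k) with (0 + IZR k) at 1 by ring. rewrite degree_one_Z, P0 by auto. ring.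
    + intros u. rewrite <- Hpsii, K2, degree_one_Z by auto. unfold mcomp. now rewrite Hpsi.
Qed.

(** Fixing [0] and commuting with the unit translation makes [phi] fix [1] as well, so it restricts
    to each of the three manifolds realized within [[0, 1]]. *)
Lemma unit_stable m phi t : m <> MR -> degree_one phi -> phi 0 = 0 -> inM m t -> inM m (phi t).
Proof.
  intros Hm [Hi Hs] H0. assert (H1 : phi 1 = 1) by (replace 1 with (0 + 1) at 1 by ring; rewrite Hs; lra).
  assert (Hlo : 0 <= t -> 0 <= phi t) by (intros H; rewrite <- H0; now apply incr_le).
  assert (Hhi : t <= 1 -> phi t <= 1) by (intros H; rewrite <- H1; now apply incr_le).
  assert (Hhi' : t < 1 -> phi t < 1) by (intros H; rewrite <- H1; now apply Hi).
  destruct m; simpl; tauto.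
Qed.

Lemma compact_case m G S d alpha : m <> MR -> (forall f, G f -> Homeo_plus m f) -> is_subgroup m G ->
  symmetric_set S -> generates S G -> poly_growth S d -> 0 < alpha -> alpha * INR d < 1 ->
  exists psi psi_inv : Mmap m, is_homeo m psi /\ inverse_maps psi psi_inv /\
    forall g, G g -> Diff1alpha m alpha (mcomp psi (mcomp g psi_inv)).
Proof.
  intros Hm HG Hsub Hsym Hgen Hgrow Hal Hald.
  destruct (lift_lgroup m G S d Hm HG Hsub Hsym Hgen Hgrow) as [[C HL] Hex].
  destruct (smoothing_homeo _ _ C d alpha HL Hal Hald) as (phi & phii & Hinc & HI & P0 & Hsh & Hor).
  assert (Hphi : degree_one phi) by now split.
  assert (Hphii : degree_one phii) by now apply (degree_one_inv phi).
  assert (P0i : phii 0 = 0) by (rewrite <- P0 at 1; apply HI).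
  set (psi := fun x : pt m => exist (inM m) (phi (val x)) (unit_stable m phi (val x) Hm Hphi P0 (proj2_sig x)) : pt m).
  set (psi_inv := fun x : pt m => exist (inM m) (phii (val x)) (unit_stable m phii (val x) Hm Hphii P0i (proj2_sig x)) : pt m).
  assert (Vpsi : forall x, val (psi x) = phi (val x)) by reflexivity.
  assert (Vpsii : forall x, val (psi_inv x) = phii (val x)) by reflexivity.
  assert (HIm : inverse_maps psi psi_inv).
  { split; apply functional_extensionality; intros x; apply val_inj; unfold mcomp, idm.
    - now rewrite Vpsii, Vpsi, (proj1 HI).
    - now rewrite Vpsi, Vpsii, (proj2 HI). }
  assert (Hself : forall f (q : Mmap m), f 0 = 0 -> (forall x, val (q x) = f (val x)) -> lift_rel m q f).
  { intros f q F0 Hq. destruct (classic (m = Mcircle)) as [Ec|Hc].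
    - clear -Hq Ec. subst m. intros x. exists 0%Z. rewrite Hq. ring.
    - rewrite linear_lift_rel by auto. exists 0%Z. split; [now rewrite F0|]. intros x. rewrite Hq. ring. }
  assert (Hc1 : continuous_M m psi).
  { apply (induces_continuous m phi phii); auto. apply lift_rel_induces; auto. }
  assert (Hc2 : continuous_M m psi_inv).
  { apply (induces_continuous m phii phi); [apply Hphii|now apply inv_of_sym|]. apply lift_rel_induces; auto. }
  exists psi, psi_inv. split; [exists psi_inv; auto|]. split; auto.
  apply conjugate_Diff; auto.
  - intros x y Hxy. rewrite !Vpsi. now apply Hinc.
  - intros x y Hxy. rewrite !Vpsii. now apply Hphii.
  - intros g Hg. destruct (Hex g Hg) as [F [HF Hr]].
    assert (HFl : lifts m G (lift_rel m) F) by (split; eauto).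
    assert (Hd : degree_one (fun u => phi (F (phii u)))).
    { apply (degree_one_comp phi (fun u => F (phii u))); auto. now apply (degree_one_comp F phii). }
    assert (HC : C1a alpha (fun u => phi (F (phii u)))).
    { destruct Hor as [Htr|[_ Hor]]; [|now apply Hor].
      destruct (Htr F HFl) as [c Hc]. apply (translate_C1a alpha _ c). intros u. now rewrite Hc, (proj2 HI). }
    destruct HC as (D & K & HDK).
    apply (induces_smooth m alpha (fun u => phi (F (phii u))) _ D K); auto.
    + apply lift_rel_induces; auto. now apply lift_rel_conj.
    + now apply (lift_rel_periodic m alpha (fun u => phi (F (phii u))) D K).
Qed.

Lemma line_case (G : Mmap MR -> Prop) S d alpha : (forall f, G f -> Homeo_plus MR f) -> is_subgroup MR G ->
  symmetric_set S -> generates S G -> poly_growth S d -> 0 < alpha -> alpha * INR d < 1 ->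
  exists psi psi_inv : Mmap MR, is_homeo MR psi /\ inverse_maps psi psi_inv /\
    forall g, G g -> Diff1alpha MR alpha (mcomp psi (mcomp g psi_inv)).
Proof.
  intros HG Hsub Hsym Hgen Hgrow Hal Hald.
  set (emb := fun x : pt MR => theta_inv (val x)).
  assert (Hm : MR <> Mcircle) by discriminate.
  assert (E1 : forall x, 0 <= emb x <= 1) by (intros x; pose proof (theta_inv_range (val x)); unfold emb; lra).
  assert (E2 : forall x y : pt MR, val x < val y <-> emb x < emb y).
  { intros x y. split; [apply theta_inv_incr|apply incr_lt_inv, theta_inv_incr]. }
  assert (E3 : forall t, 0 < t < 1 -> exists x : pt MR, emb x = t).
  { intros t Ht. destruct (@mk_pt MR (theta t) I) as [x Hx]. exists x. unfold emb. rewrite Hx. now apply theta_inv_theta. }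
  destruct (linear_lgroup MR G S d emb Hm HG Hsub Hsym Hgen Hgrow E1 E2 E3) as [C HL].
  destruct (smoothing_homeo _ _ C d alpha HL Hal Hald) as (phi & phii & Hinc & HI & P0 & Hsh & Hor).
  assert (Hphi : degree_one phi) by now split.
  assert (Hphii : degree_one phii) by now apply (degree_one_inv phi).
  assert (P0i : phii 0 = 0) by (rewrite <- P0 at 1; apply HI).
  assert (P1 : phi 1 = 1) by (replace 1 with (0 + 1) at 1 by ring; rewrite Hsh; lra).
  assert (P1i : phii 1 = 1) by (rewrite <- P1 at 1; apply HI).
  assert (Hin : forall f, incr f -> f 0 = 0 -> f 1 = 1 -> forall t, 0 < t < 1 -> 0 < f t < 1).
  { intros f Hf F0 F1 t Ht. split; [rewrite <- F0|rewrite <- F1]; apply Hf; lra. }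
  set (lft := fun (f : R -> R) u => theta (f (theta_inv u))).
  assert (Hlinc : forall f, incr f -> f 0 = 0 -> f 1 = 1 -> incr (lft f)).
  { intros f Hf F0 F1 u v Huv. apply theta_inv_incr in Huv. unfold lft.
    pose proof (Hin f Hf F0 F1 _ (theta_inv_range u)). pose proof (Hin f Hf F0 F1 _ (theta_inv_range v)).
    apply theta_incr; try lra. now apply Hf. }
  assert (Hlinv : inv_of (lft phi) (lft phii)).
  { split; intros u; unfold lft.
    - rewrite theta_inv_theta, (proj1 HI), theta_theta_inv; auto. apply Hin; auto. apply theta_inv_range.
    - rewrite theta_inv_theta, (proj2 HI), theta_theta_inv; auto. apply Hin; auto; [apply Hphii|apply theta_inv_range]. }
  set (psi := fun x : pt MR => exist (inM MR) (lft phi (val x)) I : pt MR).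
  set (psi_inv := fun x : pt MR => exist (inM MR) (lft phii (val x)) I : pt MR).
  assert (Vpsi : forall x, val (psi x) = lft phi (val x)) by reflexivity.
  assert (Vpsii : forall x, val (psi_inv x) = lft phii (val x)) by reflexivity.
  assert (HIm : inverse_maps psi psi_inv).
  { split; apply functional_extensionality; intros x; apply val_inj; unfold mcomp, idm.
    - now rewrite Vpsii, Vpsi, (proj1 Hlinv).
    - now rewrite Vpsi, Vpsii, (proj2 Hlinv). }
  assert (I1 : incr (lft phi)) by now apply Hlinc.
  assert (I2 : incr (lft phii)) by (apply Hlinc; auto; apply Hphii).
  assert (Hc1 : continuous_M MR psi).
  { apply (induces_continuous MR (lft phi) (lft phii)); auto. apply (linear_induces MR _ _ 0); auto.
    intros x. rewrite Vpsi. ring. }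
  assert (Hc2 : continuous_M MR psi_inv).
  { apply (induces_continuous MR (lft phii) (lft phi)); auto; [now apply inv_of_sym|]. apply (linear_induces MR _ _ 0); auto.
    intros x. rewrite Vpsii. ring. }
  exists psi, psi_inv. split; [exists psi_inv; auto|]. split; auto.
  apply conjugate_Diff; auto.
  { intros x y Hxy. rewrite !Vpsi. now apply I1. }
  { intros x y Hxy. rewrite !Vpsii. now apply I2. }
  intros g Hg.
  destruct (linear_rel_ex MR Hm emb E1 E2 E3 g (HG g Hg)) as [F' [HF' [k [K1 K2]]]].
  (* The lift is normalized to fix [0] and [1], so that it describes [g] itself on the unit
     interval. *)
  set (F := fun x => F' x + IZR (- k)).
  assert (HF : degree_one F) by (apply (degree_one_comp (fun x => x + IZR (- k)) F'); auto; apply degree_one_trans).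
  assert (F0 : F 0 = 0) by (unfold F; rewrite K1, opp_IZR; ring).
  assert (F1 : F 1 = 1) by (replace 1 with (0 + 1) at 1 by ring; rewrite (proj2 HF); lra).
  assert (Fe : forall x, F (emb x) = emb (g x)) by (intros x; unfold F; rewrite K2, opp_IZR; ring).
  assert (HFl : lifts MR G (linear_rel MR emb) F).
  { split; auto. exists g. split; auto. exists 0%Z. split; auto. intros x. rewrite Fe. ring. }
  destruct Hor as [Htr|[Hal1 Hor]].
  (* A lift that fixes [0] and is conjugate to a translation by [phi] is the identity, so in this
     alternative [g] is trivial. *)
  - destruct (Htr F HFl) as [c Hc]. assert (c = 0) by (pose proof (Hc 0) as E; rewrite F0, P0 in E; lra). subst c.
    assert (Fid : forall x, F x = x) by (intros x; apply (incr_inj phi); auto; rewrite Hc; ring).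
    assert (Eg : g = idm).
    { apply functional_extensionality; intros x. apply val_inj. apply (incr_inj theta_inv); [apply theta_inv_incr|].
      change (emb (g x) = emb x). now rewrite <- Fe. }
    replace (mcomp psi (mcomp g psi_inv)) with (@idm MR); [now apply smooth_id|].
    rewrite Eg. symmetry. apply HIm.
  - destruct (Hor F HFl) as (D & K & HDK).
    destruct (ig_inv _ (lg_ig _ _ _ _ HL) F HFl) as [Fi [HFi HIF]].
    apply (line_smooth alpha (fun u => phi (F (phii u))) D K (fun u => phi (Fi (phii u)))); auto.
    + intros u v Huv. apply Hinc. apply HF. now apply Hphii.
    + split; intros u; rewrite (proj1 HI); [rewrite (proj1 HIF)|rewrite (proj2 HIF)]; apply HI.
    + now rewrite P0i, F0.
    + now rewrite P1i, F1.
    + intros x. unfold mcomp. rewrite Vpsi. unfold lft at 1. do 2 f_equal.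
      change (emb (g (psi_inv x)) = F (phii (theta_inv (val x)))). rewrite <- Fe. f_equal.
      unfold emb. rewrite Vpsii. unfold lft. apply theta_inv_theta.
      apply Hin; auto; [apply Hphii|apply theta_inv_range].
Qed.

Theorem theorem1p4 (m : oneManifold) (G : Mmap m -> Prop) (S : list (Mmap m))
  (d : nat) (alpha : R) :
  (forall f, G f -> Homeo_plus m f) ->
  is_subgroup m G ->
  symmetric_set S -> generates S G ->
  virtually_nilpotent G ->
  poly_growth S d ->
  0 < alpha -> alpha * INR d < 1 ->
  exists psi psi_inv : Mmap m,
    is_homeo m psi /\ inverse_maps psi psi_inv /\
    forall g, G g -> Diff1alpha m alpha (mcomp psi (mcomp g psi_inv)).
Proof.
  intros HG Hsub Hsym Hgen _ Hgrow Hal Hald. destruct (classic (m = MR)) as [->|Hm].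
  - now apply (line_case G S d).
  - now apply (compact_case m G S d).
Qed.
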